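(* Let $t>0$ be fixed, let $a>0$, and let $A\in\mathbb{C}$. Consider doubly infinite sequences $\{T_k\}_{k\in\mathbb{Z}}$ in $S^a(\mathbb{R}^d)'$ satisfying, for all $k\in\mathbb{Z}$, (1) $e^{-t\Delta}T_k=AT_{k+1}$, and (2) $|\langle T_k,\psi\rangle|\le M\gamma(\psi)$ for all $\psi\in S^a(\mathbb{R}^d)$, for a fixed seminorm $\gamma$ of $S^a(\mathbb{R}^d)$ and a constant $M>0$ (both independent of $k$). Then: (a) If $|A|=e^{ta^2}$, then $\Delta T_0=-a^2T_0$ for every such sequence. (b) If $|A|>e^{ta^2}$, then $T_0=0$ for every such sequence. (c) If $0\ne|A|<e^{ta^2}$, then $T_0$ may not be an eigendistribution of $e^{-t\Delta}$; that is, there is a sequence satisfying (1) and (2) for some $\gamma$ and $M$ such that $e^{-t\Delta}T_0=\mu T_0$ holds for no $\mu\in\mathbb{C}$. (d) If $A=0$, then for every such sequence $T_k=0$ for all integers $k$.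
   Context: $\Delta=-\sum_{j=1}^d\frac{\partial^2}{\partial x_j^2}$ (note the sign). For $a\ge0$, $S^a(\mathbb{R}^d)$ is the space of $C^\infty$ functions $f$ on $\mathbb{R}^d$ with $\gamma_{m,\alpha}(f)=\sup_{x\in\mathbb{R}^d}e^{a|x|}(1+|x|)^m|D^\alpha f(x)|<\infty$ for all integers $m\ge0$ and all multi-indices $\alpha$; it is a Fréchet space under these seminorms. A seminorm of $S^a(\mathbb{R}^d)$ means a continuous seminorm for this topology. The (continuous) dual $S^a(\mathbb{R}^d)'$ is the space of exponential tempered distributions of type $a$. For $T\in S^a(\mathbb{R}^d)'$, $\langle\Delta T,\psi\rangle=\langle T,\Delta\psi\rangle$. The heat operator is $e^{-t\Delta}f=f*h_t$ with $h_t(x)=(4\pi t)^{-d/2}e^{-|x|^2/(4t)}$, which maps $S^a(\mathbb{R}^d)$ continuously to itself; for $T\in S^a(\mathbb{R}^d)'$, $\langle e^{-t\Delta}T,f\rangle=\langle T,e^{-t\Delta}f\rangle$ for $f\in S^a(\mathbb{R}^d)$. *)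

(* Defs.v *)
From HB Require Import structures.
From mathcomp Require Import all_boot all_order all_algebra.
From mathcomp Require Import complex.
From mathcomp Require Import all_classical all_reals all_analysis.
Set Implicit Arguments.
Unset Strict Implicit.
Unset Printing Implicit Defensive.
Import Order.TTheory GRing.Theory Num.Theory.
Import numFieldNormedType.Exports ComplexField.Normc.
Local Open Scope classical_set_scope.
Local Open Scope ring_scope.

(* Lebesgue measure on R^n, carried by the measurable type of n-tuples: the
   unit mass at the empty tuple for n = 0, then the image of the product
   measure under (x, v) |-> x :: v. *)
Section lebesgue_tuple.
Variable R : realType.
Local Notation RT := (measurableTypeR R).

Definition consp n (p : RT * n.-tuple RT) : n.+1.-tuple RT :=
  [tuple of p.1 :: p.2].

Definition unconsp n (v : n.+1.-tuple RT) : RT * n.-tuple RT :=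
  (thead v, [tuple of behead v]).

Lemma conspK n : cancel (@consp n) (@unconsp n).
Proof.
by case=> x v; rewrite /unconsp /consp theadE /=; congr pair; exact: val_inj.
Qed.

Lemma measurable_consp n : measurable_fun setT (@consp n).
Proof.
exact: (@measurable_cons _ _ _ _ fst n snd measurable_fst measurable_snd).
Qed.

Lemma measurable_unconsp n : measurable_fun setT (@unconsp n).
Proof.
apply: measurable_fun_pair; last exact: measurable_behead.
exact: measurable_tnth.
Qed.

Section step.
Variables (n : nat) (m : {sigma_finite_measure set (n.-tuple RT) -> \bar R}).

Definition consm : set (n.+1.-tuple RT) -> \bar R :=
  pushforward (@lebesgue_measure R \x m)%E (@consp n).

Let consm_measure : {measure set (n.+1.-tuple RT) -> \bar R} :=
  measure_function_pushforward__canonical__measure_function_Measure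
    (@lebesgue_measure R \x m)%E (@measurable_consp n).

HB.instance Definition _ := Measure.copy consm consm_measure.

Let consm_sigma_finite : sigma_finite setT consm.
Proof.
have /sigma_finiteP[F [TF ndF Foo]] := sigma_finiteT (@lebesgue_measure R).
have /sigma_finiteP[G [TG ndG Goo]] := sigma_finiteT m.
exists (fun i => @unconsp n @^-1` (F i `*` G i)).
  rewrite -preimage_bigcup -[RHS](_ : @unconsp n @^-1` setT = _).
    exact: preimage_setT.
  congr (_ @^-1` _); rewrite -setXTT TF TG predeqE => -[x y]; split.
    move=> [/= [i _ Fix] [j _ Gjy]]; exists (maxn i j) => //; split.
    - by move: x Fix; exact/subsetPset/ndF/leq_maxl.
    - by move: y Gjy; exact/subsetPset/ndG/leq_maxr.
  by move=> [i _ []/= ? ?]; split; exists i.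
move=> i; have [mF Fi] := Foo i; have [mG Gi] := Goo i; split.
  rewrite -[X in measurable X]setTI; apply: measurable_unconsp => //.
  exact: measurableX.
rewrite /consm /pushforward -comp_preimage.
rewrite (_ : _ \o _ = id); last by rewrite funeqE => p /=; rewrite conspK.
by rewrite preimage_id product_measure1E// lte_mul_pinfty// ge0_fin_numE.
Qed.

HB.instance Definition _ :=
  @Measure_isSigmaFinite.Build _ _ _ consm consm_sigma_finite.

End step.

Fixpoint lebesgue_tuple (n : nat) :
    {sigma_finite_measure set (n.-tuple RT) -> \bar R} :=
  match n with
  | 0 => dirac [tuple]
  | n'.+1 => consm (lebesgue_tuple n')
  end.

End lebesgue_tuple.

Section euclidean_space.
Variables (R : realType) (d : nat).
Local Notation V := 'rV[R]_d.
Local Notation C := R[i].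
Implicit Types (u : V -> R) (f g psi : V -> C) (x y : V).

(* The norm of the library on 'rV[R]_d is the sup norm, hence this one. *)
Definition enorm x : R := Num.sqrt (\sum_(j < d) x 0 j ^+ 2).

Definition rint (F : V -> R) : R :=
  \int[@lebesgue_tuple R d]_(y in setT) F (\row_j tnth y j).

Definition cint (F : V -> C) : C :=
  (rint (fun y => complex.Re (F y)) +i* rint (fun y => complex.Im (F y)))%C.

(* Iterated partial derivatives; the head of the word is applied last. *)
Definition rderiv (s : seq 'I_d) u : V -> R :=
  foldr (fun j v x => 'D_(delta_mx 0 j) v x) u s.

Definition rsmooth u : Prop :=
  forall s, continuous (rderiv s u) /\
    forall x j, derivable (rderiv s u) x (delta_mx 0 j).

Definition cderiv (s : seq 'I_d) f : V -> C :=
  fun x => (rderiv s (fun y => complex.Re (f y)) x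
         +i* rderiv s (fun y => complex.Im (f y)) x)%C.

Definition smooth f : Prop :=
  rsmooth (fun x => complex.Re (f x)) /\ rsmooth (fun x => complex.Im (f x)).

Definition multi_index := {ffun 'I_d -> nat}.

(* D^alpha = d_0^(alpha 0) d_1^(alpha 1) ... d_(d-1)^(alpha (d-1)) *)
Definition mderiv (alpha : multi_index) f : V -> C :=
  cderiv (flatten [seq nseq (alpha j) j | j <- enum 'I_d]) f.

Definition laplacian f : V -> C :=
  fun x => - \sum_(j < d) cderiv [:: j; j] f x.

Definition heat_kernel (t : R) x : R :=
  (4 * pi * t) `^ (- (d%:R / 2)) * expR (- (enorm x ^+ 2 / (4 * t))).

Definition convolution f (h : V -> R) : V -> C :=
  fun x => cint (fun y => f (x - y) * (h y)%:C%C).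

Definition heat (t : R) f : V -> C := convolution f (heat_kernel t).

Section Sa.
Variable a : R.

Definition Sa_gamma (i : nat * multi_index) f : \bar R :=
  ereal_sup (range (fun x =>
    (expR (a * enorm x) * (1 + enorm x) ^+ i.1
       * normc (mderiv i.2 f x))%:E)).

Definition Sa : set (V -> C) :=
  [set f | smooth f /\ forall i, (Sa_gamma i f < +oo)%E].

(* The neighbourhoods of f in the topology of S^a generated by the Sa_gamma i.
   Functions outside S^a are never constrained. *)
Definition Sa_nbhs f : set_system (V -> C) :=
  [set U | exists (s : seq (nat * multi_index)) (e : R), 0 < e /\
     forall g, Sa g ->
       (forall i, i \in s -> (Sa_gamma i (fun x => (g x - f x)%R) < e%:E)%E) -> U g].

Definition Sa_seminorm (p : (V -> C) -> R) : Prop :=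
  [/\ forall f g, Sa f -> Sa g -> p (fun x => f x + g x) <= p f + p g,
      forall c f, Sa f -> p (fun x => c * f x) = normc c * p f
    & forall f, Sa f -> p g @[g --> Sa_nbhs f] --> p f].

(* Distributions are total functions on V -> C of which only the values on
   S^a matter: Sa_dual and Sa_eq see nothing else, so that S^a(R^d)' is the
   set of the T such that Sa_dual T, modulo Sa_eq. *)
Definition distr := (V -> C) -> C.
Implicit Types T U : distr.

Definition Sa_dual T : Prop :=
  [/\ forall f g, Sa f -> Sa g -> T (fun x => f x + g x) = T f + T g,
      forall c f, Sa f -> T (fun x => c * f x) = c * T f
    & forall f, Sa f ->
        normc (T g - T f) @[g --> Sa_nbhs f] --> (0 : R)].

Definition Sa_eq T U : Prop := forall psi, Sa psi -> T psi = U psi.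

End Sa.

Definition distr_zero : distr := fun=> 0.
Definition distr_scale (c : C) (T : distr) : distr := fun psi => c * T psi.
Definition distr_laplacian (T : distr) : distr := fun psi => T (laplacian psi).
Definition distr_heat (t : R) (T : distr) : distr := fun psi => T (heat t psi).

Definition heat_sequence (t a : R) (A : C) (T : int -> distr) : Prop :=
  [/\ forall k, Sa_dual a (T k),
      forall k, Sa_eq a (distr_heat t (T k)) (distr_scale A (T (k + 1)))
    & exists (p : (V -> C) -> R) (M : R),
        [/\ Sa_seminorm a p, 0 < M
          & forall k psi, Sa a psi ->
              normc (T k psi) <= M * p psi]].

End euclidean_space.

(* Main.v *)
Require Import Defs.
From HB Require Import structures.
From mathcomp Require Import all_boot all_order all_algebra.
From mathcomp Require Import complex.
From mathcomp Require Import all_classical all_reals all_analysis.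
From mathcomp Require Import measurable_realfun.
From mathcomp Require Import zify ring lra.
Set Implicit Arguments.
Unset Strict Implicit.
Unset Printing Implicit Defensive.
Import Order.TTheory GRing.Theory Num.Theory.
Import numFieldNormedType.Exports ComplexField.Normc.
Local Open Scope classical_set_scope.
Local Open Scope ring_scope.

(* Write L = Delta + a^2 and P_s = exp (- s L), and B = A exp (- t a^2), so that
   T_k P_t = B T_(k+1). Comparing |x - y| with w.y for w = x / |x|, and
   translating the Gaussian by means of the factor exp (a w.y), shows that P_s
   is a contraction for the norm sup exp (a |x|) |u|, and that P_t ^ k
   multiplies the norms with a further factor (1 + |x|) ^ m by O(k ^ m) only.
   - If |B| > 1, then B ^ k T_0 = T_(-k) P_t ^ k grows at most polynomially in k,
     so that T_0 = 0.
   - If |B| = 1, one has moreover (1 - P_s) P_r = O(r ^ (-1/2)) for the norm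
     without polynomial factor; interpolating with the polynomial growth of the
     other norms, T_0 (1 - P_s) ^ N = 0 for N large. For s = t / j the sequences
     T_0 P_s ^ n u are bounded, and a bounded sequence with vanishing second
     difference is constant, which brings N down to 1. Differentiating
     T_0 P_s = T_0 yields T_0 L = 0.
   - If A = 0, then T_k exp (- t Delta) = 0. As |Delta ^ n exp (- r Delta)| is at
     most (C n / r) ^ n, Taylor expansion carries T_k exp (- s Delta) = 0 to the
     earlier time (1 - theta) s, with theta independent of s; iterate.
   - If 0 < |A| < exp (t a ^ 2), choose b in ]0, a[ and c with
     exp (t (b ^ 2 - c ^ 2)) = |A|; integration against exp ((b + i c) x_1) and
     exp ((b - i c) x_1) gives two eigendistributions whose eigenvalues have
     modulus |A| and differ, and T_0 is their sum. *)

(** * Integration on R^d *)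

(** The critical modulus is dictated by the exponentials [exp (z.x)] with [|Re z| <= a], which act
    on S^a: [e^(-t Delta)] multiplies them by [exp (t z.z)], of modulus
    [exp (t (|Re z|^2 - |Im z|^2))]. It reaches [exp (t a^2)] only for [z] real with [|z| = a],
    where [Delta] acts as [- a^2]; below that value one modulus is shared by eigenvalues of
    different phases. The obstacle in the critical case is that (2) bounds [T_k] by a seminorm with
    polynomial factors, for which powers of [P_t] are only known to grow polynomially, whereas the
    gain of [1 - P_s] is proved for the norm without such a factor. Many factors [1 - P_s] are
    therefore spent on beating the growth and have to be removed afterwards. The removal needs
    bounded orbits under [P_s], which (1) and (2) control for whole steps [t]: hence [s = t / j].
    These [s] tend to 0, which is all that the passage to the generator requires. For [A = 0] the
    relation (1) links no two of the [T_k]; what is proved amounts to the density of the range of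
    [e^(-t Delta)]. *)

Section lebesgue_tuple_integral.
Variable R : realType.
Local Notation RT := (measurableTypeR R).
Local Notation tup d := (d.-tuple RT).
Local Notation mu d := (@lebesgue_tuple R d).

Lemma lebesgue_measure_shift (c : R) (A : set R) : measurable A ->
  pushforward (@lebesgue_measure R) ((fun x => x + c) : _ -> RT) A
  = lebesgue_measure A.
Proof.
move=> mA.
have mS : measurable_fun setT ((fun x => x + c) : RT -> RT).
  by apply: continuous_measurable_fun => x; apply: cvgD; [exact: cvg_id|exact: cvg_cst].
pose m := measure_function_pushforward__canonical__measure_function_Measure
  (@lebesgue_measure R) mS.
apply/esym/(@lebesgue_measure_unique R m) => //= _ [[a b]] _ <-.
rewrite /pushforward.
have -> : ((fun x => x + c) : RT -> RT) @^-1` `]a, b] = `](a - c), (b - c)]%classic.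
  by apply/seteqP; split => x /=; rewrite !in_itv/= ltrBlDr lerBrDr.
rewrite !lebesgue_measure_itv/= !lte_fin ltrD2r -!EFinB.
by congr (if _ then _ else _); congr EFin; ring.
Qed.

Lemma ge0_integral_shift (c : R) (f : R -> \bar R) :
  measurable_fun [set: RT] f -> (forall x, 0 <= f x)%E ->
  (\int[@lebesgue_measure R]_x f (x + c)%R = \int[@lebesgue_measure R]_x f x)%E.
Proof.
move=> mf f0.
have mS : measurable_fun setT ((fun x => x + c) : RT -> RT).
  by apply: continuous_measurable_fun => x; apply: cvgD; [exact: cvg_id|exact: cvg_cst].
transitivity (\int[pushforward (@lebesgue_measure R) ((fun x => (x + c)%R) : RT -> RT)]_x f x)%E.
  rewrite ge0_integral_pushforward//.
apply: eq_measure_integral => //= A mA _.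
exact: lebesgue_measure_shift.
Qed.

Lemma tnth_consp0 n (x : R) (v : tup n) : tnth (consp (x, v)) ord0 = x.
Proof. by []. Qed.

Lemma tnth_consp_lift n (x : R) (v : tup n) (j : 'I_n) :
  tnth (consp (x, v)) (lift ord0 j) = tnth v j.
Proof. exact: tnthS. Qed.

Lemma ge0_integral_lebesgue_tupleS n (f : tup n.+1 -> \bar R) :
  measurable_fun setT f -> (forall x, 0 <= f x)%E ->
  (\int[mu n.+1]_y f y =
   \int[@lebesgue_measure R]_x \int[mu n]_v f (consp (x, v)))%E.
Proof.
move=> mf f0.
have mc := @measurable_consp R n.
transitivity (\int[(@lebesgue_measure R \x mu n)%E]_p f (consp p))%E.
  by rewrite [LHS]ge0_integral_pushforward//.
rewrite fubini_tonelli1//.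
exact: measurableT_comp.
Qed.

Definition tshift d (c : 'I_d -> R) (y : tup d) : tup d :=
  [tuple tnth y j + c j | j < d].

Lemma measurable_tshift d (c : 'I_d -> R) : measurable_fun setT (tshift c).
Proof.
apply/measurable_fun_tnthP => j.
rewrite (_ : _ \o _ = (fun x => x + c j) \o (@tnth d RT ^~ j)); last first.
  by apply/funext => y /=; rewrite tnth_mktuple.
apply: measurableT_comp; last exact: measurable_tnth.
by apply: continuous_measurable_fun => x; apply: cvgD; [exact: cvg_id|exact: cvg_cst].
Qed.

Lemma ge0_integral_tshift d (c : 'I_d -> R) (f : tup d -> \bar R) :
  measurable_fun setT f -> (forall x, 0 <= f x)%E ->
  (\int[mu d]_y f (tshift c y) = \int[mu d]_y f y)%E.
Proof.
elim: d c f => [c f mf f0|d IH c f mf f0].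
  by apply: eq_integral => y _; congr f; rewrite tuple0 [RHS]tuple0.
have mfc x : measurable_fun setT (fun v => f (consp (x, v))).
  apply: measurableT_comp => //.
  by apply: (measurableT_comp (@measurable_consp R d)); exact: measurable_pair1.
rewrite !ge0_integral_lebesgue_tupleS//; last first.
  by apply: measurableT_comp => //; exact: measurable_tshift.
rewrite -[RHS](ge0_integral_shift (c ord0)).
- apply: eq_integral => x _.
  rewrite -(IH (fun j => c (lift ord0 j)) (fun v => f (consp ((x + c ord0)%R, v))))//.
  apply: eq_integral => v _.
  congr f; apply: eq_from_tnth => j; rewrite tnth_mktuple.
  case: (unliftP ord0 j) => [i ->|->]; last by rewrite !tnth_consp0.
  by rewrite !tnth_consp_lift tnth_mktuple.
- apply: (@measurable_fun_fubini_tonelli_F _ _ _ _ R (mu d) (f \o @consp R d)) => //.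
    by apply: measurableT_comp => //; exact: measurable_consp.
  by move=> x; exact: f0.
- by move=> x; exact: integral_ge0.
Qed.

(** Reduces to dimension one both the mass of the Gaussian and the integrability of a product of
    Cauchy densities. *)
Lemma integral_lebesgue_tuple_prod d (g : R -> R) :
  measurable_fun [set: RT] g -> (forall x, 0 <= g x) ->
  (\int[mu d]_y (\prod_(j < d) g (tnth y j))%:E
   = \prod_(j < d) \int[@lebesgue_measure R]_x (g x)%:E)%E.
Proof.
move=> mg g0; elim: d => [|d IH].
  rewrite big_ord0; under eq_integral do rewrite big_ord0.
  by rewrite integral_dirac//= diracT mul1e.
have mprod n : measurable_fun [set: tup n] (fun y => \prod_(j < n) g (tnth y j)).
  apply: measurable_prod => j _.
  by apply: measurableT_comp => //; exact: measurable_tnth.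
rewrite ge0_integral_lebesgue_tupleS; last 2 first.
- by apply/measurable_EFinP; exact: mprod.
- by move=> y; rewrite lee_fin prodr_ge0.
rewrite big_ord_recl -IH.
rewrite -ge0_integralZr//; last 3 first.
- by apply/measurable_EFinP.
- by move=> x _; rewrite lee_fin.
- by apply: integral_ge0 => y _; rewrite lee_fin prodr_ge0.
apply: eq_integral => x _.
rewrite -ge0_integralZl//; last 3 first.
- by apply/measurable_EFinP; exact: mprod.
- by move=> y _; rewrite lee_fin prodr_ge0.
- by rewrite lee_fin.
apply: eq_integral => y _; rewrite big_ord_recl -EFinM; congr (_ * _)%:E.
by apply: eq_bigr => j _; rewrite tnth_consp_lift.
Qed.

End lebesgue_tuple_integral.

(** * Signed integrals over row vectors: translation, domination, Fubini *)

Section rint_theory.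
Variables (R : realType) (d : nat).
Local Notation RT := (measurableTypeR R).
Local Notation V := 'rV[R]_d.
Local Notation mu := (@lebesgue_tuple R d).

Definition row_of (y : d.-tuple RT) : V := \row_j tnth y j.
Definition measurableV (F : V -> R) :=
  measurable_fun [set: d.-tuple RT] (F \o row_of).
Definition integrableV (F : V -> R) :=
  mu.-integrable [set: d.-tuple RT] (EFin \o (F \o row_of)).

(* The sigma-algebra of the tuples is generated by the coordinates: continuous
   functions are measurable as limits of functions of the points of a grid. *)
Definition grid (n : nat) (z : d.-tuple int) : V := \row_j ((tnth z j)%:~R / n.+1%:R).

Lemma measurable_grid (n : nat) (F : V -> R) :
  measurable_fun [set: d.-tuple RT]
    (fun y : d.-tuple RT => F (grid n [tuple Num.floor (n.+1%:R * tnth y j) | j < d])).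
Proof.
move=> _ B mB; rewrite setTI.
rewrite [X in measurable X](_ : _ =
  \bigcup_(z in [set z | F (grid n z) \in B])
    [set y : d.-tuple RT | forall j, Num.floor (n.+1%:R * tnth y j) = tnth z j]); last first.
  apply/seteqP; split => [y /= By|y /= [z /= Bz yz]].
    exists [tuple Num.floor (n.+1%:R * tnth y j) | j < d] => /=; first by rewrite inE.
    by move=> j; rewrite tnth_mktuple.
  rewrite inE in Bz.
  rewrite (_ : [tuple _ | j < d] = z)//.
  by apply: eq_from_tnth => j; rewrite tnth_mktuple yz.
rewrite bigcup_mkcond.
apply: countable_bigcupT_measurable => // z.
case: ifPn => // _.
rewrite [X in measurable X](_ : _ = \bigcap_(j in [set: 'I_d])
   ((@tnth d RT ^~ j) @^-1` [set x | Num.floor (n.+1%:R * x) = tnth z j])); last first.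
  by apply/seteqP; split => [y /= yz j _|y /= yz j]; [exact: yz|exact: (yz j)].
apply: fin_bigcap_measurable => [//|j _].
rewrite -[X in measurable X]setTI; apply: measurable_tnth => //.
rewrite (_ : [set x | _] = `[(tnth z j)%:~R / n.+1%:R, ((tnth z j)%:~R + 1) / n.+1%:R[%classic).
  exact: measurable_itv.
apply/seteqP; split => x /=; rewrite in_itv/=.
  move=> /eqP; rewrite floor_eq intrD => /andP[h1 h2].
  by rewrite ler_pdivrMr// ltr_pdivlMr// ![x * _]mulrC h1.
move=> /andP[h1 h2]; apply/eqP; rewrite floor_eq intrD.
by rewrite ler_pdivrMr// ltr_pdivlMr// ![x * _]mulrC in h1 h2 *; rewrite h1 h2.
Qed.

Lemma cvg_grid (y : d.-tuple RT) :
  grid n [tuple Num.floor (n.+1%:R * tnth y j) | j < d] @[n --> \oo] --> row_of y.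
Proof.
apply/cvg_ballP => e e0.
have [N _ HN] : \forall n \near \oo, n.+1%:R^-1 < e.
  have := @cvg_harmonic R; move/cvgrPdist_lt => /(_ _ e0); apply: filterS => n.
  by rewrite sub0r normrN ger0_norm// /harmonic/= invr_ge0.
exists N => // n Nn; split => // i j.
rewrite !mxE tnth_mktuple /ball/=.
apply: le_lt_trans (HN _ Nn).
set x := tnth y j.
have -> : x - (Num.floor (n.+1%:R * x))%:~R / n.+1%:R
       = (n.+1%:R * x - (Num.floor (n.+1%:R * x))%:~R) / n.+1%:R.
  by rewrite mulrBl mulrAC mulfV ?mul1r.
rewrite normrM [X in _ * X]gtr0_norm ?invr_gt0// -[leRHS]mul1r ler_wpM2r ?invr_ge0//.
have := floor_itv (n.+1%:R * x); rewrite intrD => /andP[h1 h2].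
by rewrite ger0_norm ?subr_ge0// lerBlDl ltW.
Qed.

Lemma continuous_measurableV (F : V -> R) : continuous F -> measurableV F.
Proof.
move=> cF.
apply: (@measurable_fun_cvg _ _ _ _
  (fun n (y : d.-tuple RT) => F (grid n [tuple Num.floor (n.+1%:R * tnth y j) | j < d]))).
  by move=> n; exact: measurable_grid.
move=> y _; apply: continuous_cvg; [exact: cF|exact: cvg_grid].
Qed.

(** Double integrals need joint measurability on pairs of tuples; every factor that occurs there is
    a continuous function of an affine combination of the two rows. *)
Lemma continuous_measurableV2 (F : V -> R) (a b : R) (c : V) : continuous F ->
  measurable_fun [set: (d.-tuple RT * d.-tuple RT)%type]
    (fun p => F (a *: row_of p.1 + b *: row_of p.2 + c)).
Proof.
move=> /continuous_measurableV mF.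
rewrite (_ : (fun p => _) = (F \o row_of) \o
  (fun p : d.-tuple RT * d.-tuple RT =>
     [tuple a * tnth p.1 j + b * tnth p.2 j + c 0 j | j < d])); last first.
  apply/funext => p /=; congr F; apply/rowP => j.
  by rewrite !mxE tnth_mktuple.
apply: measurableT_comp => //; apply/measurable_fun_tnthP => j.
rewrite (_ : _ \o _ = fun p : d.-tuple RT * d.-tuple RT =>
    (a * tnth p.1 j + b * tnth p.2 j + c 0 j)); last first.
  by apply/funext => p /=; rewrite tnth_mktuple.
apply: measurable_funD; last exact: measurable_cst.
by apply: measurable_funD; apply: measurable_funM => //;
  [exact: (measurableT_comp (measurable_tnth j) measurable_fst)|
    exact: (measurableT_comp (measurable_tnth j) measurable_snd)].
Qed.

Lemma row_of_tshift (c : V) (y : d.-tuple RT) :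
  row_of (tshift (fun j => c 0 j) y) = row_of y + c.
Proof. by apply/rowP => j; rewrite !mxE tnth_mktuple. Qed.

Lemma measurableV_shift (F : V -> R) (c : V) :
  measurableV F -> measurableV (fun y => F (y + c)).
Proof.
move=> mF; rewrite /measurableV (_ : _ \o _ = (F \o row_of) \o tshift (fun j => c 0 j)).
  by apply: measurableT_comp => //; exact: measurable_tshift.
by apply/funext => y /=; rewrite row_of_tshift.
Qed.

Lemma integral_shiftV (F : V -> R) (c : V) : measurableV F ->
  (\int[mu]_y (F (row_of y + c))%:E = \int[mu]_y (F (row_of y))%:E)%E.
Proof.
move=> mF; pose E : d.-tuple RT -> \bar R := EFin \o (F \o row_of).
have mE : measurable_fun setT E by apply/measurable_EFinP.
rewrite integralE [RHS]integralE.
rewrite -(@ge0_integral_tshift R d (fun j => c 0 j) (E^\+)%E)//; last exact: measurable_funepos.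
rewrite -(@ge0_integral_tshift R d (fun j => c 0 j) (E^\-)%E)//; last exact: measurable_funeneg.
by congr (_ - _)%E; apply: eq_integral => y _; rewrite ?funeposE ?funenegE /E/= row_of_tshift.
Qed.

Lemma rint_shift (F : V -> R) (c : V) : measurableV F ->
  rint (fun y => F (y + c)) = rint F.
Proof. by move=> mF; rewrite /rint/= /Rintegral (integral_shiftV c mF). Qed.

Lemma integrableV_shift (F : V -> R) (c : V) : integrableV F ->
  integrableV (fun y => F (y + c)).
Proof.
move=> /integrableP[/measurable_EFinP mF Foo]; apply/integrableP; split.
  by apply/measurable_EFinP; exact: measurableV_shift.
have mN : measurableV (fun y => `|F y|) by exact: measurableT_comp.
by have /= -> := integral_shiftV c mN.
Qed.

Lemma integrableV_measurable F : integrableV F -> measurableV F.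
Proof. by move=> /integrableP[/measurable_EFinP]. Qed.

Lemma integrableV_dom (F G : V -> R) : measurableV F -> integrableV G ->
  (forall x, `|F x| <= G x) -> integrableV F.
Proof.
move=> mF iG FG; apply: le_integrable iG => //; first exact/measurable_EFinP.
by move=> y _ /=; rewrite lee_fin (le_trans (FG _))// ler_norm.
Qed.

Lemma integrableVD (F G : V -> R) : integrableV F -> integrableV G ->
  integrableV (fun x => F x + G x).
Proof. by move=> iF iG; have := integrableD measurableT iF iG. Qed.

Lemma integrableVZ (k : R) (F : V -> R) : integrableV F ->
  integrableV (fun x => k * F x).
Proof. by move=> iF; have := integrableZl measurableT k iF. Qed.

Lemma integrableVB (F G : V -> R) : integrableV F -> integrableV G ->
  integrableV (fun x => F x - G x).
Proof. by move=> iF iG; have := integrableB measurableT iF iG. Qed.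

Lemma integrableV_norm (F : V -> R) : integrableV F ->
  integrableV (fun x => `|F x|).
Proof. by move=> iF; have := integrable_norm iF. Qed.

Lemma rintD (F G : V -> R) : integrableV F -> integrableV G ->
  rint (fun x => F x + G x) = rint F + rint G.
Proof. by move=> iF iG; rewrite /rint RintegralD. Qed.

Lemma rintB (F G : V -> R) : integrableV F -> integrableV G ->
  rint (fun x => F x - G x) = rint F - rint G.
Proof. by move=> iF iG; rewrite /rint RintegralB. Qed.

Lemma rintZ (k : R) (F : V -> R) : integrableV F ->
  rint (fun x => k * F x) = k * rint F.
Proof. by move=> iF; rewrite /rint RintegralZl. Qed.

Lemma le_rint (F G : V -> R) : integrableV F -> integrableV G ->
  (forall x, F x <= G x) -> rint F <= rint G.
Proof. by move=> iF iG FG; rewrite /rint le_Rintegral. Qed.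

Lemma rint_ge0 (F : V -> R) : (forall x, 0 <= F x) -> 0 <= rint F.
Proof. by move=> F0; exact: Rintegral_ge0. Qed.

Lemma ler_norm_rint (F G : V -> R) : measurableV F -> integrableV G ->
  (forall x, `|F x| <= G x) -> `|rint F| <= rint G.
Proof.
move=> mF iG FG; have iF := integrableV_dom mF iG FG.
apply: (le_trans (le_normr_Rintegral measurableT iF)).
apply: (@le_rint (fun x => `|F x|)) => //; exact: integrableV_norm.
Qed.

(** A product majorant makes the iterated integral of [|F|] finite, so that Tonelli gives the joint
    integrability required by Fubini. All applications provide such a product. *)
Lemma rint_swap (F : V -> V -> R) (G H : V -> R) :
  measurable_fun [set: (d.-tuple RT * d.-tuple RT)%type]
    (fun p => F (row_of p.1) (row_of p.2)) ->
  integrableV G -> integrableV H ->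
  (forall x y, `|F x y| <= G x * H y) ->
  rint (fun x => rint (F x)) = rint (fun y => rint (F ^~ y)).
Proof.
move=> mF iG iH FGH.
have H0 y : 0 <= `|H y| by [].
have FGH' x y : `|F x y| <= `|G x| * `|H y|.
  by rewrite (le_trans (FGH x y))// -normrM ler_norm.
have iF x : integrableV (F x).
  apply: (@integrableV_dom _ (fun y => `|G x| * `|H y|)) => //.
    have := measurableT_comp mF (measurable_pair1 _).
    by move=> /(_ [tuple x 0 j | j < d]); congr (measurable_fun _ _);
      apply/funext => y /=; congr F; apply/rowP => j; rewrite mxE tnth_mktuple.
  by apply: integrableVZ; exact: integrableV_norm.
have iF2 y : integrableV (F ^~ y).
  apply: (@integrableV_dom _ (fun x => `|H y| * `|G x|)) => //.
  - have := measurableT_comp mF (measurable_pair2 _).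
    by move=> /(_ [tuple y 0 j | j < d]); congr (measurable_fun _ _);
      apply/funext => z /=; congr F; apply/rowP => j; rewrite mxE tnth_mktuple.
  - by apply: integrableVZ; exact: integrableV_norm.
  - by move=> x; rewrite mulrC.
have iFF : (mu \x mu)%E.-integrable [set: (d.-tuple RT * d.-tuple RT)%type]
    (fun p => (F (row_of p.1) (row_of p.2))%:E).
  apply/integrable12ltyP; first exact/measurable_EFinP.
  have iGn := integrableV_norm iG; have iHn := integrableV_norm iH.
  apply: (@le_lt_trans _ _ (\int[mu]_x ((rint (fun y => `|H y|))%:E * `|G (row_of x)|%:E))%E).
    apply: ge0_le_integral => //.
    - by move=> x _; exact: integral_ge0.
    - apply: (@measurable_fun_fubini_tonelli_F _ _ _ _ R mu
        (fun p => `|(F (row_of p.1) (row_of p.2))%:E|%E)) => //.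
      by apply: measurableT_comp => //; exact/measurable_EFinP.
    - by apply: measurable_funeM; case/integrableP : iGn.
    move=> x _; rewrite muleC.
    have -> : (rint (fun y => `|H y|))%:E = (\int[mu]_y `|H (row_of y)|%:E)%E.
      by rewrite /rint /Rintegral fineK//; exact: integrable_fin_num.
    rewrite -ge0_integralZl//; last by case/integrableP : iHn.
    apply: ge0_le_integral => //.
    - apply: measurableT_comp => //; apply/measurable_EFinP.
      exact: (integrableV_measurable (iF (row_of x))).
    - by apply: measurable_funeM; case/integrableP : iHn.
    - by move=> y _ /=; rewrite lee_fin.
  rewrite integralZl//; have := integrable_fin_num measurableT iGn.
  by rewrite fin_numE => /andP[_ ?]; rewrite lte_mul_pinfty ?lee_fin ?rint_ge0// ltey.
rewrite /rint/= /Rintegral; congr fine.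
transitivity (\int[mu]_x \int[mu]_y (F (row_of x) (row_of y))%:E)%E.
  apply: eq_integral => x _; rewrite fineK//.
  exact: (integrable_fin_num measurableT (iF (row_of x))).
rewrite (Fubini iFF)/=.
apply: eq_integral => x _; rewrite fineK//.
exact: (integrable_fin_num measurableT (iF2 (row_of x))).
Qed.

End rint_theory.

(** * Gaussians *)

Section continuous_realfun.
Variables (R : realType) (T : topologicalType).
Implicit Types F G : T -> R.

Lemma contC (c : R) : continuous (fun _ : T => c).
Proof. by move=> x; exact: cst_continuous. Qed.

Lemma contD F G : continuous F -> continuous G -> continuous (fun x => F x + G x).
Proof. by move=> cF cG x; have := @continuousD _ R^o _ F G x (cF x) (cG x). Qed.

Lemma contM F G : continuous F -> continuous G -> continuous (fun x => F x * G x).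
Proof. by move=> cF cG x; have := @continuousM _ _ F G x (cF x) (cG x). Qed.

Lemma contN F : continuous F -> continuous (fun x => - F x).
Proof. by move=> cF x; have := @continuousN _ R^o _ F x (cF x). Qed.

Lemma contB F G : continuous F -> continuous G -> continuous (fun x => F x - G x).
Proof. by move=> cF cG; apply: contD => //; exact: contN. Qed.

Lemma contX F n : continuous F -> continuous (fun x => F x ^+ n).
Proof.
move=> cF; elim: n => [|n IH]; first exact: contC.
by under eq_fun do rewrite exprS; exact: contM.
Qed.

Lemma cont_comp (f : R -> R) F : continuous f -> continuous F ->
  continuous (fun x => f (F x)).
Proof. by move=> cf cF x; apply: continuous_comp; [exact: cF|exact: cf]. Qed.

Lemma cont_sum (I : Type) (s : seq I) (F : I -> T -> R) :
  (forall i, continuous (F i)) -> continuous (fun x => \sum_(i <- s) F i x).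
Proof.
move=> cF; elim: s => [|i s IH].
  by under eq_fun do rewrite big_nil; exact: contC.
by under eq_fun do rewrite big_cons; exact: contD.
Qed.

End continuous_realfun.

(** * Euclidean norm and Gaussian identities *)

Section gaussian.
Variables (R : realType) (d : nat).
Local Notation RT := (measurableTypeR R).
Local Notation V := 'rV[R]_d.
Local Notation h := (@heat_kernel R d).
Implicit Types x y z w : V.

Definition dot x y : R := \sum_(j < d) x 0 j * y 0 j.

Lemma dotC x y : dot x y = dot y x.
Proof. by apply: eq_bigr => j _; rewrite mulrC. Qed.

Lemma dotDr x y z : dot x (y + z) = dot x y + dot x z.
Proof. by rewrite -big_split; apply: eq_bigr => j _ /=; rewrite mxE mulrDr. Qed.

Lemma dotZr x c y : dot x (c *: y) = c * dot x y.
Proof. by rewrite mulr_sumr; apply: eq_bigr => j _; rewrite mxE mulrCA. Qed.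

Lemma dotNr x y : dot x (- y) = - dot x y.
Proof. by rewrite -scaleN1r dotZr mulN1r. Qed.

Lemma dotDl x y z : dot (x + y) z = dot x z + dot y z.
Proof. by rewrite dotC dotDr dotC (dotC z). Qed.

Lemma dotZl c x y : dot (c *: x) y = c * dot x y.
Proof. by rewrite dotC dotZr dotC. Qed.

Lemma dotNl x y : dot (- x) y = - dot x y.
Proof. by rewrite dotC dotNr dotC. Qed.

Lemma dotxx_ge0 x : 0 <= dot x x.
Proof. by apply: sumr_ge0 => j _; rewrite -expr2 sqr_ge0. Qed.

Lemma enormE x : enorm x = Num.sqrt (dot x x).
Proof. by congr Num.sqrt; apply: eq_bigr => j _; rewrite expr2. Qed.

Lemma sqr_enorm x : enorm x ^+ 2 = dot x x.
Proof. by rewrite enormE sqr_sqrtr ?dotxx_ge0. Qed.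

Lemma enorm_ge0 x : 0 <= enorm x.
Proof. exact: sqrtr_ge0. Qed.
Hint Resolve enorm_ge0 : core.

Lemma enormZ c x : enorm (c *: x) = `|c| * enorm x.
Proof. by rewrite !enormE dotZl dotZr mulrA -expr2 sqrtrM ?sqr_ge0// sqrtr_sqr. Qed.

Lemma enormN x : enorm (- x) = enorm x.
Proof. by rewrite -scaleN1r enormZ normrN normr1 mul1r. Qed.

Lemma enorm0 : enorm (0 : V) = 0.
Proof. by rewrite -(scale0r 0) enormZ normr0 mul0r. Qed.

Lemma ler_coord_enorm x j : `|x 0 j| <= enorm x.
Proof.
rewrite -sqrtr_sqr ler_wsqrtr// (bigD1 j)//= lerDl.
by apply: sumr_ge0 => i _; exact: sqr_ge0.
Qed.

Lemma enorm_eq0 x : enorm x = 0 -> x = 0.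
Proof.
move=> x0; apply/rowP => j; rewrite mxE; apply/eqP; rewrite -normr_le0.
by rewrite -x0 ler_coord_enorm.
Qed.

Lemma ler_dot_enorm x y : dot x y <= enorm x * enorm y.
Proof.
have [/eqP x0|x0] := boolP (enorm x == 0).
  rewrite x0 mul0r (enorm_eq0 x0) /dot big1// => j _; by rewrite mxE mul0r.
have [/eqP y0|y0] := boolP (enorm y == 0).
  rewrite y0 mulr0 (enorm_eq0 y0) /dot big1// => j _; by rewrite mxE mulr0.
have p0 : 0 < enorm x * enorm y by rewrite mulr_gt0// lt_def ?x0 ?y0 enorm_ge0.
rewrite -(ler_pM2l p0).
have := dotxx_ge0 (enorm y *: x - enorm x *: y).
rewrite dotDl !dotDr !dotNr !dotNl !dotZl !dotZr -!sqr_enorm (dotC y x).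
nra.
Qed.

Lemma sqr_enormD x y : enorm (x + y) ^+ 2 = enorm x ^+ 2 + 2 * dot x y + enorm y ^+ 2.
Proof. by rewrite !sqr_enorm dotDl !dotDr (dotC y x); ring. Qed.

Lemma ler_enormD x y : enorm (x + y) <= enorm x + enorm y.
Proof.
rewrite -(@ler_pXn2r _ 2)// ?nnegrE ?addr_ge0//.
rewrite sqr_enormD; have := ler_dot_enorm x y; nra.
Qed.

Lemma enorm_delta (j : 'I_d) : enorm (delta_mx 0 j : V) = 1.
Proof.
rewrite enormE /dot (bigD1 j)//= mxE !eqxx/= mulr1 big1 ?addr0 ?sqrtr1// => i ij.
by rewrite mxE (negbTE ij) andbF mul0r.
Qed.

Lemma continuous_coord (j : 'I_d) : continuous (fun x => x 0 j).
Proof. exact: coord_continuous. Qed.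

Lemma continuous_sqr_enorm : continuous (fun x => enorm x ^+ 2).
Proof.
rewrite (_ : (fun x => _) = fun x => \sum_(j < d) x 0 j * x 0 j); last first.
  by apply/funext => x; rewrite sqr_enorm.
by apply: cont_sum => j; apply: contM; exact: continuous_coord.
Qed.

Lemma continuous_enorm : continuous (@enorm R d).
Proof.
rewrite (_ : @enorm R d = fun x => Num.sqrt (enorm x ^+ 2)).
  by apply: cont_comp; [exact: sqrt_continuous|exact: continuous_sqr_enorm].
by apply/funext => y; rewrite sqrtr_sqr ger0_norm.
Qed.

Definition hconst (t : R) : R := (4 * pi * t) `^ (- (d%:R / 2)).

Lemma heat_kernelE t y : h t y = hconst t * expR (- (enorm y ^+ 2 / (4 * t))).
Proof. by []. Qed.

Lemma hconst_gt0 t : 0 < t -> 0 < hconst t.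
Proof. by move=> t0; rewrite powR_gt0// !mulr_gt0// pi_gt0. Qed.

Lemma heat_kernel_gt0 t y : 0 < t -> 0 < h t y.
Proof. by move=> t0; rewrite heat_kernelE mulr_gt0 ?expR_gt0// hconst_gt0. Qed.

Lemma heat_kernel_ge0 t y : 0 <= h t y.
Proof. by rewrite heat_kernelE mulr_ge0 ?expR_ge0// powR_ge0. Qed.
Hint Resolve heat_kernel_ge0 : core.

Lemma continuous_heat_kernel t : continuous (h t).
Proof.
apply: contM; first exact: contC.
apply: cont_comp; first exact: continuous_expR.
by apply: contN; apply: contM; [exact: continuous_sqr_enorm|exact: contC].
Qed.

(** The coordinates are independent centred normal variables of variance [2 t]; the mass of [h t]
    thus comes from that of the normal law. *)
Lemma heat_kernel_prod t y : 0 < t ->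
  h t y = \prod_(j < d) normal_pdf 0 (Num.sqrt (2 * t)) (y 0 j).
Proof.
move=> t0.
have s0 : Num.sqrt (2 * t) != 0 by rewrite gt_eqF// sqrtr_gt0 mulr_gt0.
have sE : Num.sqrt (2 * t) ^+ 2 = 2 * t by rewrite sqr_sqrtr// mulr_ge0// ltW.
rewrite normal_pdfE// big_split/= heat_kernelE; congr (_ * _).
  rewrite prodr_const card_ord /normal_peak sE /hconst.
  rewrite (_ : 2 * t * pi *+ 2 = 4 * pi * t); last by ring.
  have p0 : 0 <= 4 * pi * t by rewrite !mulr_ge0 ?pi_ge0// ltW.
  rewrite powRN -powR_mulrn ?invr_ge0 ?sqrtr_ge0// -powR12_sqrt//.
  by rewrite -!powRN -powRrM; congr (_ `^ _); lra.
rewrite -expR_sum; congr expR; rewrite sqr_enorm /dot mulr_suml -sumrN.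
by apply: eq_bigr => j _; rewrite sE subr0 expr2 mulNr; congr (- (_ / _)); ring.
Qed.

Lemma integral_heat_kernel t : 0 < t ->
  (\int[@lebesgue_tuple R d]_y (h t (row_of y))%:E = 1)%E.
Proof.
move=> t0.
have s0 : Num.sqrt (2 * t) != 0 by rewrite gt_eqF// sqrtr_gt0 mulr_gt0.
under eq_integral => y _.
  rewrite heat_kernel_prod//.
  under eq_bigr do rewrite mxE.
  over.
rewrite integral_lebesgue_tuple_prod.
- by rewrite big1// => j _; exact: integral_normal_pdf.
- exact: measurable_normal_pdf.
- by move=> x; exact: normal_pdf_ge0.
Qed.

Lemma measurableV_heat_kernel t : measurableV (h t).
Proof. by apply: continuous_measurableV; exact: continuous_heat_kernel. Qed.

Lemma integrableV_heat_kernel t : 0 < t -> integrableV (h t).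
Proof.
move=> t0; apply/integrableP; split.
  by apply/measurable_EFinP; exact: measurableV_heat_kernel.
under eq_integral => y _ do rewrite /= ger0_norm//.
by rewrite integral_heat_kernel// ltry.
Qed.

Lemma rint_heat_kernel t : 0 < t -> rint (h t) = 1.
Proof. by move=> t0; rewrite /rint /Rintegral integral_heat_kernel. Qed.

(** Completing the square: an exponential factor becomes a constant and a translation, both harmless
    under the integral sign. *)
Lemma heat_kernel_tilt t w y : 0 < t ->
  expR (dot w y) * h t y = expR (t * enorm w ^+ 2) * h t (y - (2 * t) *: w).
Proof.
move=> t0; rewrite !heat_kernelE mulrCA [RHS]mulrCA; congr (_ * _).
rewrite -!expRD; congr expR.
rewrite sqr_enormD enormN enormZ exprMn real_normK ?num_real// dotNr dotZr (dotC y).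
by field; rewrite gt_eqF.
Qed.

(** Completing the square in [y]: a product of two Gaussians is again Gaussian in [y], with time
    [r s / (r + s)] and shifted centre. Integrating in [y] leaves [h (r + s) w], which is the
    semigroup law. *)
Lemma heat_kernel_conv r s w y : 0 < r -> 0 < s ->
  h r (w - y) * h s y
  = h (r + s) w * h (r * s / (r + s)) (y - (s / (r + s)) *: w).
Proof.
move=> r0 s0; have rs0 : 0 < r + s by rewrite addr_gt0.
rewrite !heat_kernelE mulrACA [RHS]mulrACA; congr (_ * _).
  rewrite /hconst -!powRM ?mulr_ge0 ?invr_ge0 ?pi_ge0// ?ltW//; congr (_ `^ _).
  by field; rewrite gt_eqF.
rewrite -!expRD; congr expR.
rewrite !sqr_enormD !enormN enormZ exprMn real_normK ?num_real// !dotNr dotZr (dotC y).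
by field; rewrite ?gt_eqF.
Qed.

Lemma pow_le_expR_sqr (k : nat) (X : R) : (k <= 2)%N -> 0 <= X ->
  X ^+ k <= 16 * expR (X ^+ 2 / 16).
Proof.
move=> k2 X0; apply: (@le_trans _ _ (16 * (1 + X ^+ 2 / 16))); last first.
  by rewrite ler_pM2l// expR_ge1Dx.
have := sqr_ge0 (X - 8); case: k k2 => [|[|[|]]]// _; rewrite ?expr0 ?expr1; nra.
Qed.

(** With [X = |y| / sqrt r], the exponent [- X^2 / 4] of [h r] is shared out: [X^2 / 8] is left to
    [h (2 r)], [X^2 / 16] absorbs [X^k] at the cost of the factor 16, and [X^2 / 16] absorbs
    [exp (b |y|)] at the cost of [exp (4 b^2 r)]. The factor [2 ^ (d / 2)] is the ratio of the
    normalizations. *)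
Lemma heat_kernel_moment (k : nat) (b r : R) y : (k <= 2)%N -> 0 < r ->
  enorm y ^+ k * expR (b * enorm y) * h r y
  <= 16 * 2 `^ (d%:R / 2) * Num.sqrt r ^+ k * expR (4 * b ^+ 2 * r) * h (2 * r) y.
Proof.
move=> k2 r0; set s := Num.sqrt r; set X := enorm y / s.
have s0 : 0 < s by rewrite sqrtr_gt0.
have sE : s ^+ 2 = r by rewrite sqr_sqrtr// ltW.
have yE : enorm y = X * s by rewrite /X divfK// gt_eqF.
have X0 : 0 <= X by rewrite divr_ge0// ltW.
have -> : h r y = 2 `^ (d%:R / 2) * hconst (2 * r) * expR (- (X ^+ 2 / 4)).
  rewrite heat_kernelE /hconst.
  rewrite (_ : 4 * pi * (2 * r) = 2 * (4 * pi * r)); last by ring.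
  rewrite [in RHS]powRM ?mulr_ge0 ?pi_ge0// ?(ltW r0)//.
  rewrite [X in _ = X * _]mulrA -powRD ?pnatr_eq0 ?implybT// subrr powRr0 mul1r; congr (_ * expR (- _)).
  by rewrite /X exprMn exprVn sE; field; rewrite gt_eqF.
rewrite [X in _ <= _ * X]heat_kernelE.
have -> : enorm y ^+ 2 / (4 * (2 * r)) = X ^+ 2 / 8.
  by rewrite /X exprMn exprVn sE; field; rewrite gt_eqF.
rewrite {1}yE exprMn.
have p0 : 0 <= 2 `^ (d%:R / 2) * hconst (2 * r) * s ^+ k.
  by rewrite !mulr_ge0// ?powR_ge0// exprn_ge0// ltW.
have -> : X ^+ k * s ^+ k * expR (b * enorm y) *
    (2 `^ (d%:R / 2) * hconst (2 * r) * expR (- (X ^+ 2 / 4))) =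
   (2 `^ (d%:R / 2) * hconst (2 * r) * s ^+ k) *
   (X ^+ k * (expR (b * enorm y + - (X ^+ 2 / 4)))).
  by rewrite expRD; ring.
have -> : 16 * 2 `^ (d%:R / 2) * s ^+ k * expR (4 * b ^+ 2 * r) *
    (hconst (2 * r) * expR (- (X ^+ 2 / 8))) =
   (2 `^ (d%:R / 2) * hconst (2 * r) * s ^+ k) *
   (16 * (expR (4 * b ^+ 2 * r + - (X ^+ 2 / 8)))).
  by rewrite expRD; ring.
apply: ler_wpM2l => //.
apply: (@le_trans _ _ (16 * expR (X ^+ 2 / 16) * expR (b * enorm y + - (X ^+ 2 / 4)))).
  by rewrite ler_wpM2r ?expR_ge0// pow_le_expR_sqr.
rewrite -mulrA ler_pM2l// -expRD ler_expR yE -sE.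
have := sqr_ge0 (X / 4 - 2 * b * s); lra.
Qed.

End gaussian.
#[export] Hint Extern 0 (is_true (0 <= enorm _)) => exact: enorm_ge0 : core.
#[export] Hint Extern 0 (is_true (0 <= heat_kernel _ _)) => exact: heat_kernel_ge0 : core.

(** * Iterated partial derivatives and weighted classes *)

Section partial_derivatives.
Variables (R : realType) (d : nat).
Local Notation V := 'rV[R]_d.
Local Notation "''e_' j" := (delta_mx 0 j : V) (at level 8, j at level 2).
Implicit Types (u v : V -> R) (x y z : V).

Lemma is_derive_line u (w x : V) (r : R) : derivable u (x + r *: w) w ->
  is_derive r (1 : R) (fun t => u (x + t *: w)) ('D_w u (x + r *: w)).
Proof.
move=> du.
have E : (fun h : R => h^-1 *: (((fun t => u (x + t *: w)) \o shift r) (h *: 1) -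
     u (x + r *: w))) = (fun h : R => h^-1 *: ((u \o shift (x + r *: w)) (h *: w) - u (x + r *: w))).
  apply/funext => k /=; congr (_ *: (u _ - _)).
  by rewrite scalerDl [k *: 1]mulr1 addrCA.
by apply: DeriveDef; rewrite /derivable /derive E.
Qed.

Lemma derivable_continuous_line u (w x : V) : (forall z, derivable u z w) ->
  continuous (fun t : R => u (x + t *: w)).
Proof.
move=> du r; apply: differentiable_continuous; apply/derivable1_diffP.
by have [] := is_derive_line (du (x + r *: w)).
Qed.

Lemma MVT_line u (w x : V) (r : R) : (forall z, derivable u z w) ->
  exists2 c, `|c| <= `|r| & u (x + r *: w) - u x = r * 'D_w u (x + c *: w).
Proof.
move=> du; pose f t := u (x + t *: w).
have df (t : R) : is_derive t (1 : R) f ('D_w u (x + t *: w)) by exact: is_derive_line.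
have cf (a b : R) : {within `[a, b], continuous f}.
  by apply: continuous_subspaceT; exact: derivable_continuous_line.
have [r0|r0|->] := ltgtP r 0.
- have [c] := MVT r0 (fun t _ => df t) (@cf _ _).
  rewrite in_itv/= => /andP[c1 c2]; rewrite /f scale0r addr0 sub0r => E.
  exists c; first by rewrite !ler0_norm ?lerN2 ?ltW.
  by rewrite -opprB E mulrN opprK mulrC.
- have [c] := MVT r0 (fun t _ => df t) (@cf _ _).
  rewrite in_itv/= => /andP[c1 c2]; rewrite /f scale0r addr0 subr0 => E.
  exists c; first by rewrite !ger0_norm ?ltW.
  by rewrite E mulrC.
- by exists 0 => //; rewrite mul0r scale0r addr0 subrr.
Qed.

Lemma derivable_shift u (w c x : V) : derivable u (x + c) w ->
  derivable (fun z => u (z + c)) x w.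
Proof.
have E : (fun k : R => k^-1 *: (((fun z => u (z + c)) \o shift x) (k *: w) - u (x + c)))
    = (fun k : R => k^-1 *: ((u \o shift (x + c)) (k *: w) - u (x + c))).
  by apply/funext => k /=; rewrite addrA.
by rewrite /derivable E.
Qed.

Lemma derive_shiftV u (w c x : V) : 'D_w (fun z => u (z + c)) x = 'D_w u (x + c).
Proof.
have E : (fun k : R => k^-1 *: (((fun z => u (z + c)) \o shift x) (k *: w) - u (x + c)))
    = (fun k : R => k^-1 *: ((u \o shift (x + c)) (k *: w) - u (x + c))).
  by apply/funext => k /=; rewrite addrA.
by rewrite /derive E.
Qed.

Lemma second_difference u (w1 w2 x : V) (r : R) :
  (forall z, derivable u z w1) -> (forall z, derivable ('D_w1 u) z w2) ->
  exists a b, [/\ `|a| <= `|r|, `|b| <= `|r| &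
    u (x + r *: w1 + r *: w2) - u (x + r *: w1) - (u (x + r *: w2) - u x)
    = r ^+ 2 * 'D_w2 ('D_w1 u) (x + (a *: w1 + b *: w2))].
Proof.
move=> du ddu; pose g z := u (z + r *: w2) - u z.
have dg z : derivable g z w1.
  by apply: derivableB => //; exact: derivable_shift.
have [a ar Ea] := MVT_line x r dg.
have [b br Eb] := MVT_line (x + a *: w1) r ddu.
exists a, b; split; [exact: ar|exact: br|].
rewrite addrA expr2 -mulrA -Eb.
rewrite -[LHS]/(g (x + r *: w1) - g x) Ea; congr (_ * _).
by rewrite deriveB//; [rewrite derive_shiftV|exact: derivable_shift].
Qed.

Lemma cvg_continuousV u (z : nat -> V) x : continuous u ->
  z n @[n --> \oo] --> x -> u (z n) @[n --> \oo] --> u x.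
Proof. by move=> cu zx; apply: continuous_cvg; [exact: cu|exact: zx]. Qed.

(** The second difference of [u] is symmetric in [w1] and [w2]. Divided by [r^2] it is a mixed
    derivative, in either order, at a point close to [x]; continuity lets [r] tend to 0. *)
Lemma schwarz u (w1 w2 x : V) :
  (forall z, derivable u z w1) -> (forall z, derivable u z w2) ->
  (forall z, derivable ('D_w1 u) z w2) -> (forall z, derivable ('D_w2 u) z w1) ->
  continuous ('D_w2 ('D_w1 u)) -> continuous ('D_w1 ('D_w2 u)) ->
  'D_w2 ('D_w1 u) x = 'D_w1 ('D_w2 u) x.
Proof.
move=> d1 d2 d12 d21 c12 c21.
pose r (n : nat) : R := n.+1%:R^-1.
have r0 n : r n != 0 by rewrite invr_eq0.
have rcvg : r n @[n --> \oo] --> (0 : R) by exact: cvg_harmonic.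
have /choice[p Hp] : forall n, exists p : R * R * R * R,
    [/\ `|p.1.1.1| <= r n, `|p.1.1.2| <= r n, `|p.1.2| <= r n, `|p.2| <= r n &
     'D_w2 ('D_w1 u) (x + (p.1.1.1 *: w1 + p.1.1.2 *: w2)) =
     'D_w1 ('D_w2 u) (x + (p.1.2 *: w2 + p.2 *: w1))].
  move=> n; have rn : `|r n| = r n by rewrite ger0_norm// invr_ge0.
  have [a [b [ha hb E]]] := second_difference x (r n) d1 d12.
  have [a' [b' [ha' hb' E']]] := second_difference x (r n) d2 d21.
  exists (a, b, a', b'); rewrite rn in ha hb ha' hb'.
  split; [exact: ha|exact: hb|exact: ha'|exact: hb'|]; rewrite /=.
  apply: (@mulfI _ (r n ^+ 2)); first by rewrite expf_neq0.
  refine (etrans (esym E) (etrans _ E')); rewrite (addrAC x (r n *: w1)).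
  have alg (p q s t : R) : p - q - (s - t) = p - s - (q - t) by ring.
  exact: alg.
have small (q : nat -> R) : (forall n, `|q n| <= r n) -> q n @[n --> \oo] --> (0 : R).
  move=> qr; apply: norm_cvg0; apply: (squeeze_cvgr _ (cvg_cst 0) rcvg).
  by near=> n; rewrite normr_ge0 qr.
have lim (q1 q2 : nat -> R) (v1 v2 : V) : (forall n, `|q1 n| <= r n) ->
   (forall n, `|q2 n| <= r n) -> x + (q1 n *: v1 + q2 n *: v2) @[n --> \oo] --> x.
  move=> /small h1 /small h2; rewrite -[X in _ --> X]addr0.
  apply: cvgD; first exact: cvg_cst.
  rewrite -[X in _ --> X]addr0; apply: cvgD.
    by rewrite -(scale0r v1); apply: cvgZr_tmp.
  by rewrite -(scale0r v2); apply: cvgZr_tmp.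
have h1 n : `|(p n).1.1.1| <= r n := let: And5 a _ _ _ _ := Hp n in a.
have h2 n : `|(p n).1.1.2| <= r n := let: And5 _ a _ _ _ := Hp n in a.
have h3 n : `|(p n).1.2| <= r n := let: And5 _ _ a _ _ := Hp n in a.
have h4 n : `|(p n).2| <= r n := let: And5 _ _ _ a _ := Hp n in a.
have h5 n : 'D_w2 ('D_w1 u) (x + ((p n).1.1.1 *: w1 + (p n).1.1.2 *: w2)) =
     'D_w1 ('D_w2 u) (x + ((p n).1.2 *: w2 + (p n).2 *: w1))
  := let: And5 _ _ _ _ a := Hp n in a.
have L1 : 'D_w2 ('D_w1 u) (x + ((p n).1.1.1 *: w1 + (p n).1.1.2 *: w2)) @[n --> \oo] -->
     'D_w2 ('D_w1 u) x.
  exact: (cvg_continuousV c12 (lim _ _ _ _ h1 h2)).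
have L2 : 'D_w1 ('D_w2 u) (x + ((p n).1.2 *: w2 + (p n).2 *: w1)) @[n --> \oo] -->
     'D_w1 ('D_w2 u) x.
  exact: (cvg_continuousV c21 (lim _ _ _ _ h3 h4)).
have E12 := funext h5.
rewrite E12 in L1.
exact: (cvg_unique _ L1 L2).
Unshelve. all: by end_near. Qed.

Lemma rderiv_cat (s1 s2 : seq 'I_d) u : rderiv (s1 ++ s2) u = rderiv s1 (rderiv s2 u).
Proof. by rewrite /rderiv foldr_cat. Qed.

Lemma rderiv_cons j s u : rderiv (j :: s) u = 'D_('e_j) (rderiv s u).
Proof. by []. Qed.

Lemma rsmooth_rderiv s u : rsmooth u -> rsmooth (rderiv s u).
Proof. by move=> su s'; rewrite -rderiv_cat; exact: su. Qed.

Lemma rsmooth_continuous u : rsmooth u -> continuous u.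
Proof. by move=> /(_ [::])[]. Qed.

Lemma rsmooth_derivable u x j : rsmooth u -> derivable u x 'e_j.
Proof. by move=> /(_ [::])[]. Qed.

Lemma rderiv_swap i j s u : rsmooth u -> rderiv [:: i, j & s] u = rderiv [:: j, i & s] u.
Proof.
move=> su; apply/funext => x; rewrite !rderiv_cons; apply: schwarz => [z|z|z|z||].
- by have [_ ] := su s; exact.
- by have [_ ] := su s; exact.
- by have [_ ] := su (j :: s); exact.
- by have [_ ] := su (i :: s); exact.
- by have [] := su [:: i, j & s].
- by have [] := su [:: j, i & s].
Qed.

(** The seminorms of S^a only see words sorted by coordinate, through [mderiv]; commutation extends
    their bounds to arbitrary words. *)
Lemma rderiv_perm (s s' : seq 'I_d) u : rsmooth u -> perm_eq s s' ->
  rderiv s u = rderiv s' u.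
Proof.
move=> su.
have move1 i s1 s2 : rderiv (s1 ++ i :: s2) u = rderiv (i :: s1 ++ s2) u.
  elim: s1 => [//|k s1 IH]; rewrite [LHS]rderiv_cons IH -rderiv_cons.
  exact: rderiv_swap.
elim: s s' => [|i s IH] s' ss'.
  by move: ss'; rewrite perm_sym => /perm_nilP ->.
have : i \in s' by rewrite -(perm_mem ss') mem_head.
move=> /splitPr si; case: si ss' => s1 s2 ss'.
rewrite move1 !rderiv_cons (IH (s1 ++ s2))//.
by move: ss'; rewrite perm_sym perm_catC /= perm_cons perm_catC perm_sym.
Qed.

Definition mi_word (al : multi_index d) : seq 'I_d :=
  flatten [seq nseq (al j) j | j <- enum 'I_d].

Lemma perm_mi_word (s : seq 'I_d) : exists al, perm_eq s (mi_word al).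
Proof.
exists [ffun j => count_mem j s]; apply/allP => i _ /=; apply/eqP.
rewrite /mi_word count_flatten -map_comp sumnE big_map big_enum/=.
rewrite (bigD1 i)//= count_nseq /= eqxx mul1n ffunE big1 ?addn0// => j ji.
by rewrite count_nseq /= (negbTE ji) mul0n.
Qed.

Lemma rsmoothD u v : rsmooth u -> rsmooth v ->
  rsmooth (fun x => u x + v x) /\
  forall s, rderiv s (fun x => u x + v x) = fun x => rderiv s u x + rderiv s v x.
Proof.
move=> su sv.
have E s : rderiv s (fun x => u x + v x) = fun x => rderiv s u x + rderiv s v x.
  elim: s => [//|j s IH]; apply/funext => x; rewrite !rderiv_cons IH.
  by apply: deriveD; [have [_ ] := su s|have [_ ] := sv s]; exact.
split=> [s|]; last exact: E.
rewrite E; split.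
  by apply: contD; [have [] := su s|have [] := sv s].
by move=> x j; apply: derivableD; [have [_ ] := su s|have [_ ] := sv s]; exact.
Qed.

Lemma rsmoothZ (c : R) u : rsmooth u ->
  rsmooth (fun x => c * u x) /\
  forall s, rderiv s (fun x => c * u x) = fun x => c * rderiv s u x.
Proof.
move=> su.
have E s : rderiv s (fun x => c * u x) = fun x => c * rderiv s u x.
  elim: s => [//|j s IH]; apply/funext => x; rewrite !rderiv_cons IH.
  by apply: (@deriveZ _ _ R^o); have [_ ] := su s; exact.
split=> [s|]; last exact: E.
rewrite E; split.
  by apply: contM; [exact: contC|have [] := su s].
by move=> x j; apply: (@derivableZ _ _ R^o); have [_ ] := su s; exact.
Qed.

(* For instance exp (b |x|), or exp (- b |x|) (1 + |x|)^-m. *)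
Definition moderate (b : R) (W : V -> R) : Prop :=
  [/\ 0 <= b, forall x, 0 < W x & forall x y, W (x + y) <= W x * expR (b * enorm y)].

Definition bigW (W u : V -> R) : Prop := exists C, forall x, `|u x| <= C * W x.

Definition smoothW (W u : V -> R) : Prop :=
  rsmooth u /\ forall s, bigW W (rderiv s u).

Lemma bigW_ge0 W u : (forall x, 0 < W x) -> bigW W u ->
  exists2 C, 0 <= C & forall x, `|u x| <= C * W x.
Proof.
move=> W0 [C HC]; exists `|C| => // x; apply: (le_trans (HC x)).
by rewrite ler_wpM2r ?ler_norm// ltW.
Qed.

Lemma smoothW_bigW W u : smoothW W u -> bigW W u.
Proof. by move=> [_ /(_ [::])]. Qed.

Lemma smoothW_rderiv W s u : smoothW W u -> smoothW W (rderiv s u).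
Proof.
move=> [su bu]; split; first exact: rsmooth_rderiv.
by move=> s'; rewrite -rderiv_cat.
Qed.

Lemma smoothWD W u v : smoothW W u -> smoothW W v -> smoothW W (fun x => u x + v x).
Proof.
move=> [su bu] [sv bv]; have [suv E] := rsmoothD su sv; split => // s.
have [C HC] := bu s; have [D HD] := bv s; exists (C + D) => x; rewrite E mulrDl.
by rewrite (le_trans (ler_normD _ _))// lerD.
Qed.

Lemma smoothWZ W (c : R) u : smoothW W u -> smoothW W (fun x => c * u x).
Proof.
move=> [su bu]; have [suv E] := rsmoothZ c su; split => // s.
have [C HC] := bu s; exists (`|c| * C) => x; rewrite E normrM -mulrA.
by rewrite ler_wpM2l.
Qed.

Lemma smoothWN W u : smoothW W u -> smoothW W (fun x => - u x).
Proof.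
move=> su; rewrite (_ : (fun x => _) = fun x => -1 * u x); first exact: smoothWZ.
by apply/funext => x; rewrite mulN1r.
Qed.

Lemma smoothWB W u v : smoothW W u -> smoothW W v -> smoothW W (fun x => u x - v x).
Proof. by move=> su sv; apply: smoothWD => //; exact: smoothWN. Qed.

Lemma smoothW0 W : (forall x, 0 < W x) -> smoothW W (fun=> 0).
Proof.
move=> W0.
have E s : rderiv s (fun _ : V => 0 : R) = fun=> 0.
  by elim: s => [//|j s IH]; apply/funext => x; rewrite rderiv_cons IH derive_cst.
split => s; rewrite E; last by exists 0 => x; rewrite normr0 mul0r.
by split; [exact: contC|move=> x j; exact: derivable_cst].
Qed.

Lemma smoothW_sum W (I : Type) (r : seq I) (F : I -> V -> R) : (forall x, 0 < W x) ->
  (forall i, smoothW W (F i)) -> smoothW W (fun x => \sum_(i <- r) F i x).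
Proof.
move=> W0 sF; elim: r => [|i r IH].
  by under eq_fun do rewrite big_nil; exact: smoothW0.
by under eq_fun do rewrite big_cons; exact: smoothWD.
Qed.

(** Vertices of a path from 0 to [y] that changes one coordinate at a time, since only derivatives
    along the axes are available. *)
Definition prefix_row (y : V) (k : nat) : V := \row_j (if (j < k)%N then y 0 j else 0).

Lemma prefix_rowS y (k : 'I_d) : prefix_row y k.+1 = prefix_row y k + y 0 k *: 'e_k.
Proof.
apply/rowP => j; rewrite !mxE eqxx/=.
have [->|jk] := eqVneq j k; first by rewrite ltnS leqnn ltnn mulr1 add0r.
by rewrite ltnS leq_eqVlt val_eqE (negbTE jk)/= mulr0 addr0.
Qed.

Lemma enorm_prefix_row y (k : 'I_d) c : `|c| <= `|y 0 k| ->
  enorm (prefix_row y k + c *: 'e_k) <= enorm y.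
Proof.
move=> cy; rewrite ler_wsqrtr// ler_sum// => j _; rewrite !mxE eqxx/=.
have [->|jk] := eqVneq j k.
  by rewrite ltnn add0r mulr1 -real_normK ?num_real// -[leRHS]real_normK ?num_real// lerXn2r ?nnegrE.
by rewrite mulr0 addr0; case: ifP => // _; rewrite expr0n sqr_ge0.
Qed.

(** Mean value theorem on each edge of the path of the [prefix_row]. All its points stay within
    distance [|y|] of [x], a displacement that a moderate weight tolerates. *)
Lemma smoothW_lipschitz b W u : moderate b W -> smoothW W u ->
  exists2 C, 0 <= C & forall x y,
    `|u (x + y) - u x| <= C * W x * (enorm y * expR (b * enorm y)).
Proof.
move=> [b0 W0 Wb] su.
have /choice[C HC] : forall j : 'I_d, exists C, 0 <= C /\
    forall x, `|'D_('e_j) u x| <= C * W x.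
  move=> j; have [] := bigW_ge0 W0 (smoothW_bigW (smoothW_rderiv [:: j] su)).
  by move=> C C0 HC; exists C.
exists (\sum_j C j); first by apply: sumr_ge0 => j _; have [] := HC j.
move=> x y.
have -> : u (x + y) - u x = \sum_(k < d) (u (x + prefix_row y k.+1) - u (x + prefix_row y k)).
  rewrite -(big_mkord xpredT (fun k => u (x + prefix_row y k.+1) - u (x + prefix_row y k))).
  rewrite telescope_sumr//; congr (u _ - u _).
    by congr (_ + _); apply/rowP => j; rewrite mxE ltn_ord.
  by rewrite -[LHS]addr0; congr (_ + _); apply/rowP => j; rewrite !mxE.
apply: (le_trans (ler_norm_sum _ _ _)); rewrite !mulr_suml; apply: ler_sum => k _.
rewrite prefix_rowS addrA.
have dk z : derivable u z 'e_k by exact: (rsmooth_derivable su.1).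
have [c ck ->] := MVT_line (x + prefix_row y k) (y 0 k) dk.
have [C0 HCk] := HC k.
rewrite normrM -!mulrA mulrCA.
have ey : 0 <= enorm y * expR (b * enorm y) by rewrite mulr_ge0 ?enorm_ge0 ?expR_ge0.
apply: (@le_trans _ _ (enorm y * (C k * (W x * expR (b * enorm y))))); last first.
  by rewrite le_eqVlt; apply/orP; left; apply/eqP; ring.
rewrite ler_pM//; first exact: ler_coord_enorm.
apply: (le_trans (HCk _)); rewrite ler_wpM2l// -addrA.
apply: (le_trans (Wb _ _)); rewrite ler_wpM2l ?(ltW (W0 _))// ler_expR ler_wpM2l//.
exact: enorm_prefix_row.
Qed.

End partial_derivatives.

(** * Convolution *)

Section derivation_rules.
Variables (R : realType) (U : normedModType R).
Implicit Types (f g : U -> R) (x w : U).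

Lemma isD_cst (c : R) x w : is_derive x w (fun=> c) 0.
Proof. exact: is_derive_cst. Qed.

Lemma isD_D f g x w df dg : is_derive x w f df -> is_derive x w g dg ->
  is_derive x w (fun y => f y + g y) (df + dg).
Proof. by move=> h1 h2; have := is_deriveD h1 h2. Qed.

Lemma isD_N f x w df : is_derive x w f df -> is_derive x w (fun y => - f y) (- df).
Proof. by move=> h1; have := is_deriveN h1. Qed.

Lemma isD_M f g x w df dg : is_derive x w f df -> is_derive x w g dg ->
  is_derive x w (fun y => f y * g y) (df * g x + f x * dg).
Proof.
move=> h1 h2; have := is_deriveM h1 h2; move=> h3; apply: is_derive_eq.
by rewrite !/GRing.scale/= addrC mulrC.
Qed.

Lemma isD_Z (c : R) f x w df : is_derive x w f df ->
  is_derive x w (fun y => c * f y) (c * df).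
Proof.
by move=> h1; apply: (is_derive_eq (isD_M (isD_cst c x w) h1)); rewrite mul0r add0r.
Qed.

Lemma isD_along f x w df : is_derive (0 : R) (1 : R) (fun t => f (x + t *: w)) df ->
  is_derive x w f df.
Proof.
have E : (fun k : R => k^-1 *: (((fun t : R => f (x + t *: w)) \o shift 0) (k *: (1:R))
     - f (x + 0 *: w)))
   = (fun k : R => k^-1 *: ((f \o shift x) (k *: w) - f x)).
  by apply/funext => k /=; rewrite scale0r !addr0 [k%:A]mulr1 (addrC x).
by move=> [d1 d2]; move: d1 d2; rewrite /derivable /derive E => d1 d2; apply: DeriveDef.
Qed.

Lemma isD_val f x w df : is_derive x w f df -> 'D_w f x = df.
Proof. by move=> [_ ->]. Qed.

Lemma isD_uniq f x w df dg : is_derive x w f df -> is_derive x w f dg -> df = dg.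
Proof. by move=> [_ <-] [_ <-]. Qed.

Lemma continuous_at_dominated f g x : continuous g -> g x = 0 ->
  (forall z, `|f z - f x| <= g z) -> {for x, continuous f}.
Proof.
move=> cg g0 fg; apply/cvgrPdist_lt => e e0.
have := cg x; rewrite /continuous_at g0 => /cvgrPdist_lt/(_ _ e0).
apply: filterS => z; rewrite sub0r normrN => gz.
by rewrite distrC (le_lt_trans (fg _))// (le_lt_trans (ler_norm _)).
Qed.

End derivation_rules.

Section differentiation_under_rint.
Variables (R : realType) (d : nat).
Local Notation V := 'rV[R]_d.

Lemma is_derive_rint (f f' : R -> V -> R) (a lo hi : R) (G : V -> R) :
  lo < a < hi ->
  (forall r, lo < r < hi -> integrableV (f r)) ->
  (forall r y, lo < r < hi -> is_derive r 1 (f^~ y) (f' r y)) ->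
  integrableV G -> (forall r y, lo < r < hi -> `|f' r y| <= G y) ->
  is_derive a 1 (fun r => rint (f r)) (rint (f' a)).
Proof.
move=> ab intf df iG fG.
have Ia : (`]lo, hi[%classic : set R) a by rewrite /= in_itv.
pose F (r : R) (y : d.-tuple (measurableTypeR R)) := f r (row_of y).
have intF r : (`]lo, hi[%classic : set R) r ->
    (@lebesgue_tuple R d).-integrable setT (EFin \o F r).
  by rewrite /= in_itv => /intf.
have dF r y : (`]lo, hi[%classic : set R) r -> setT y -> derivable (F ^~ y) r 1.
  by rewrite /= in_itv/= => /(df r (row_of y))[].
have d1F r y : (`]lo, hi[%classic : set R) r ->
    partial1of2 F r y = f' r (row_of y).
  by rewrite /= in_itv/= => /(df r (row_of y)) [_]; rewrite partial1of2E.
have G0 y : 0 <= G (row_of y) by rewrite (le_trans _ (fG a _ ab)).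
have FG r y : (`]lo, hi[%classic : set R) r -> setT y -> `|partial1of2 F r y| <= G (row_of y).
  by move=> Ir _; rewrite d1F// fG//; move: Ir; rewrite /= in_itv.
have h1 := derivable_under_integral measurableT Ia intF dF G0 iG FG.
have h2 := differentiation_under_integral measurableT Ia intF dF G0 iG FG.
apply: DeriveDef; first exact: h1.
rewrite derive1E in h2; refine (etrans h2 _).
by apply: eq_Rintegral => y _; rewrite d1F.
Qed.

End differentiation_under_rint.

(** * Convolution with rapidly decreasing kernels on weighted spaces *)

Section convolution_real.
Variables (R : realType) (d : nat).
Local Notation RT := (measurableTypeR R).
Local Notation V := 'rV[R]_d.
Local Notation h := (@heat_kernel R d).
Local Notation "''e_' j" := (delta_mx 0 j : V) (at level 8, j at level 2).
Implicit Types (u v K W : V -> R) (x y z : V).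

Definition rconv u K x : R := rint (fun y => u (x - y) * K y).

(** A Gaussian majorant is asked for, rather than mere integrability against exponentials, because
    it survives small translations ([rapid_shift]), as differentiation under the integral sign
    requires. *)
Definition rapid K : Prop := continuous K /\
  forall b, exists C r, 0 < r /\ forall y, `|K y| * expR (b * enorm y) <= C * h r y.

Lemma hconst2 (r : R) : 0 < r -> hconst d r = 2 `^ (d%:R / 2) * hconst d (2 * r).
Proof.
move=> r0; rewrite /hconst.
rewrite (_ : 4 * pi * (2 * r) = 2 * (4 * pi * r)); last by ring.
rewrite [in RHS]powRM ?mulr_ge0 ?pi_ge0// ?(ltW r0)//.
by rewrite mulrA -powRD ?pnatr_eq0 ?implybT// subrr powRr0 mul1r.
Qed.

Lemma heat_kernel_translate (r : R) (v : V) y : 0 < r -> enorm v <= 1 ->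
  h r (y + v) <= 2 `^ (d%:R / 2) * expR (1 / (4 * r)) * h (2 * r) y.
Proof.
move=> r0 v1; rewrite !heat_kernelE hconst2// -mulrA [X in _ <= X]mulrACA.
have ->: 2 `^ (d%:R / 2) * hconst d (2 * r) * (expR (1 / (4 * r)) * expR (- (enorm y ^+ 2 / (4 * (2 * r)))))
  = 2 `^ (d%:R / 2) * (hconst d (2 * r) * expR (1 / (4 * r) - (enorm y ^+ 2 / (4 * (2 * r))))).
  by rewrite expRD; ring.
rewrite ler_wpM2l ?powR_ge0// ler_wpM2l ?(ltW (hconst_gt0 _ _)) ?mulr_gt0// ler_expR.
have v2 : enorm v ^+ 2 <= 1 by rewrite expr_le1// enorm_ge0.
have key : enorm y ^+ 2 / 2 - 1 <= enorm (y + v) ^+ 2.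
  have := dotxx_ge0 (y + 2 *: v).
  rewrite -sqr_enorm !sqr_enormD enormZ exprMn dotZr [`|2|]ger0_norm//; nra.
rewrite -subr_ge0.
have -> : 1 / (4 * r) - enorm y ^+ 2 / (4 * (2 * r)) - - (enorm (y + v) ^+ 2 / (4 * r))
  = (enorm (y + v) ^+ 2 - (enorm y ^+ 2 / 2 - 1)) / (4 * r).
  by field; rewrite gt_eqF.
by rewrite divr_ge0 ?subr_ge0// ltW// mulr_gt0.
Qed.

(** A majorant uniform over a compact range of times, for differentiation under the integral sign
    with respect to time. *)
Lemma heat_kernel_le (r0 r r1 : R) y : 0 < r0 -> r0 <= r <= r1 ->
  h r y <= hconst d r0 / hconst d r1 * h r1 y.
Proof.
move=> p0 /andP[r0r rr1]; have r_gt0 := lt_le_trans p0 r0r.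
have r1_gt0 := lt_le_trans r_gt0 rr1.
rewrite !heat_kernelE mulrA divfK ?gt_eqF ?hconst_gt0//.
apply: ler_pM; rewrite ?expR_ge0 ?(ltW (hconst_gt0 _ _))//.
  rewrite /hconst !powRN lef_pV2 ?posrE ?powR_gt0 ?mulr_gt0 ?pi_gt0//.
  have p4 (q : R) : 0 < q -> 4 * pi * q \in Num.nneg.
    by move=> q0; rewrite nnegrE ltW// !mulr_gt0// pi_gt0.
  apply: (ge0_ler_powR (divr_ge0 (ler0n _ _) (ler0n _ _)) (p4 _ p0) (p4 _ r_gt0)).
  by rewrite ler_pM2l// mulr_gt0// pi_gt0.
rewrite ler_expR lerN2 ler_wpM2l ?sqr_ge0// lef_pV2 ?posrE ?mulr_gt0//.
by rewrite ler_pM2l.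
Qed.

(* |w - y|^2 / 4r + |y|^2 / 4s >= k |w|^2 + |y|^2 / 8s for k small. *)
Lemma heat_kernel_split (r s : R) : 0 < r -> 0 < s -> exists C q, 0 < q /\
  forall w y, h r (w - y) * h s y <= C * (h q w * h (2 * s) y).
Proof.
move=> r0 s0; pose k := Num.min (1 / (8 * r)) (1 / (16 * s)).
have k0 : 0 < k by rewrite lt_min !divr_gt0// mulr_gt0.
have kr : k <= 1 / (8 * r) by rewrite ge_min lexx.
have ks : k <= 1 / (16 * s) by rewrite ge_min lexx orbT.
pose q := 1 / (4 * k); have q0 : 0 < q by rewrite divr_gt0// mulr_gt0.
exists (hconst d r * hconst d s / (hconst d q * hconst d (2 * s))), q; split => // w y.
have s20 : 0 < 2 * s by rewrite mulr_gt0.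
have hq := hconst_gt0 d q0; have hs := hconst_gt0 d s20.
rewrite !heat_kernelE mulrACA.
have -> (e1 e2 : R) : hconst d r * hconst d s / (hconst d q * hconst d (2 * s)) *
    (hconst d q * e1 * (hconst d (2 * s) * e2)) = hconst d r * hconst d s * (e1 * e2).
  by field; rewrite !gt_eqF.
rewrite ler_wpM2l ?mulr_ge0 ?(ltW (hconst_gt0 _ _))// -!expRD ler_expR.
have -> : enorm w ^+ 2 / (4 * q) = k * enorm w ^+ 2.
  by rewrite /q; field; rewrite gt_eqF.
have E1 : 0 <= (1 / (8 * r) - k) * (2 * enorm (w - y) ^+ 2).
  by apply: mulr_ge0; [rewrite subr_ge0|apply: mulr_ge0 => //; exact: sqr_ge0].
have E2 : 0 <= (1 / (16 * s) - k) * (2 * enorm y ^+ 2).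
  by apply: mulr_ge0; [rewrite subr_ge0|apply: mulr_ge0 => //; exact: sqr_ge0].
have E3 : 0 <= k * (enorm (w - y - y) ^+ 2).
  by rewrite mulr_ge0 ?sqr_ge0// ltW.
have F1 : enorm (w - y) ^+ 2 / (4 * r) = 1 / (8 * r) * (2 * enorm (w - y) ^+ 2).
  by field; rewrite gt_eqF.
have F2 : enorm y ^+ 2 / (4 * (2 * s)) = 1 / (16 * s) * (2 * enorm y ^+ 2).
  by field; rewrite gt_eqF.
have F3 : enorm y ^+ 2 / (4 * s) = 2 * (1 / (16 * s) * (2 * enorm y ^+ 2)).
  by field; rewrite gt_eqF.
rewrite F1 F2 F3.
have F4 : enorm (w - y - y) ^+ 2 = 2 * enorm (w - y) ^+ 2 + 2 * enorm y ^+ 2 - enorm w ^+ 2.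
  by rewrite !sqr_enormD enormN !dotNr !dotDl !dotNl -!sqr_enorm; ring.
rewrite F4 in E3.
move: E1 E2 E3; set A := 2 * enorm (w - y) ^+ 2; set B := 2 * enorm y ^+ 2.
rewrite !mulrBl mulrBr mulrDr; lra.
Qed.

Lemma continuous_subl x : continuous (fun y : V => x - y).
Proof. by move=> y; apply: (@continuousB _ _ _ (fun=> x) id y); [exact: cst_continuous|exact: cvg_id]. Qed.

Lemma continuous_addr x : continuous (fun y : V => y + x).
Proof. by move=> y; apply: (@continuousD _ _ _ id (fun=> x) y); [exact: cvg_id|exact: cst_continuous]. Qed.

Lemma cont_compV u (f : V -> V) : continuous u -> continuous f -> continuous (fun y => u (f y)).
Proof. by move=> cu cf y; apply: continuous_comp; [exact: cf|exact: cu]. Qed.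

(** Covers the heat kernel and its derivatives of the orders in use, all of which are polynomials of
    degree at most 2 times [h r]. *)
Lemma rapid_heat_poly (P : V -> R) (A : R) r : 0 < r -> continuous P ->
  (forall y, `|P y| <= A * (1 + enorm y ^+ 2)) -> rapid (fun y => P y * h r y).
Proof.
move=> r0 cP PA; split; first by apply: contM => //; exact: continuous_heat_kernel.
move=> b.
have A0 : 0 <= A.
  by have := le_trans (normr_ge0 _) (PA 0); rewrite enorm0 expr0n/= addr0 mulr1.
pose D k := 16 * 2 `^ (d%:R / 2) * Num.sqrt r ^+ k * expR (4 * b ^+ 2 * r) : R.
exists (A * (D 0 + D 2)), (2 * r); split; first by rewrite mulr_gt0.
move=> y; rewrite normrM (ger0_norm (heat_kernel_ge0 _ _)).
have m0 := heat_kernel_moment b y (isT : (0 <= 2)%N) r0.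
have m2 := heat_kernel_moment b y (isT : (2 <= 2)%N) r0.
rewrite -[leLHS]mulrA (mulrC (h r y)).
apply: (@le_trans _ _ (A * (1 + enorm y ^+ 2) * (expR (b * enorm y) * h r y))).
  by rewrite ler_wpM2r ?PA// mulr_ge0 ?expR_ge0 ?heat_kernel_ge0.
rewrite -mulrA -[leRHS]mulrA; apply: ler_wpM2l => //.
rewrite mulrDl mul1r [leRHS]mulrDl; apply: lerD; first by move: m0; rewrite expr0 mul1r.
by rewrite mulrA.
Qed.

Lemma rapid_heat_kernel r : 0 < r -> rapid (h r).
Proof.
move=> r0; rewrite (_ : h r = fun y => 1 * h r y); last first.
  by apply/funext => y; rewrite mul1r.
apply: (@rapid_heat_poly (fun=> 1) 1) => //; first exact: contC.
by move=> y; rewrite normr1 mul1r lerDl sqr_ge0.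
Qed.

Lemma rapid_integrable K b : rapid K -> integrableV (fun y => expR (b * enorm y) * `|K y|).
Proof.
move=> [cK rK]; have [C [r [r0 HC]]] := rK b.
apply: (@integrableV_dom _ _ _ (fun y => C * h r y)).
- apply: continuous_measurableV; apply: contM.
    apply: cont_comp; first exact: continuous_expR.
    by apply: contM; [exact: contC|exact: continuous_enorm].
  by apply: (@cont_comp _ _ (fun x : R => `|x|)); [exact: norm_continuous|].
- by apply: integrableVZ; exact: integrableV_heat_kernel.
- by move=> y; rewrite normrM normr_id ger0_norm ?expR_ge0// mulrC.
Qed.

(** Weighted L^1 norm; it bounds the operator norm of the convolution by [K] for every weight that
    is moderate with exponent [b] ([conv_bound]). *)
Definition wnorm b K : R := rint (fun y => expR (b * enorm y) * `|K y|).

Lemma wnorm_ge0 b K : 0 <= wnorm b K.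
Proof. by apply: rint_ge0 => y; rewrite mulr_ge0 ?expR_ge0. Qed.

Lemma rapid_shift K (b : R) : rapid K -> exists C r, 0 < r /\
  forall (v : V) y, enorm v <= 1 -> `|K (y + v)| * expR (b * enorm y) <= C * h r y.
Proof.
move=> [_ rK]; have [C [r [r0 HC]]] := rK `|b|.
have C0 : 0 <= C.
  have := HC 0; have : 0 < h r 0 by exact: heat_kernel_gt0.
  have := normr_ge0 (K 0); have := expR_ge0 (`|b| * enorm (0 : V)).
  move=> e0 k0 h0 H; rewrite -(pmulr_lge0 _ h0) (le_trans _ H)// mulr_ge0//.
exists (C * expR `|b| * (2 `^ (d%:R / 2) * expR (1 / (4 * r)))), (2 * r); split.
  by rewrite mulr_gt0.
move=> v y v1.
have yv : expR (b * enorm y) <= expR `|b| * expR (`|b| * enorm (y + v)).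
  rewrite -expRD ler_expR (le_trans (ler_norm _))// normrM (ger0_norm (enorm_ge0 _)).
  rewrite -{2}[`|b|]mulr1 -mulrDr ler_wpM2l//.
  have -> : y = (y + v) - v by rewrite addrK.
  by rewrite (le_trans (ler_enormD _ _))// enormN subrK addrC lerD2r.
apply: (@le_trans _ _ (`|K (y + v)| * (expR `|b| * expR (`|b| * enorm (y + v))))).
  by rewrite ler_wpM2l.
rewrite mulrCA; apply: (@le_trans _ _ (expR `|b| * (C * h r (y + v)))).
  by rewrite ler_wpM2l ?expR_ge0.
have -> (q g : R) : C * expR `|b| * q * g = expR `|b| * (C * (q * g)) by ring.
rewrite ler_wpM2l ?expR_ge0// ler_wpM2l//.
exact: heat_kernel_translate.
Qed.

Section weighted.
Variables (b : R) (W : V -> R).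
Hypothesis mW : moderate b W.

Let W0 x : 0 < W x. Proof. by case: mW. Qed.
Let Wge0 x : 0 <= W x. Proof. exact: ltW. Qed.
Let b0 : 0 <= b. Proof. by case: mW. Qed.

Lemma moderateB x y : W (x - y) <= W x * expR (b * enorm y).
Proof. by case: mW => _ _ /(_ x (- y)); rewrite enormN. Qed.

Lemma bigW_sub (A : R) u x y : 0 <= A -> (forall z, `|u z| <= A * W z) ->
  `|u (x - y)| <= A * W x * expR (b * enorm y).
Proof.
move=> A0 uA; rewrite (le_trans (uA _))// -mulrA ler_wpM2l//; exact: moderateB.
Qed.

Lemma integrable_conv u K x : continuous u -> bigW W u -> rapid K ->
  integrableV (fun y => u (x - y) * K y).
Proof.
move=> cu bu rK; have [A A0 uA] := bigW_ge0 W0 bu.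
apply: (@integrableV_dom _ _ _ (fun y => A * W x * (expR (b * enorm y) * `|K y|))).
- apply: continuous_measurableV; apply: contM; last by case: rK.
  by apply: cont_compV => //; exact: continuous_subl.
- by apply: integrableVZ; exact: rapid_integrable.
- by move=> y; rewrite normrM mulrA ler_wpM2r// bigW_sub.
Qed.

Lemma conv_bound u K (A : R) x : continuous u -> 0 <= A ->
  (forall z, `|u z| <= A * W z) -> rapid K -> `|rconv u K x| <= A * W x * wnorm b K.
Proof.
move=> cu A0 uA rK; rewrite -rintZ; last exact: rapid_integrable.
apply: ler_norm_rint.
- apply: integrableV_measurable; apply: integrable_conv => //; by exists A.
- by apply: integrableVZ; exact: rapid_integrable.
- by move=> y; rewrite normrM mulrA ler_wpM2r// bigW_sub.
Qed.

Lemma bigW_conv u K : continuous u -> bigW W u -> rapid K -> bigW W (rconv u K).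
Proof.
move=> cu bu rK; have [A A0 uA] := bigW_ge0 W0 bu.
exists (A * wnorm b K) => x; rewrite mulrAC; exact: conv_bound.
Qed.

Lemma convD u v K : continuous u -> bigW W u -> continuous v -> bigW W v -> rapid K ->
  rconv (fun x => u x + v x) K = fun x => rconv u K x + rconv v K x.
Proof.
move=> cu bu cv bv rK; apply/funext => x; rewrite -rintD; try exact: integrable_conv.
by congr rint; apply/funext => y; rewrite mulrDl.
Qed.

Lemma convZ (c : R) u K : continuous u -> bigW W u -> rapid K ->
  rconv (fun x => c * u x) K = fun x => c * rconv u K x.
Proof.
move=> cu bu rK; apply/funext => x; rewrite -rintZ; try exact: integrable_conv.
by congr rint; apply/funext => y; rewrite mulrA.
Qed.

Lemma conv_lipschitz u K : smoothW W u -> rapid K ->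
  exists2 C, 0 <= C & forall x z,
   `|rconv u K (x + z) - rconv u K x| <= C * W x * (enorm z * expR (b * enorm z)).
Proof.
move=> su rK; have [C C0 uC] := smoothW_lipschitz mW su.
have cu := rsmooth_continuous su.1; have bu := smoothW_bigW su.
exists (C * wnorm b K); first by rewrite mulr_ge0 ?wnorm_ge0.
move=> x z; rewrite -rintB; try exact: integrable_conv.
set q := enorm z * _; have q0 : 0 <= q by rewrite mulr_ge0 ?enorm_ge0 ?expR_ge0.
have -> : C * wnorm b K * W x * q = C * q * W x * wnorm b K by ring.
rewrite -rintZ; last exact: rapid_integrable.
apply: ler_norm_rint.
- by apply: integrableV_measurable; apply: integrableVB; exact: integrable_conv.
- by apply: integrableVZ; exact: rapid_integrable.
- move=> y; rewrite -mulrBl normrM mulrA ler_wpM2r//.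
  rewrite addrAC; apply: (le_trans (uC _ _)); rewrite -/q [leLHS]mulrAC -[leRHS]mulrA.
  by apply: ler_wpM2l; [exact: mulr_ge0|exact: moderateB].
Qed.

Lemma continuous_conv u K : smoothW W u -> rapid K -> continuous (rconv u K).
Proof.
move=> su rK x; have [C C0 uC] := conv_lipschitz su rK.
pose g (z : V) := C * W x * (enorm (z - x) * expR (b * enorm (z - x))).
have cg : continuous g.
  have ce : continuous (fun z : V => enorm (z - x)).
    apply: (@cont_compV _ (fun z => z - x)); [exact: continuous_enorm|exact: continuous_addr].
  apply: contM; first exact: contC.
  apply: contM => //; apply: cont_comp; first exact: continuous_expR.
  by apply: contM => //; exact: contC.
have g0 : g x = 0 by rewrite /g subrr enorm0 mul0r mulr0.
apply: (continuous_at_dominated cg g0) => z.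
by have := uC x (z - x); rewrite [x + _]addrC subrK.
Qed.

Lemma is_derive_conv u K j x : smoothW W u -> rapid K ->
  is_derive x 'e_j (rconv u K) (rconv (rderiv [:: j] u) K x).
Proof.
move=> su rK; apply: isD_along.
have sdu := smoothW_rderiv [:: j] su.
have [A A0 uA] := bigW_ge0 W0 (smoothW_bigW sdu).
have -> : rconv (rderiv [:: j] u) K x = rconv (rderiv [:: j] u) K (x + 0 *: 'e_j).
  by rewrite scale0r addr0.
apply: (@is_derive_rint _ _ (fun (r : R) y => u (x + r *: 'e_j - y) * K y)
   (fun (r : R) y => rderiv [:: j] u (x + r *: 'e_j - y) * K y) 0 (-1) 1
   (fun y => A * W x * expR b * (expR (b * enorm y) * `|K y|))).
- by rewrite ltrN10 ltr01.
- move=> r _; apply: integrable_conv => //; [exact: rsmooth_continuous su.1|exact: smoothW_bigW].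
- move=> r y _.
  have D : is_derive r (1 : R) (fun t => u ((x - y) + t *: 'e_j))
     (rderiv [:: j] u ((x - y) + r *: 'e_j)).
    by apply: is_derive_line; exact: (rsmooth_derivable su.1).
  have := isD_M D (isD_cst (K y) r (1 : R)); rewrite mulr0 addr0 addrAC.
  by under eq_fun do rewrite addrAC.
- by apply: integrableVZ; exact: rapid_integrable.
- move=> r y /andP[r1 r2]; rewrite normrM mulrA ler_wpM2r//.
  apply: (le_trans (bigW_sub _ _ A0 uA)); rewrite ler_wpM2r ?expR_ge0// -mulrA ler_wpM2l//.
  case: mW => _ _ /(_ x (r *: 'e_j)) H; apply: (le_trans H); rewrite ler_wpM2l// ler_expR.
  by rewrite -[leRHS]mulr1 ler_wpM2l// enormZ enorm_delta mulr1 ler_norml !ltW.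
Qed.

Lemma smoothW_conv u K : smoothW W u -> rapid K ->
  smoothW W (rconv u K) /\ forall s, rderiv s (rconv u K) = rconv (rderiv s u) K.
Proof.
move=> su rK.
have E s : rderiv s (rconv u K) = rconv (rderiv s u) K.
  elim: s => [//|j s IH]; apply/funext => x; rewrite rderiv_cons IH.
  by rewrite (isD_val (is_derive_conv j x (smoothW_rderiv s su) rK)).
split=> [|s]; last exact: E.
split=> s; rewrite E.
  split; first exact: continuous_conv (smoothW_rderiv s su) rK.
  by move=> x j; have [] := is_derive_conv j x (smoothW_rderiv s su) rK.
apply: bigW_conv => //; first by apply: rsmooth_continuous; exact: rsmooth_rderiv su.1.
exact: smoothW_bigW (smoothW_rderiv s su).
Qed.

(** Both sides are the derivative at [r = 0] of [rconv u K (x + r e_j)]: the increment falls on [u]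
    as the integral stands, and on [K] after a translation of the integration variable. No boundary
    term has to be discussed. *)
Lemma conv_by_parts u K K' j : smoothW W u -> rapid K -> rapid K' ->
  (forall y, is_derive y 'e_j K (K' y)) ->
  rconv (rderiv [:: j] u) K = rconv u K'.
Proof.
move=> su rK rK' dK; apply/funext => x.
have cu := rsmooth_continuous su.1.
have D1 : is_derive (0 : R) (1 : R) (fun r => rconv u K (x + r *: 'e_j))
    (rconv (rderiv [:: j] u) K x).
  have [d1 d2] := is_derive_conv j x su rK.
  have d1' : derivable (rconv u K) (x + 0 *: 'e_j) 'e_j by rewrite scale0r addr0.
  by apply: (is_derive_eq (is_derive_line d1')); rewrite scale0r addr0 d2.
have [A A0 uA] := bigW_ge0 W0 (smoothW_bigW su).
have [C [q [q0 HC]]] := rapid_shift b rK'.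
have cux : continuous (fun y => u (x - y)) by apply: cont_compV => //; exact: continuous_subl.
have D2 : is_derive (0 : R) (1 : R) (fun r => rint (fun y => u (x - y) * K (y + r *: 'e_j)))
    (rint (fun y => u (x - y) * K' (y + 0 *: 'e_j))).
  apply: (@is_derive_rint _ _ (fun (r : R) y => u (x - y) * K (y + r *: 'e_j))
   (fun (r : R) y => u (x - y) * K' (y + r *: 'e_j)) 0 (-1) 1
   (fun y => A * W x * (C * h q y))).
  - by rewrite ltrN10 ltr01.
  - move=> r _.
    have -> : (fun y => u (x - y) * K (y + r *: 'e_j)) =
        (fun y => (fun y => u (x + r *: 'e_j - y) * K y) (y + r *: 'e_j)).
      by apply/funext => y; rewrite opprD addrACA subrr addr0.
    apply: (@integrableV_shift _ _ (fun y => u (x + r *: 'e_j - y) * K y)).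
    by apply: integrable_conv => //; exact: smoothW_bigW.
  - move=> r y _.
    have [dKr dKv] := dK (y + r *: 'e_j).
    have := isD_M (isD_cst (u (x - y)) r (1 : R)) (is_derive_line dKr).
    by rewrite mul0r add0r dKv.
  - by do 2!apply: integrableVZ; exact: integrableV_heat_kernel.
  - move=> r y /andP[r1 r2]; rewrite normrM.
    have vr : enorm (r *: 'e_j) <= 1 by rewrite enormZ enorm_delta mulr1 ler_norml !ltW.
    have /(ler_wpM2l (mulr_ge0 A0 (Wge0 x))) := HC _ y vr.
    apply: le_trans; rewrite mulrA mulrAC ler_wpM2r//.
    exact: bigW_sub.
apply: (isD_uniq D1); apply: (is_derive_eq _ (_ : rint (fun y => u (x - y) * K' (y + 0 *: 'e_j)) = _)).
  have -> : (fun r => rconv u K (x + r *: 'e_j)) =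
      (fun r => rint (fun y => u (x - y) * K (y + r *: 'e_j))).
    apply/funext => r; rewrite /rconv.
    rewrite -(@rint_shift _ _ (fun y => u (x + r *: 'e_j - y) * K y) (r *: 'e_j)).
      by congr rint; apply/funext => y; rewrite opprD addrACA subrr addr0.
    apply: continuous_measurableV; apply: contM; last by case: rK.
    by apply: cont_compV => //; exact: continuous_subl.
  exact: D2.
by congr rint; apply/funext => y; rewrite scale0r addr0.
Qed.

End weighted.
End convolution_real.

(** * The heat equation *)

Section heat_real.
Variables (R : realType) (d : nat).
Local Notation RT := (measurableTypeR R).
Local Notation V := 'rV[R]_d.
Local Notation h := (@heat_kernel R d).
Local Notation "''e_' j" := (delta_mx 0 j : V) (at level 8, j at level 2).
Implicit Types (u v K W : V -> R) (x y z : V) (r s t : R).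

Definition heat_kernel_x (j : 'I_d) t y : R := - (y 0 j / (2 * t)) * h t y.

Definition heat_kernel_xx (j : 'I_d) t y : R :=
  (y 0 j ^+ 2 / (4 * t ^+ 2) - 1 / (2 * t)) * h t y.

Definition heat_kernel_t t y : R :=
  (enorm y ^+ 2 / (4 * t ^+ 2) - d%:R / (2 * t)) * h t y.

Lemma is_derive_coord (j : 'I_d) y : is_derive y 'e_j (fun z : V => z 0 j) 1.
Proof.
apply: isD_along.
have -> : (fun t : R => (y + t *: 'e_j) 0 j) = (fun t => y 0 j + t).
  by apply/funext => t; rewrite !mxE !eqxx mulr1.
have := isD_D (isD_cst (y 0 j) (0 : R) (1 : R)) (is_derive_id (0 : R) (1 : R)).
by rewrite add0r.
Qed.

Lemma is_derive_expR_comp (f : R -> R) (r df : R) : is_derive r (1 : R) f df ->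
  is_derive r (1 : R) (fun t => expR (f t)) (df * expR (f r)).
Proof.
move=> df1; have := is_derive1_comp (is_derive_expR (f r)) df1.
by rewrite mulrC.
Qed.

Lemma is_derive_heat_kernel_x j t y : 0 < t ->
  is_derive y 'e_j (h t) (heat_kernel_x j t y).
Proof.
move=> t0; apply: isD_along.
pose g (r : R) := - (4 * t)^-1 * (enorm y ^+ 2 + 2 * y 0 j * r + r * r).
have -> : (fun r : R => h t (y + r *: 'e_j)) = (fun r => hconst d t * expR (g r)).
  apply/funext => r; rewrite heat_kernelE; congr (_ * expR _).
  rewrite sqr_enormD enormZ enorm_delta mulr1 real_normK ?num_real// dotZr.
  have -> : dot y 'e_j = y 0 j.
    rewrite /dot (bigD1 j)//= mxE !eqxx mulr1 big1 ?addr0// => i ij.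
    by rewrite mxE (negbTE ij) andbF mulr0.
  by rewrite /g; field; rewrite gt_eqF.
have dg : is_derive (0 : R) (1 : R) g (- (4 * t)^-1 * (2 * y 0 j)).
  have id0 := is_derive_id (0 : R) (1 : R).
  apply: is_derive_eq (isD_Z _ (isD_D (isD_D (isD_cst _ _ _) (isD_Z (2 * y 0 j) id0))
    (isD_M id0 id0))) _.
  by rewrite mulr0 mul0r !addr0 add0r mulr1.
apply: is_derive_eq (isD_Z _ (is_derive_expR_comp dg)) _.
rewrite /heat_kernel_x heat_kernelE /g !mulr0 !addr0.
have -> : - (4 * t)^-1 * enorm y ^+ 2 = - (enorm y ^+ 2 / (4 * t)).
  by rewrite mulNr mulrC.
by field; rewrite gt_eqF.
Qed.

Lemma is_derive_heat_kernel_xx j t y : 0 < t ->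
  is_derive y 'e_j (heat_kernel_x j t) (heat_kernel_xx j t y).
Proof.
move=> t0.
have E : heat_kernel_x j t = fun y => - (2 * t)^-1 * (y 0 j * h t y).
  by apply/funext => z; rewrite /heat_kernel_x; field; rewrite gt_eqF.
rewrite [X in is_derive _ _ X]E.
apply: is_derive_eq (isD_Z _ (isD_M (is_derive_coord j y) (is_derive_heat_kernel_x j y t0))) _.
by rewrite /heat_kernel_xx /heat_kernel_x; field; rewrite gt_eqF.
Qed.

Lemma is_derive_hconst t : 0 < t ->
  is_derive t (1 : R) (@hconst R d) (- (d%:R / (2 * t)) * hconst d t).
Proof.
move=> t0; have p0 : 0 < 4 * pi * t by rewrite !mulr_gt0// pi_gt0.
have dl : is_derive t (1 : R) (fun t => 4 * pi * t) (4 * pi).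
  by apply: is_derive_eq (isD_Z _ (is_derive_id t (1 : R))) _; rewrite mulr1.
have := is_derive1_comp (is_derive1_powR (- (d%:R / 2)) p0) dl.
move=> D; apply: is_derive_eq D _.
have pn : 4 * pi * t != 0 by rewrite gt_eqF.
rewrite powRB ?pn ?implybT// powRr1 ?(ltW p0)// /hconst.
have pi0 : pi != 0 :> R by rewrite gt_eqF// pi_gt0.
have t00 : t != 0 by rewrite gt_eqF.
have alg (q P : R) : q != 0 ->
    - (d%:R / 2) * (P / (4 * q * t)) * (4 * q) = - (d%:R / (2 * t)) * P.
  by move=> q0; field; rewrite q0 t00.
exact: alg.
Qed.

Lemma is_derive_heat_kernel_t t y : 0 < t ->
  is_derive t (1 : R) (h^~ y) (heat_kernel_t t y).
Proof.
move=> t0.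
have t4 : 4 * t != 0 by rewrite gt_eqF// mulr_gt0.
have dg : is_derive t (1 : R) (fun t => - (enorm y ^+ 2 / (4 * t))) (enorm y ^+ 2 / (4 * t ^+ 2)).
  have dl : is_derive t (1 : R) (fun t => 4 * t) 4.
    by apply: is_derive_eq (isD_Z _ (is_derive_id t (1 : R))) _; rewrite mulr1.
  have dV : is_derive t (1 : R) (fun t => (4 * t)^-1) (- (4 * t) ^- 2 * 4).
    by have := is_deriveV t4 dl.
  apply: is_derive_eq (isD_N (isD_Z _ dV)) _.
  by field; rewrite gt_eqF.
apply: is_derive_eq (isD_M (is_derive_hconst t0) (is_derive_expR_comp dg)) _.
by rewrite /heat_kernel_t heat_kernelE; ring.
Qed.

Lemma rapid_heat_kernel_x j t : 0 < t -> rapid (heat_kernel_x j t).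
Proof.
move=> t0; apply: (@rapid_heat_poly _ _ _ (1 / (2 * t))) => //.
  by apply: contN; apply: contM; [exact: continuous_coord|exact: contC].
move=> y; rewrite normrN normrM [`|(2 * t)^-1|]ger0_norm ?invr_ge0 ?mulr_ge0 ?(ltW t0)//.
rewrite mulrC div1r ler_wpM2l ?invr_ge0 ?mulr_ge0 ?(ltW t0)//.
apply: (le_trans (ler_coord_enorm _ _)).
have := enorm_ge0 y; have := sqr_ge0 (enorm y - 1); nra.
Qed.

Lemma rapid_heat_kernel_xx j t : 0 < t -> rapid (heat_kernel_xx j t).
Proof.
move=> t0; have i1 : 0 <= 1 / (2 * t) by rewrite divr_ge0// mulr_ge0// ltW.
have i2 : 0 <= 1 / (4 * t ^+ 2) by rewrite divr_ge0// mulr_ge0// ?sqr_ge0.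
apply: (@rapid_heat_poly _ _ _ (1 / (4 * t ^+ 2) + 1 / (2 * t))) => //.
  apply: contB; last exact: contC.
  by apply: contM; [apply: contX; exact: continuous_coord|exact: contC].
move=> y; apply: (le_trans (ler_normB _ _)).
rewrite (ger0_norm i1) -[y 0 j ^+ 2]mulr1 -mulrA normrM (ger0_norm i2) ger0_norm ?sqr_ge0//.
have c2 : y 0 j ^+ 2 <= enorm y ^+ 2.
  rewrite -[leLHS]real_normK ?num_real// lerXn2r ?nnegrE ?enorm_ge0//; exact: ler_coord_enorm.
move: i1 i2 c2 (sqr_ge0 (enorm y)) (sqr_ge0 (y 0 j)).
set A := 1 / _; set B := 1 / _; nra.
Qed.

(** The heat equation for the kernel. *)
Lemma heat_kernel_tE t y : heat_kernel_t t y = \sum_j heat_kernel_xx j t y.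
Proof.
rewrite -mulr_suml; congr (_ * _); rewrite sumrB sumr_const card_ord.
rewrite -mulr_suml [(1 / _) *+ d](_ : _ = d%:R / (2 * t)); last by rewrite div1r (mulr_natl _ d).
have -> // : enorm y ^+ 2 = \sum_j y 0 j ^+ 2.
by rewrite sqr_enorm; apply: eq_bigr => j _; rewrite expr2.
Qed.

Lemma rapid_heat_kernel_t t : 0 < t -> rapid (heat_kernel_t t).
Proof.
move=> t0; have i1 : 0 <= d%:R / (2 * t) by rewrite divr_ge0// mulr_ge0// ltW.
have i2 : 0 <= 1 / (4 * t ^+ 2) by rewrite divr_ge0// mulr_ge0// ?sqr_ge0.
apply: (@rapid_heat_poly _ _ _ (1 / (4 * t ^+ 2) + d%:R / (2 * t))) => //.
  apply: contB; last exact: contC.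
  by apply: contM; [exact: continuous_sqr_enorm|exact: contC].
move=> y; apply: (le_trans (ler_normB _ _)).
rewrite (ger0_norm i1) -[enorm y ^+ 2]mulr1 -mulrA normrM (ger0_norm i2) ger0_norm ?sqr_ge0//.
move: i1 i2 (sqr_ge0 (enorm y)).
rewrite mulr1; set A := 1 / _; set B := d%:R / _; nra.
Qed.

(** The first two factors come from [heat_kernel_moment]; [1 + d] majorizes the sum [1 / 4 + d / 2]
    of the coefficients in [heat_kernel_t]. *)
Definition time_const : R := 16 * 2 `^ (d%:R / 2) * (1 + d%:R).

Lemma time_const_ge0 : 0 <= time_const.
Proof. by rewrite !mulr_ge0 ?powR_ge0// addr_ge0. Qed.

Lemma heat_kernel_t_bound (b t : R) y : 0 < t ->
  expR (b * enorm y) * `|heat_kernel_t t y|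
  <= time_const / t * expR (4 * b ^+ 2 * t) * h (2 * t) y.
Proof.
move=> t0.
have m0 := heat_kernel_moment b y (isT : (0 <= 2)%N) t0.
have m2 := heat_kernel_moment b y (isT : (2 <= 2)%N) t0.
rewrite expr0 mul1r mulr1 in m0; rewrite sqr_sqrtr ?(ltW t0)// in m2.
have i1 : 0 <= d%:R / (2 * t) by rewrite divr_ge0// mulr_ge0// ltW.
have i2 : 0 <= 1 / (4 * t ^+ 2) by rewrite divr_ge0// mulr_ge0// ?sqr_ge0.
rewrite /heat_kernel_t normrM (ger0_norm (heat_kernel_ge0 _ _)) mulrCA.
apply: (@le_trans _ _ ((1 / (4 * t ^+ 2) * enorm y ^+ 2 + d%:R / (2 * t)) *
    (expR (b * enorm y) * h t y))).
  apply: ler_wpM2r; first by rewrite mulr_ge0 ?expR_ge0.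
  apply: (le_trans (ler_normB _ _)).
  by rewrite (ger0_norm i1) -[enorm y ^+ 2]mulr1 -mulrA normrM (ger0_norm i2) ger0_norm ?sqr_ge0// mulr1 mulrC.
rewrite mulrDl -mulrA [enorm y ^+ 2 * (_ * _)]mulrA.
apply: (le_trans (lerD (ler_wpM2l i2 m2) (ler_wpM2l i1 m0))).
set c := 16 * 2 `^ (d%:R / 2); set E := expR (4 * _ * _); set H := h (2 * t) y.
have -> : 1 / (4 * t ^+ 2) * (c * t * E * H) + d%:R / (2 * t) * (c * E * H)
   = (1 / 4 + d%:R / 2) * (c * (E * H) / t).
  by field; rewrite gt_eqF.
have -> : time_const / t * E * H = (1 + d%:R) * (c * (E * H) / t).
  by rewrite /time_const -/c; field; rewrite gt_eqF.
have c0 : 0 <= c by rewrite mulr_ge0 ?powR_ge0.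
apply: ler_wpM2r.
  apply: divr_ge0; last exact: ltW.
  by apply: mulr_ge0 => //; apply: mulr_ge0; [exact: expR_ge0|exact: heat_kernel_ge0].
have : 0 <= d%:R :> R by []; lra.
Qed.

(** Bounds [Delta exp (- t Delta)] by [O(1 / t)] for bounded [t]. Multiplying such bounds over short
    times gives the estimates on iterated Laplacians in the case [A = 0]. *)
Lemma wnorm_heat_kernel_t (b t : R) : 0 < t ->
  wnorm b (heat_kernel_t t) <= time_const / t * expR (4 * b ^+ 2 * t).
Proof.
move=> t0; have t20 : 0 < 2 * t by rewrite mulr_gt0.
have ih := @integrableV_heat_kernel R d _ t20.
have -> : time_const / t * expR (4 * b ^+ 2 * t)
    = rint (fun y => time_const / t * expR (4 * b ^+ 2 * t) * h (2 * t) y).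
  by rewrite rintZ// rint_heat_kernel// mulr1.
apply: le_rint.
- exact: (rapid_integrable b (rapid_heat_kernel_t t0)).
- by apply: integrableVZ; exact: integrableV_heat_kernel.
- by move=> y; exact: heat_kernel_t_bound.
Qed.

Lemma rint_sum (I : Type) (l : seq I) (F : I -> V -> R) :
  (forall i, integrableV (F i)) ->
  integrableV (fun y => \sum_(i <- l) F i y) /\
  rint (fun y => \sum_(i <- l) F i y) = \sum_(i <- l) rint (F i).
Proof.
move=> iF.
have i0 : integrableV (fun _ : V => 0 : R).
  by rewrite /integrableV (_ : _ \o _ = cst 0%E)//; exact: integrable0.
elim: l => [|i l [IH1 IH2]].
  under [X in integrableV X]eq_fun do rewrite big_nil.
  split=> //; under [X in rint X]eq_fun do rewrite big_nil.
  by rewrite big_nil; have := rintZ 0 i0; rewrite !mul0r.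
under [X in integrableV X]eq_fun do rewrite big_cons.
under [X in rint X]eq_fun do rewrite big_cons.
by rewrite big_cons rintD// IH2; split=> //; exact: integrableVD.
Qed.

Definition rlap u x : R := - \sum_(j < d) rderiv [:: j; j] u x.

Section weighted.
Variables (b : R) (W : V -> R).
Hypothesis mW : moderate b W.
Let W0 x : 0 < W x. Proof. by case: mW. Qed.
Let Wge0 x : 0 <= W x. Proof. exact: ltW. Qed.

Lemma smoothW_rlap u : smoothW W u -> smoothW W (rlap u).
Proof.
move=> su; apply: smoothWN; apply: smoothW_sum => // j.
exact: (smoothW_rderiv [:: j; j] su).
Qed.

Lemma conv_rlap u K : smoothW W u -> rapid K -> rconv (rlap u) K = rlap (rconv u K).
Proof.
move=> su rK; apply/funext => x; have [_ E] := smoothW_conv mW su rK.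
have -> : rlap (rconv u K) x = - \sum_(j < d) rconv (rderiv [:: j; j] u) K x.
  by congr (- _); apply: eq_bigr => j _; rewrite (E [:: j; j]).
have iF j : integrableV (fun y => rderiv [:: j; j] u (x - y) * K y).
  have sj := smoothW_rderiv [:: j; j] su.
  by apply: (integrable_conv mW) => //; [exact: rsmooth_continuous sj.1|exact: smoothW_bigW].
have [iS E2] := rint_sum (index_enum 'I_d) iF.
rewrite -E2 -mulN1r -rintZ//; congr rint; apply/funext => y.
by rewrite mulNr mulN1r mulr_suml.
Qed.

Lemma is_derive_conv_heat u x r : continuous u -> bigW W u -> 0 < r ->
  is_derive r (1 : R) (fun r => rconv u (h r) x) (rconv u (heat_kernel_t r) x).
Proof.
move=> cu bu r0; have [A A0 uA] := bigW_ge0 W0 bu.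
(* Majorant for times [s] between [r / 2] and [2 r]: the factor [1 / s] is largest at [r / 2], the
   exponential at [2 r], and [h (2 s)] is compared with [h (4 r)]. *)
pose C := time_const / (r / 2) * expR (4 * b ^+ 2 * (2 * r)) * (hconst d r / hconst d (4 * r)).
have pos s : r / 2 < s -> 0 < s by apply: lt_trans; rewrite divr_gt0.
apply: (@is_derive_rint _ _ (fun r y => u (x - y) * h r y)
  (fun r y => u (x - y) * heat_kernel_t r y) r (r / 2) (2 * r)
  (fun y => A * W x * (C * h (4 * r) y))).
- by apply/andP; split; lra.
- by move=> s /andP[/pos s0 _]; apply: (integrable_conv mW) => //; exact: rapid_heat_kernel.
- move=> s y /andP[/pos s0 _].
  have := isD_M (isD_cst (u (x - y)) s (1 : R)) (is_derive_heat_kernel_t y s0).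
  by rewrite mul0r add0r.
- by do 2!apply: integrableVZ; apply: integrableV_heat_kernel; rewrite mulr_gt0.
- move=> s y /andP[rs sr]; have s0 := pos _ rs.
  rewrite normrM; apply: (@le_trans _ _ (A * W x * (expR (b * enorm y) * `|heat_kernel_t s y|))).
    by rewrite [leRHS]mulrA ler_wpM2r//; exact: (bigW_sub mW).
  apply: ler_wpM2l; first by rewrite mulr_ge0.
  apply: (le_trans (heat_kernel_t_bound _ _ s0)).
  have hl : h (2 * s) y <= hconst d r / hconst d (4 * r) * h (4 * r) y.
    by apply: heat_kernel_le => //; apply/andP; split; lra.
  rewrite /C -[leRHS]mulrA.
  apply: ler_pM => //; first by rewrite mulr_ge0 ?expR_ge0// divr_ge0 ?time_const_ge0// ltW.
  apply: ler_pM; rewrite ?expR_ge0 ?divr_ge0 ?time_const_ge0 ?(ltW s0)//.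
    by apply: ler_wpM2l; rewrite ?time_const_ge0// lef_pV2 ?posrE ?divr_gt0// ltW.
  by rewrite ler_expR; apply: ler_wpM2l; [rewrite mulr_ge0// sqr_ge0|exact: ltW].
Qed.

(** Two integrations by parts carry the second derivatives of the kernel over to [u]; the minus sign
    is that of [rlap]. *)
Lemma conv_heat_kernel_t u r : smoothW W u -> 0 < r ->
  rconv u (heat_kernel_t r) = fun x => - rconv (rlap u) (h r) x.
Proof.
move=> su r0; have rh := rapid_heat_kernel d r0.
have cu := rsmooth_continuous su.1; have bu := smoothW_bigW su.
apply/funext => x; rewrite conv_rlap// /rlap opprK.
have [_ E] := smoothW_conv mW su rh.
transitivity (\sum_j rconv u (heat_kernel_xx j r) x).
  have iF j : integrableV (fun y => u (x - y) * heat_kernel_xx j r y).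
    by apply: (integrable_conv mW) => //; exact: rapid_heat_kernel_xx.
  have [_ <-] := rint_sum (index_enum 'I_d) iF.
  by congr rint; apply/funext => y; rewrite heat_kernel_tE mulr_sumr.
apply: eq_bigr => j _; rewrite E.
have rx := rapid_heat_kernel_x j r0; have rxx := rapid_heat_kernel_xx j r0.
rewrite -(conv_by_parts mW su rx rxx (fun y => is_derive_heat_kernel_xx j y r0)).
by rewrite -(conv_by_parts mW (smoothW_rderiv [:: j] su) rh rx
  (fun y => is_derive_heat_kernel_x j y r0)).
Qed.

Lemma conv_heat_semigroup u r s : continuous u -> bigW W u -> 0 < r -> 0 < s ->
  rconv (rconv u (h r)) (h s) = rconv u (h (r + s)).
Proof.
move=> cu bu r0 s0; apply/funext => x; have rs0 : 0 < r + s by rewrite addr_gt0.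
have q0 : 0 < r * s / (r + s) by rewrite divr_gt0// mulr_gt0.
have [A A0 uA] := bigW_ge0 W0 bu.
have rh t : 0 < t -> rapid (h t) by exact: rapid_heat_kernel.
(* With [w = y + z] the inner integral becomes one in [w], so that [u (x - w)] no longer depends on
   [y]. The majorant for Fubini comes from [heat_kernel_split]. *)
pose F y w := u (x - w) * (h r (w - y) * h s y).
have inner y : rconv u (h r) (x - y) * h s y = rint (F y).
  have -> : rconv u (h r) (x - y) = rint (fun w => u (x - w) * h r (w - y)).
    rewrite -(@rint_shift _ _ (fun w => u (x - w) * h r (w - y)) y).
      by congr rint; apply/funext => z; rewrite addrK opprD addrA addrAC.
    apply: continuous_measurableV; apply: contM; apply: cont_compV.
    - exact: cu.
    - exact: continuous_subl.
    - exact: continuous_heat_kernel.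
    - exact: continuous_addr.
  rewrite mulrC -rintZ; first by congr rint; apply/funext => w; rewrite /F; ring.
  have := @integrableV_shift _ _ (fun z => u (x - y - z) * h r z) (- y)
    (integrable_conv mW (x - y) cu bu (rh _ r0)).
  by congr integrableV; apply/funext => w; rewrite opprB addrA subrK.
rewrite {1}/rconv; under eq_fun do rewrite inner.
have [C [q [qq0 HC]]] := heat_kernel_split d r0 s0.
have C0 : 0 <= C.
  have := HC 0 0; have := heat_kernel_gt0 (0 - 0 : V) r0; have := heat_kernel_gt0 (0 : V) s0.
  have s20 : 0 < 2 * s by rewrite mulr_gt0.
  have := heat_kernel_gt0 (0 : V) s20; have := heat_kernel_gt0 (0 : V) qq0.
  move=> p1 p2 p3 p4 H; rewrite -(pmulr_lge0 _ (mulr_gt0 p1 p2)) (le_trans _ H)//.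
  by rewrite ltW// mulr_gt0.
rewrite (@rint_swap _ _ F (h (2 * s)) (fun w => A * W x * C * (expR (b * enorm w) * `|h q w|))).
- transitivity (rint (fun w => u (x - w) * h (r + s) w)); last by [].
  congr rint; apply/funext => w.
  have iq : integrableV (fun y => h (r * s / (r + s)) (y - s / (r + s) *: w)).
    by apply: (integrableV_shift (- (s / (r + s) *: w))); exact: integrableV_heat_kernel.
  transitivity (rint (fun y => (u (x - w) * h (r + s) w) *
      h (r * s / (r + s)) (y - s / (r + s) *: w))).
    by congr rint; apply/funext => y; rewrite /F heat_kernel_conv// mulrA.
  rewrite rintZ// (@rint_shift _ _ (h _)); last exact: measurableV_heat_kernel.
  by rewrite rint_heat_kernel// mulr1.
- apply: measurable_funM.
    have := @continuous_measurableV2 R d u 0 (-1) x cu.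
    by congr measurable_fun; apply/funext => p; rewrite scale0r add0r scaleN1r addrC.
  apply: measurable_funM.
    have := @continuous_measurableV2 R d (h r) (-1) 1 0 (@continuous_heat_kernel R d r).
    by congr measurable_fun; apply/funext => p; rewrite addr0 scale1r scaleN1r addrC.
  have := @continuous_measurableV2 R d (h s) 1 0 0 (@continuous_heat_kernel R d s).
  by congr measurable_fun; apply/funext => p; rewrite addr0 scale1r scale0r addr0.
- by apply: integrableV_heat_kernel; rewrite mulr_gt0.
- by apply: integrableVZ; apply: rapid_integrable; exact: rh.
- move=> y w; rewrite /F normrM [`|h r _ * _|]ger0_norm; last first.
    by apply: mulr_ge0; exact: heat_kernel_ge0.
  rewrite [`|h q w|]ger0_norm//.
  have -> : h (2 * s) y * (A * W x * C * (expR (b * enorm w) * h q w)) =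
     (A * W x * expR (b * enorm w)) * (C * (h q w * h (2 * s) y)) by ring.
  apply: ler_pM => //; first by rewrite mulr_ge0.
  exact: (bigW_sub mW).
Qed.

(** [u] is Lipschitz relative to the weight, and the Gaussian has first moment [O(sqrt s)]; [s <= 1]
    keeps the exponential factor bounded. *)
Lemma conv_heat_approx u : smoothW W u -> exists2 C, 0 <= C & forall x s, 0 < s <= 1 ->
  `|rconv u (h s) x - u x| <= C * W x * Num.sqrt s.
Proof.
move=> su; have [C C0 uC] := smoothW_lipschitz mW su.
have cu := rsmooth_continuous su.1; have bu := smoothW_bigW su.
exists (C * (16 * 2 `^ (d%:R / 2) * expR (4 * b ^+ 2))).
  by rewrite !mulr_ge0 ?powR_ge0 ?expR_ge0.
move=> x s /andP[s0 s1]; have rh := rapid_heat_kernel d s0.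
have s20 : 0 < 2 * s by rewrite mulr_gt0.
have iu := integrable_conv mW x cu bu rh.
have -> : rconv u (h s) x - u x = rint (fun y => u (x - y) * h s y - u x * h s y).
  rewrite rintB//; last by apply: integrableVZ; exact: integrableV_heat_kernel.
  by rewrite rintZ ?rint_heat_kernel ?mulr1//; exact: integrableV_heat_kernel.
pose D := C * W x * (16 * 2 `^ (d%:R / 2) * Num.sqrt s * expR (4 * b ^+ 2)).
have -> : C * (16 * 2 `^ (d%:R / 2) * expR (4 * b ^+ 2)) * W x * Num.sqrt s
   = rint (fun y => D * h (2 * s) y).
  rewrite rintZ ?rint_heat_kernel ?mulr1//; last exact: integrableV_heat_kernel.
  by rewrite /D; ring.
apply: ler_norm_rint.
- apply: integrableV_measurable; apply: integrableVB => //.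
  by apply: integrableVZ; exact: integrableV_heat_kernel.
- by apply: integrableVZ; exact: integrableV_heat_kernel.
- move=> y; rewrite -mulrBl normrM [`|h s y|]ger0_norm//.
  have := uC x (- y); rewrite enormN => uy.
  apply: (@le_trans _ _ (C * W x * (enorm y * expR (b * enorm y)) * h s y)).
    by rewrite ler_wpM2r.
  rewrite /D -mulrA -[leRHS]mulrA; apply: ler_wpM2l; first by rewrite mulr_ge0.
  have := heat_kernel_moment b y (isT : (1 <= 2)%N) s0; rewrite !expr1 => m1.
  apply: (le_trans m1); apply: ler_wpM2r => //; apply: ler_wpM2l.
    by rewrite !mulr_ge0 ?powR_ge0 ?sqrtr_ge0.
  by rewrite ler_expR -[leRHS]mulr1; apply: ler_wpM2l; [rewrite mulr_ge0// sqr_ge0|].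
Qed.

End weighted.
End heat_real.

(** * The semigroup generated by Delta + a^2 on S^a *)

Section taylor.
Variable R : realType.

Lemma is_derive_pow (n : nat) (x : R) :
  is_derive x (1 : R) (fun t : R => t ^+ n.+1) (n.+1%:R * x ^+ n).
Proof.
elim: n => [|n IH].
  have -> : (fun t : R => t ^+ 1) = id by apply/funext => t; rewrite expr1.
  by rewrite expr0 mulr1; exact: is_derive_id.
have -> : (fun t : R => t ^+ n.+2) = fun t => t * t ^+ n.+1.
  by apply/funext => t; rewrite exprS.
apply: is_derive_eq (isD_M (is_derive_id x (1 : R)) IH) _.
by rewrite -[n.+2%:R]natr1 exprS; ring.
Qed.

Definition tpow (n : nat) (x : R) : R := x ^+ n / n`!%:R.

Lemma is_derive_tpow (n : nat) (x : R) : is_derive x (1 : R) (tpow n.+1) (tpow n x).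
Proof.
have -> : tpow n.+1 = fun x => n.+1`!%:R^-1 * x ^+ n.+1.
  by apply/funext => t; rewrite /tpow mulrC.
apply: is_derive_eq (isD_Z _ (is_derive_pow n x)) _.
rewrite /tpow factS natrM; field.
by rewrite addrC natr1 !pnatr_eq0 -lt0n fact_gt0.
Qed.

Lemma is_derive_ge0_le (f f' : R -> R) (x : R) : 0 <= x ->
  (forall y, 0 <= y <= x -> is_derive y (1 : R) f (f' y)) ->
  (forall y, 0 <= y <= x -> 0 <= f' y) -> f 0 <= f x.
Proof.
rewrite le_eqVlt => /predU1P[<- //|x0] df f'0.
have cf : {within `[0, x], continuous f}.
  apply: derivable_within_continuous => y; rewrite in_itv/= => /df[].
  by [].
have df' y : y \in `]0, x[ -> is_derive y (1 : R) f (f' y).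
  by rewrite in_itv/= => /andP[y0 yx]; apply: df; rewrite !ltW.
have [c] := MVT x0 df' cf; rewrite in_itv/= => /andP[c0 cx] E.
rewrite -subr_ge0 E mulr_ge0 ?subr0 ?(ltW x0)//; apply: f'0.
by rewrite !ltW.
Qed.

(** Induction on [N]: the derivative of the remainder is the remainder of the family shifted by one,
    and its bound is integrated through the monotonicity of [K * tpow N.+1] plus or minus the
    remainder. *)
Lemma taylor_bound (N : nat) (V : nat -> R -> R) (r K : R) :
  (forall n x, 0 <= x <= r -> is_derive x (1 : R) (V n) (V n.+1 x)) ->
  (forall x, 0 <= x <= r -> `|V N x| <= K) ->
  forall x, 0 <= x <= r -> `|V 0%N x - \sum_(n < N) tpow n x * V n 0| <= K * tpow N x.
Proof.
elim: N V => [V dV VK x xr|N IH V dV VK].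
  by rewrite big_ord0 subr0 /tpow expr0 fact0 divr1 mulr1 VK.
pose G x := V 0%N x - \sum_(n < N.+1) tpow n x * V n 0.
pose G' x := V 1%N x - \sum_(n < N) tpow n x * V n.+1 0.
have dG x : 0 <= x <= r -> is_derive x (1 : R) G (G' x).
  move=> xr.
  have -> : G = fun x => V 0%N x - (V 0%N 0 + \sum_(n < N) tpow n.+1 x * V n.+1 0).
    by apply/funext => y; rewrite /G big_ord_recl /tpow expr0 fact0 divr1 mul1r.
  have dS : is_derive x (1 : R) (fun x => \sum_(n < N) tpow n.+1 x * V n.+1 0)
     (\sum_(n < N) tpow n x * V n.+1 0).
    elim: (N) => [|k IHk].
      rewrite big_ord0; under eq_fun do rewrite big_ord0; exact: isD_cst.
    under eq_fun do rewrite big_ord_recr; rewrite big_ord_recr/=.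
    apply: isD_D IHk _.
    by apply: is_derive_eq (isD_M (is_derive_tpow k x) (isD_cst _ _ _)) _; rewrite mulr0 addr0.
  apply: is_derive_eq (isD_D (dV 0%N x xr) (isD_N (isD_D (isD_cst _ _ _) dS))) _.
  by rewrite add0r.
have G0 : G 0 = 0.
  rewrite /G big_ord_recl big1 => [|i _]; last by rewrite /tpow/= expr0n !mul0r.
  by rewrite /tpow expr0 fact0 divr1 mul1r addr0 subrr.
have G'b x : 0 <= x <= r -> `|G' x| <= K * tpow N x.
  by apply: (IH (fun n => V n.+1)) => // n y yr; exact: dV.
move=> x xr; rewrite -/(G x); have /andP[x0 xr'] := xr.
have sub y : 0 <= y <= x -> 0 <= y <= r.
  by move=> /andP[-> yx]; exact: le_trans xr'.
have dK y : is_derive y (1 : R) (fun y => K * tpow N.+1 y) (K * tpow N y).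
  exact: isD_Z (is_derive_tpow N y).
have t0 : tpow N.+1 0 = 0 by rewrite /tpow expr0n mul0r.
rewrite ler_norml; apply/andP; split.
- have := @is_derive_ge0_le (fun y => K * tpow N.+1 y + G y) (fun y => K * tpow N y + G' y) x x0.
  rewrite t0 mulr0 G0 addr0 -lerBlDl sub0r; apply.
    by move=> y yx; apply: isD_D => //; exact/dG/sub.
  move=> y yx; have := G'b y (sub _ yx); rewrite ler_norml => /andP[h1 _].
  by rewrite -lerBlDl sub0r.
- have := @is_derive_ge0_le (fun y => K * tpow N.+1 y - G y) (fun y => K * tpow N y - G' y) x x0.
  rewrite t0 mulr0 G0 subr0 subr_ge0; apply.
    by move=> y yx; apply: isD_D => //; apply: isD_N; exact/dG/sub.
  by move=> y yx; have := G'b y (sub _ yx); rewrite ler_norml subr_ge0 => /andP[].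
Qed.

End taylor.

(** * Exponential weights and the normalized heat semigroup *)

Section exponential_weights.
Variables (R : realType) (d : nat) (a : R).
Hypothesis a0 : 0 < a.
Local Notation V := 'rV[R]_d.
Local Notation h := (@heat_kernel R d).
Implicit Types (u v w K : V -> R) (x y z : V).

(** Reciprocal of the weight in [Sa_gamma], whose bounds become [|D u| <= C * expW m]
    ([Sa_gamma_le]). *)
Definition expW (m : nat) x : R := expR (- (a * enorm x)) / (1 + enorm x) ^+ m.

Lemma enorm1_gt0 x : 0 < 1 + enorm x.
Proof. by rewrite ltr_pwDl. Qed.

Lemma expW_gt0 m x : 0 < expW m x.
Proof. by rewrite divr_gt0 ?expR_gt0// exprn_gt0// enorm1_gt0. Qed.

Lemma expW_ge0 m x : 0 <= expW m x.
Proof. exact/ltW/expW_gt0. Qed.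

Lemma moderate_expW m : moderate (a + m%:R) (expW m).
Proof.
split; first by rewrite addr_ge0// ltW.
  exact: expW_gt0.
move=> x y; rewrite /expW.
have E1 : expR (- (a * enorm (x + y))) <= expR (- (a * enorm x)) * expR (a * enorm y).
  rewrite -expRD ler_expR; have := ler_enormD (x + y) (- y); rewrite addrK enormN.
  by move=> /(ler_wpM2l (ltW a0)); rewrite mulrDr; lra.
(* From [1 + |x| <= (1 + |y|) (1 + |x + y|)] and [1 + |y| <= exp |y|]. *)
have E2 : (1 + enorm (x + y)) ^- m <= (1 + enorm x) ^- m * expR (m%:R * enorm y).
  rewrite expRM_natl -exprVn -[(1 + enorm x) ^- m]exprVn -exprMn.
  apply: lerXn2r; rewrite ?nnegrE.
  - by rewrite invr_ge0 ltW// enorm1_gt0.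
  - by rewrite mulr_ge0 ?expR_ge0// invr_ge0 ltW// enorm1_gt0.
  rewrite ler_pdivlMl ?enorm1_gt0// ler_pdivrMr ?enorm1_gt0//.
  apply: (@le_trans _ _ ((1 + enorm y) * (1 + enorm (x + y)))).
    have := ler_enormD (x + y) (- y); rewrite addrK enormN => h1.
    have := enorm_ge0 y; have := enorm_ge0 (x + y); nra.
  by apply: ler_wpM2r; [rewrite ltW// enorm1_gt0|exact: expR_ge1Dx].
rewrite [X in _ <= _ * X](_ : _ = expR (a * enorm y) * expR (m%:R * enorm y)); last first.
  by rewrite -expRD mulrDl.
by rewrite mulrACA ler_pM ?expR_ge0 ?invr_ge0 ?exprn_ge0// ltW// enorm1_gt0.
Qed.

Lemma expW_mono m n x : (m <= n)%N -> expW n x <= expW m x.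
Proof.
move=> mn; rewrite ler_wpM2l ?expR_ge0// lef_pV2 ?posrE ?exprn_gt0 ?enorm1_gt0//.
by apply: ler_weXn2l => //; rewrite lerDl.
Qed.

(** Real-valued members of S^a. Derivatives range over words instead of multi-indices, so that
    stability under [rderiv] is immediate. *)
Definition inS u : Prop := forall m, smoothW (expW m) u.

Lemma inS_rsmooth u : inS u -> rsmooth u.
Proof. by move=> /(_ 0%N)[]. Qed.

Lemma inS_continuous u : inS u -> continuous u.
Proof. by move=> /inS_rsmooth/rsmooth_continuous. Qed.

Lemma inS_bigW m u : inS u -> bigW (expW m) u.
Proof. by move=> /(_ m)/smoothW_bigW. Qed.

Lemma inS_rderiv s u : inS u -> inS (rderiv s u).
Proof. by move=> su m; exact: smoothW_rderiv. Qed.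

Lemma inSD u v : inS u -> inS v -> inS (fun x => u x + v x).
Proof. by move=> su sv m; exact: smoothWD. Qed.

Lemma inSZ (c : R) u : inS u -> inS (fun x => c * u x).
Proof. by move=> su m; exact: smoothWZ. Qed.

Lemma inSB u v : inS u -> inS v -> inS (fun x => u x - v x).
Proof. by move=> su sv m; exact: smoothWB. Qed.

Lemma inS_sum (I : Type) (l : seq I) (F : I -> V -> R) :
  (forall i, inS (F i)) -> inS (fun x => \sum_(i <- l) F i x).
Proof. by move=> sF m; apply: smoothW_sum => [x|i]; [exact: expW_gt0|exact: sF]. Qed.

Lemma inS_rlap u : inS u -> inS (rlap u).
Proof. by move=> su m; exact: (smoothW_rlap (moderate_expW m)). Qed.

Lemma inS_rconv u K : inS u -> rapid K -> inS (rconv u K).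
Proof. by move=> su rK m; have [] := smoothW_conv (moderate_expW m) (su m) rK. Qed.

Lemma rderiv_rconv s u K : inS u -> rapid K -> rderiv s (rconv u K) = rconv (rderiv s u) K.
Proof. by move=> su rK; have [_] := smoothW_conv (moderate_expW 0) (su 0%N) rK. Qed.

Lemma rderivB s u v : inS u -> inS v ->
  rderiv s (fun x => u x - v x) = fun x => rderiv s u x - rderiv s v x.
Proof.
move=> su sv; have sv' := inSZ (-1) sv.
have -> : (fun x => u x - v x) = (fun x => u x + -1 * v x).
  by apply/funext => x; rewrite mulN1r.
have [_ ->] := rsmoothD (inS_rsmooth su) (inS_rsmooth sv').
have [_ ->] := rsmoothZ (-1) (inS_rsmooth sv).
by apply/funext => x; rewrite mulN1r.
Qed.

Lemma rderiv_rlap s u : inS u -> rderiv s (rlap u) = rlap (rderiv s u).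
Proof.
move=> su.
have rs j := inS_rsmooth (inS_rderiv [:: j; j] su).
have sum_ (l : seq 'I_d) : rsmooth (fun x => \sum_(j <- l) rderiv [:: j; j] u x) /\
   rderiv s (fun x => \sum_(j <- l) rderiv [:: j; j] u x)
   = fun x => \sum_(j <- l) rderiv s (rderiv [:: j; j] u) x.
  have sl k : inS (fun x => \sum_(j <- k) rderiv [:: j; j] u x).
    by apply: inS_sum => j; exact: (inS_rderiv [:: j; j] su).
  elim: l => [|j l [IH1 IH2]]; split; try exact: inS_rsmooth (sl _).
    have -> : (fun x : V => \sum_(j <- [::]) rderiv [:: j; j] u x) = fun x => 0 * u x.
      by apply/funext => x; rewrite big_nil mul0r.
    have [_ ->] := rsmoothZ 0 (inS_rsmooth su).
    by apply/funext => x; rewrite big_nil mul0r.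
  have -> : (fun x : V => \sum_(i <- j :: l) rderiv [:: i; i] u x) =
      fun x => rderiv [:: j; j] u x + \sum_(i <- l) rderiv [:: i; i] u x.
    by apply/funext => x; rewrite big_cons.
  have [_ ->] := rsmoothD (rs j) IH1.
  by apply/funext => x; rewrite big_cons IH2.
have [sm E] := sum_ (index_enum 'I_d).
have -> : rlap u = fun x => -1 * \sum_(j < d) rderiv [:: j; j] u x.
  by apply/funext => x; rewrite mulN1r.
have [_ ->] := rsmoothZ (-1) sm.
apply/funext => x; rewrite E mulN1r; congr (- _); apply: eq_bigr => j _.
rewrite -!rderiv_cat; congr (_ x); apply: rderiv_perm; first exact: inS_rsmooth.
by rewrite perm_catC.
Qed.

Lemma rconvB u v K : inS u -> inS v -> rapid K ->
  rconv (fun x => u x - v x) K = fun x => rconv u K x - rconv v K x.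
Proof.
move=> su sv rK; have sv' := inSZ (-1) sv; have mW := moderate_expW 0.
have -> : (fun x => u x - v x) = (fun x => u x + -1 * v x).
  by apply/funext => x; rewrite mulN1r.
rewrite (convD mW (inS_continuous su) (inS_bigW 0 su) (inS_continuous sv') (inS_bigW 0 sv') rK).
rewrite (convZ mW (-1) (inS_continuous sv) (inS_bigW 0 sv) rK).
by apply/funext => x; rewrite mulN1r.
Qed.

(* The heat semigroup generated by Delta + a ^ 2, instead of Delta. *)
Definition nheat (s : R) u x : R := expR (- (a ^+ 2 * s)) * rconv u (h s) x.

Lemma inS_nheat s u : 0 < s -> inS u -> inS (nheat s u).
Proof. by move=> s0 su; apply: inSZ; apply: inS_rconv => //; exact: rapid_heat_kernel. Qed.

Lemma rderiv_nheat l s u : 0 < s -> inS u -> rderiv l (nheat s u) = nheat s (rderiv l u).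
Proof.
move=> s0 su; have rh := rapid_heat_kernel d s0.
have [_ ->] := rsmoothZ (expR (- (a ^+ 2 * s))) (inS_rsmooth (inS_rconv su rh)).
by rewrite rderiv_rconv.
Qed.

Lemma nheatB s u v : 0 < s -> inS u -> inS v ->
  nheat s (fun x => u x - v x) = fun x => nheat s u x - nheat s v x.
Proof.
move=> s0 su sv; apply/funext => x; rewrite /nheat rconvB//.
  by rewrite mulrBr.
exact: rapid_heat_kernel.
Qed.

Lemma nheat_semigroup r s u : 0 < r -> 0 < s -> inS u -> nheat s (nheat r u) = nheat (r + s) u.
Proof.
move=> r0 s0 su.
have rh (q : R) : 0 < q -> rapid (h q) by exact: rapid_heat_kernel.
apply/funext => x; rewrite /nheat.
rewrite (convZ (moderate_expW 0) (expR (- (a ^+ 2 * r)))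
  (inS_continuous (inS_rconv su (rh _ r0))) (inS_bigW 0 (inS_rconv su (rh _ r0))) (rh _ s0)).
rewrite (conv_heat_semigroup (moderate_expW 0) (inS_continuous su) (inS_bigW 0 su) r0 s0).
by rewrite mulrA -expRD; congr (expR _ * _); ring.
Qed.

Lemma iter_nheat n s u : 0 < s -> inS u -> iter n.+1 (nheat s) u = nheat (n.+1%:R * s) u.
Proof.
move=> s0 su; elim: n => [|n IH]; first by rewrite mul1r.
rewrite iterS IH; refine (etrans (nheat_semigroup _ s0 su) _); first by rewrite mulr_gt0.
by congr (nheat _ u); rewrite -[n.+2%:R]natr1; ring.
Qed.

End exponential_weights.

(** * Growth and decay of the normalized heat semigroup *)

Section decay_estimates.
Variables (R : realType) (d : nat) (a : R).
Hypotheses (a0 : 0 < a) (hd : (0 < d)%N).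
Local Notation V := 'rV[R]_d.
Local Notation h := (@heat_kernel R d).
Local Notation inS := (@inS R d a).
Local Notation expW := (@expW R d a).
Local Notation nheat := (@nheat R d a).
Implicit Types (u v K : V -> R) (x y z w : V) (n r s t : R).

Lemma unit_direction x : exists2 w : V, enorm w = 1 & dot w x = enorm x.
Proof.
have [/eqP x0|x0] := boolP (enorm x == 0).
  (* At [x = 0] any unit vector will do; it exists because [d > 0]. *)
  exists (delta_mx 0 (Ordinal hd)); first exact: enorm_delta.
  by rewrite x0 (enorm_eq0 x0) /dot big1// => j _; rewrite [X in _ * X]mxE mulr0.
exists ((enorm x)^-1 *: x).
  by rewrite enormZ ger0_norm ?invr_ge0// mulVf.
by rewrite dotZl -sqr_enorm expr2 mulrA mulVf// mul1r.
Qed.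

(* A step of the evolution costs the weight a factor 1 + O(1 / n), so that n
   steps cost O(1), and this weight is comparable to [expW m] up to n ^ m. *)
Definition shiftedW (n : R) (m : nat) x : R :=
  expR (- (a * enorm x)) / (n + enorm x) ^+ m.

Lemma shiftedW_gt0 n m x : 0 < n -> 0 < shiftedW n m x.
Proof. by move=> n0; rewrite divr_gt0 ?expR_gt0// exprn_gt0// ltr_pwDl. Qed.

(** Here [|x - y| >= w.(x - y) = |x| - w.y]. Keeping [w.y] instead of the larger [|y|] makes the
    loss the exponential of a linear form, whose Gaussian integral is exactly [exp (a^2 t)]. The
    other factor comes from [n + |x| <= (n + |x - y|) (1 + |y| / n)]. *)
Lemma shiftedW_sub n m (w : V) x y : 1 <= n -> enorm w = 1 -> dot w x = enorm x ->
  shiftedW n m (x - y)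
  <= shiftedW n m x * (expR (a * dot w y) * (1 + enorm y / n) ^+ m).
Proof.
move=> n1 w1 wx; have n0 : 0 < n by rewrite (lt_le_trans _ n1).
rewrite /shiftedW mulrACA; apply: ler_pM.
- exact: expR_ge0.
- by rewrite invr_ge0 exprn_ge0// addr_ge0// ltW.
- rewrite -expRD ler_expR.
  have := ler_dot_enorm w (x - y); rewrite w1 mul1r dotDr dotNr wx.
  by move=> /(ler_wpM2l (ltW a0)); rewrite mulrBr; lra.
rewrite -[_ ^- m]exprVn -[(n + enorm x) ^- m]exprVn -exprMn.
apply: lerXn2r; rewrite ?nnegrE.
- by rewrite invr_ge0 addr_ge0// ltW.
- by rewrite mulr_ge0 ?invr_ge0 ?addr_ge0// ?divr_ge0// ltW.
have px : 0 < n + enorm x by rewrite ltr_pwDl.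
have pxy : 0 < n + enorm (x - y) by rewrite ltr_pwDl.
rewrite ler_pdivlMl// ler_pdivrMr//.
have := ler_enormD (x - y) y; rewrite subrK => h1.
have : enorm y / n * n <= enorm y / n * (n + enorm (x - y)).
  by rewrite ler_wpM2l ?divr_ge0 ?(ltW n0)// lerDl.
rewrite divfK ?gt_eqF// mulrDl mul1r; lra.
Qed.

Lemma pow_le_expR m (n : R) y : 1 <= n -> (1 + enorm y / n) ^+ m <= expR (m%:R * enorm y).
Proof.
move=> n1; have n0 : 0 < n by rewrite (lt_le_trans _ n1).
rewrite expRM_natl; apply: lerXn2r; rewrite ?nnegrE ?expR_ge0//.
  by rewrite addr_ge0// divr_ge0// ltW.
apply: (@le_trans _ _ (1 + enorm y)); last exact: expR_ge1Dx.
by rewrite lerD2l ler_pdivrMr// ler_peMr.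
Qed.

Lemma expR_dot_le (w : V) y : enorm w = 1 -> expR (a * dot w y) <= expR (a * enorm y).
Proof.
move=> w1; rewrite ler_expR ler_wpM2l ?(ltW a0)//.
by have := ler_dot_enorm w y; rewrite w1 mul1r.
Qed.

Definition tiltI (w : V) (n : R) (m : nat) K : V -> R :=
  fun y => expR (a * dot w y) * (1 + enorm y / n) ^+ m * `|K y|.

Lemma integrable_tiltI w n m K : 1 <= n -> enorm w = 1 -> rapid K ->
  integrableV (tiltI w n m K).
Proof.
move=> n1 w1 rK; have n0 : 0 < n by rewrite (lt_le_trans _ n1).
have e0 y : 0 <= 1 + enorm y / n by rewrite addr_ge0// divr_ge0// ltW.
apply: (@integrableV_dom _ _ _ (fun y => expR ((a + m%:R) * enorm y) * `|K y|)).
- apply: continuous_measurableV; apply: contM; last first.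
    by apply: (@cont_comp _ _ (fun x : R => `|x|)); [exact: norm_continuous|case: rK].
  apply: contM.
    apply: cont_comp; first exact: continuous_expR.
    apply: contM; first exact: contC.
    by apply: cont_sum => j; apply: contM; [exact: contC|exact: continuous_coord].
  apply: contX; apply: contD; first exact: contC.
  by apply: contM; [exact: continuous_enorm|exact: contC].
- exact: rapid_integrable.
- move=> y; rewrite /tiltI ger0_norm; last first.
    by rewrite !mulr_ge0 ?expR_ge0 ?exprn_ge0.
  rewrite ler_wpM2r// mulrDl expRD ler_pM ?expR_ge0 ?exprn_ge0 ?expR_dot_le//.
  exact: pow_le_expR.
Qed.

(** The unit vector given by [unit_direction] depends on [x], so the mass of the tilted kernel has
    to be bounded uniformly over all directions. *)
Lemma rconv_shiftedW u K n m (C k : R) : 1 <= n -> continuous u -> rapid K -> 0 <= C ->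
  (forall x, `|u x| <= C * shiftedW n m x) ->
  (forall w, enorm w = 1 -> rint (tiltI w n m K) <= k) ->
  forall x, `|rconv u K x| <= C * k * shiftedW n m x.
Proof.
move=> n1 cu rK C0 uC Kk x; have [w w1 wx] := unit_direction x.
have n0 : 0 < n by rewrite (lt_le_trans _ n1).
have it := integrable_tiltI m n1 w1 rK.
have CW : 0 <= C * shiftedW n m x by rewrite mulr_ge0// ltW// shiftedW_gt0.
apply: (@le_trans _ _ (rint (fun y => C * shiftedW n m x * tiltI w n m K y))).
  apply: ler_norm_rint.
  - apply: continuous_measurableV; apply: contM; last by case: rK.
    by apply: cont_compV => //; exact: continuous_subl.
  - exact: integrableVZ.
  - move=> y; rewrite normrM /tiltI [leRHS]mulrA; apply: ler_wpM2r => //.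
    by rewrite (le_trans (uC _))// -mulrA ler_wpM2l//; exact: shiftedW_sub.
rewrite rintZ// mulrAC; apply: ler_wpM2r; first by rewrite ltW// shiftedW_gt0.
by apply: ler_wpM2l => //; exact: Kk.
Qed.

Lemma shiftedW1 m x : shiftedW 1 m x = expW m x.
Proof. by []. Qed.

Lemma tilt_heat_kernel (w : V) t y : 0 < t -> enorm w = 1 ->
  expR (a * dot w y) * h t y = expR (a ^+ 2 * t) * h t (y - (2 * t * a) *: w).
Proof.
move=> t0 w1; rewrite -(dotZl a w y) (heat_kernel_tilt (a *: w) y t0).
rewrite enormZ w1 mulr1 scalerA [t * _]mulrC real_normK; last exact: num_real.
by [].
Qed.

Lemma integrable_exp_heat (w : V) t : 0 < t -> enorm w = 1 ->
  integrableV (fun y => expR (a * dot w y) * h t y) /\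
  rint (fun y => expR (a * dot w y) * h t y) = expR (a ^+ 2 * t).
Proof.
move=> t0 w1.
have -> : (fun y => expR (a * dot w y) * h t y) =
    fun y => expR (a ^+ 2 * t) * h t (y + - ((2 * t * a) *: w)).
  by apply/funext => y; exact: tilt_heat_kernel.
have ish := integrableV_shift (- ((2 * t * a) *: w)) (integrableV_heat_kernel d t0).
split; first exact: integrableVZ.
by rewrite rintZ// rint_shift ?rint_heat_kernel ?mulr1//; exact: measurableV_heat_kernel.
Qed.

(** Convexity of the power: [1 + z / n] is the mean of [1] and [1 + z] with weights [1 - 1 / n] and
    [1 / n]. *)
Lemma pow1D_le m (n z : R) : 1 <= n -> 0 <= z ->
  (1 + z / n) ^+ m <= 1 + ((1 + z) ^+ m - 1) / n.
Proof.
move=> n1 z0; have n0 : 0 < n by rewrite (lt_le_trans _ n1).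
have i0 : 0 <= n^-1 by rewrite invr_ge0 ltW.
have i1 : n^-1 <= 1 by rewrite invf_le1.
elim: m => [|m IH]; first by rewrite !expr0 subrr mul0r addr0.
have p1 : 1 <= (1 + z) ^+ m by rewrite exprn_ege1// lerDl.
rewrite exprS; apply: (@le_trans _ _ ((1 + z / n) * (1 + ((1 + z) ^+ m - 1) / n))).
  by rewrite ler_wpM2l// addr_ge0// mulr_ge0.
rewrite exprS; move: (n^-1) ((1 + z) ^+ m) i0 i1 p1 => i p i0 i1 p1.
have : 0 <= i * (1 - i) * (z * (p - 1)).
  by rewrite !mulr_ge0// subr_ge0.
nra.
Qed.

Definition growth_const (t : R) (m : nat) : R :=
  expR (- (a ^+ 2 * t)) * wnorm (a + m%:R) (h t).

Lemma growth_const_ge0 t m : 0 <= growth_const t m.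
Proof. by rewrite mulr_ge0 ?expR_ge0// wnorm_ge0. Qed.

(** The tilted Gaussian has mass [exp (a^2 t)], which the normalization of [nheat] cancels exactly;
    the polynomial factor only adds [O(1 / n)], by [pow1D_le]. *)
Lemma nheat_step (n t : R) m u (C : R) : 1 <= n -> 0 < t -> continuous u -> 0 <= C ->
  (forall x, `|u x| <= C * shiftedW n m x) ->
  forall x, `|nheat t u x| <= C * (1 + growth_const t m / n) * shiftedW n m x.
Proof.
move=> n1 t0 cu C0 uC x; have n0 : 0 < n by rewrite (lt_le_trans _ n1).
have rh := rapid_heat_kernel d t0.
pose k := expR (a ^+ 2 * t) + n^-1 * wnorm (a + m%:R) (h t).
have Kk w : enorm w = 1 -> rint (tiltI w n m (h t)) <= k.
  move=> w1; have [ie eE] := integrable_exp_heat t0 w1.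
  have iw := rapid_integrable (a + m%:R) rh.
  rewrite /k -eE -rintZ// -rintD//; last exact: integrableVZ.
  apply: le_rint.
  - exact: integrable_tiltI.
  - by apply: integrableVD => //; exact: integrableVZ.
  - move=> y; rewrite /tiltI [`|h t y|]ger0_norm//.
    rewrite [X in _ <= X + _](_ : _ = expR (a * dot w y) * 1 * h t y); last by rewrite mulr1.
    rewrite mulrA -mulrDl; apply: ler_wpM2r => //.
    apply: (@le_trans _ _ (expR (a * dot w y) * (1 + n^-1 * expR (m%:R * enorm y)))).
      apply: ler_wpM2l; first exact: expR_ge0.
      apply: (le_trans (pow1D_le m n1 (enorm_ge0 y))).
      rewrite lerD2l mulrC; apply: ler_wpM2l; first by rewrite invr_ge0 ltW.
      have := pow_le_expR m y (lexx (1 : R)); rewrite divr1; lra.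
    rewrite mulrDr lerD2l mulrCA; apply: ler_wpM2l; first by rewrite invr_ge0 ltW.
    by rewrite mulrDl expRD ler_wpM2r ?expR_ge0// expR_dot_le.
have H := rconv_shiftedW n1 cu rh C0 uC Kk x.
rewrite /nheat normrM ger0_norm ?expR_ge0//.
apply: (le_trans (ler_wpM2l (expR_ge0 _) H)).
rewrite le_eqVlt; apply/orP; left; apply/eqP.
have E : expR (- (a ^+ 2 * t)) * expR (a ^+ 2 * t) = 1 by rewrite -expRD addNr expR0.
transitivity (C * (expR (- (a ^+ 2 * t)) * expR (a ^+ 2 * t) + growth_const t m / n) * shiftedW n m x).
  by rewrite /k /growth_const; ring.
by rewrite E.
Qed.

Lemma iter_nheat_inS (n : nat) t u : 0 < t -> inS u -> inS (iter n (nheat t) u).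
Proof. by move=> t0 su; elim: n => [//|n IH]; rewrite iterS; exact: inS_nheat. Qed.

Lemma nheat_growth (t : R) m u (C : R) (k : nat) : 0 < t -> inS u -> 0 <= C -> (0 < k)%N ->
  (forall x, `|u x| <= C * expW m x) ->
  forall x, `|iter k (nheat t) u x| <= C * expR (growth_const t m) * k%:R ^+ m * expW m x.
Proof.
move=> t0 su C0 k0 uC; set c := growth_const t m.
have k1 : 1 <= k%:R :> R by rewrite ler1n.
have kp : 0 < k%:R :> R by rewrite ltr0n.
have c0 : 0 <= c / k%:R by rewrite divr_ge0 ?growth_const_ge0// ltW.
(* The shift is the number of steps itself. Passing to the shifted weight costs [k ^ m], passing
   back is free, and the steps cost [(1 + c / k) ^ k <= exp c]. *)
have W1 x : expW m x <= k%:R ^+ m * shiftedW k%:R m x.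
  rewrite /expW /shiftedW mulrCA; apply: ler_wpM2l; first exact: expR_ge0.
  rewrite -exprVn -[(_ + _) ^- m]exprVn -exprMn; apply: lerXn2r; rewrite ?nnegrE.
  - by rewrite invr_ge0 addr_ge0.
  - by rewrite mulr_ge0 ?invr_ge0 ?addr_ge0// ltW.
  rewrite ler_pdivlMr ?ltr_pwDl// mulrC ler_pdivrMr ?ltr_pwDl// mulrDr mulr1.
  by rewrite lerD2l ler_peMl.
have W2 x : shiftedW k%:R m x <= expW m x.
  rewrite /expW /shiftedW; apply: ler_wpM2l; first exact: expR_ge0.
  rewrite lef_pV2 ?posrE ?exprn_gt0 ?ltr_pwDl//; by apply: lerXn2r; rewrite ?nnegrE ?addr_ge0 ?ler0n ?lerD2r.
have step i x : `|iter i (nheat t) u x| <=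
    C * k%:R ^+ m * (1 + c / k%:R) ^+ i * shiftedW k%:R m x.
  elim: i x => [|i IH] x.
    by rewrite expr0 mulr1 -mulrA (le_trans (uC x))// ler_wpM2l.
  rewrite iterS exprSr mulrA; apply: nheat_step => //.
    by apply: (@inS_continuous _ _ a); exact: iter_nheat_inS.
  by rewrite !mulr_ge0// ?exprn_ge0 ?addr_ge0// ltW.
move=> x; apply: (le_trans (step k x)).
have E : (1 + c / k%:R) ^+ k <= expR c.
  have Ec : c = k%:R * (c / k%:R) by rewrite mulrC divfK// gt_eqF.
  rewrite [X in _ <= expR X]Ec expRM_natl.
  by apply: lerXn2r; rewrite ?nnegrE ?expR_ge0 ?addr_ge0//; exact: expR_ge1Dx.
have k1m : 0 <= C * k%:R ^+ m by rewrite mulr_ge0// exprn_ge0// ltW.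
apply: (@le_trans _ _ (C * k%:R ^+ m * expR c * expW m x)).
  apply: ler_pM.
  - by apply: mulr_ge0 => //; apply: exprn_ge0; exact: addr_ge0.
  - exact: ltW (shiftedW_gt0 m x kp).
  - exact: ler_wpM2l.
  - exact: W2.
by rewrite [C * k%:R ^+ m * expR c]mulrAC.
Qed.

(* Time derivative of [nheat], up to the factor [exp (- a^2 r)]. *)
Definition nheat_kernel_t (r : R) y : R :=
  (enorm y ^+ 2 / (4 * r ^+ 2) - d%:R / (2 * r) - a ^+ 2) * h r y.

Lemma rapid_nheat_kernel_t r : 0 < r -> rapid (nheat_kernel_t r).
Proof.
move=> r0; have i1 : 0 <= d%:R / (2 * r) by rewrite divr_ge0// mulr_ge0// ltW.
have i2 : 0 <= 1 / (4 * r ^+ 2) by rewrite divr_ge0// mulr_ge0// ?sqr_ge0.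
apply: (@rapid_heat_poly _ _ _ (1 / (4 * r ^+ 2) + d%:R / (2 * r) + a ^+ 2)) => //.
  apply: contB; last exact: contC.
  apply: contB; last exact: contC.
  by apply: contM; [exact: continuous_sqr_enorm|exact: contC].
move=> y; apply: (le_trans (ler_normB _ _)); rewrite (ger0_norm (sqr_ge0 a)).
apply: (@le_trans _ _ (`|enorm y ^+ 2 / (4 * r ^+ 2)| + d%:R / (2 * r) + a ^+ 2)).
  by rewrite lerD2r (le_trans (ler_normB _ _))// (ger0_norm i1).
rewrite -[enorm y ^+ 2]mulr1 -mulrA normrM (ger0_norm i2) ger0_norm ?sqr_ge0//.
move: i1 i2 (sqr_ge0 (enorm y)) (sqr_ge0 a).
rewrite mulr1; set A := 1 / _; set B := d%:R / _; nra.
Qed.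

Lemma is_derive_nheat u x r : inS u -> 0 < r ->
  is_derive r (1 : R) (fun r => nheat r u x)
    (expR (- (a ^+ 2 * r)) * rconv u (nheat_kernel_t r) x).
Proof.
move=> su r0; have mW := moderate_expW d a0 0.
have cu := inS_continuous su; have bu := inS_bigW 0 su.
have rh := rapid_heat_kernel d r0; have rt := rapid_heat_kernel_t d r0.
have dl : is_derive r (1 : R) (fun r => - (a ^+ 2 * r)) (- a ^+ 2).
  by apply: is_derive_eq (isD_N (isD_Z _ (is_derive_id r (1 : R)))) _; rewrite mulr1.
apply: is_derive_eq (isD_M (is_derive_expR_comp dl) (is_derive_conv_heat mW x cu bu r0)) _.
have -> : rconv u (nheat_kernel_t r) x
    = rconv u (heat_kernel_t r) x - a ^+ 2 * rconv u (h r) x.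
  have i1 := integrable_conv mW x cu bu rt; have i2 := integrable_conv mW x cu bu rh.
  rewrite -rintZ// -rintB//; last exact: integrableVZ.
  by congr rint; apply/funext => y; rewrite /nheat_kernel_t /heat_kernel_t; ring.
ring.
Qed.

(** The first two factors come from [heat_kernel_moment]; [1 / 4], [a] and [d / 2] are the
    coefficients of the quadratic, linear and constant terms of [F] in [nheat_kernel_t_tilt]. *)
Definition drift_const : R := 16 * 2 `^ (d%:R / 2) * (1 / 4 + a + d%:R / 2).

Lemma drift_const_ge0 : 0 <= drift_const.
Proof. by rewrite !mulr_ge0 ?powR_ge0// !addr_ge0 ?divr_ge0// ltW. Qed.

(* After tilting by exp (a w.y) the kernel becomes the time derivative of a
   Gaussian moving with speed 2a, whose L^1 norm is O(r^-1/2). *)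
Lemma nheat_kernel_t_tilt (w : V) r : 1 <= r -> enorm w = 1 ->
  rint (tiltI w 1 0 (nheat_kernel_t r))
  <= expR (a ^+ 2 * r) * (drift_const / Num.sqrt r).
Proof.
move=> r1 w1; have r0 : 0 < r by rewrite (lt_le_trans _ r1).
have r20 : 0 < 2 * r by rewrite mulr_gt0.
(* With [y = z + 2 r a w] the square [|y|^2 / (4 r^2)] contributes [a^2], which cancels the term
   [- a^2]. The quadratic and constant terms that remain have L^1 norm [O(1 / r)], the linear one
   [O(r^-1/2)], which dominates since [r >= 1]. *)
pose F z : R := `|enorm z ^+ 2 / (4 * r ^+ 2) + a * dot w z / r - d%:R / (2 * r)| * h r z.
pose c := (2 * r * a) *: w.
have Ey y : tiltI w 1 0 (nheat_kernel_t r) y = expR (a ^+ 2 * r) * F (y + - c).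
  rewrite /tiltI expr0 mulr1 /nheat_kernel_t normrM [`|h r y|]ger0_norm// mulrCA.
  rewrite tilt_heat_kernel// /F -/c mulrCA; congr (_ * (`|_| * _)).
  rewrite sqr_enormD enormN !dotDr !dotNr /c enormZ !dotZr -(sqr_enorm w) w1 (dotC y w).
  rewrite mulr1 real_normK ?num_real//.
  by field; rewrite gt_eqF.
have cF : continuous F.
  apply: contM; last exact: continuous_heat_kernel.
  apply: (@cont_comp _ _ (fun x : R => `|x|)); first exact: norm_continuous.
  apply: contB; last exact: contC.
  apply: contD; first by apply: contM; [exact: continuous_sqr_enorm|exact: contC].
  apply: contM; last exact: contC.
  apply: contM; first exact: contC.
  by apply: cont_sum => j; apply: contM; [exact: contC|exact: continuous_coord].
have mF := continuous_measurableV cF.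
have s0 : 0 < Num.sqrt r by rewrite sqrtr_gt0.
have sE : Num.sqrt r ^+ 2 = r by rewrite sqr_sqrtr// ltW.
have s1 : 1 <= Num.sqrt r by rewrite -sqrtr1 ler_wsqrtr.
have FB z : F z <= drift_const / Num.sqrt r * h (2 * r) z.
  have m0 := heat_kernel_moment 0 z (isT : (0 <= 2)%N) r0.
  have m1 := heat_kernel_moment 0 z (isT : (1 <= 2)%N) r0.
  have m2 := heat_kernel_moment 0 z (isT : (2 <= 2)%N) r0.
  move: m0 m1 m2; rewrite !mul0r expr0n/= mulr0 mul0r expR0 !mulr1 !expr0 !expr1 mul1r sE.
  set q := 16 * _; set H := h (2 * r) z; set G := h r z; set s := Num.sqrt r.
  move=> m0 m1 m2.
  have H0 : 0 <= q * H by rewrite !mulr_ge0 ?powR_ge0.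
  have i1 : 0 <= d%:R / (2 * r) by rewrite divr_ge0// ltW.
  have i2 : 0 <= 1 / (4 * r ^+ 2) by rewrite divr_ge0// mulr_ge0// ?sqr_ge0.
  have i3 : 0 <= a / r by rewrite divr_ge0// ltW.
  have N : `|enorm z ^+ 2 / (4 * r ^+ 2) + a * dot w z / r - d%:R / (2 * r)| <=
     1 / (4 * r ^+ 2) * enorm z ^+ 2 + a / r * enorm z + d%:R / (2 * r).
    apply: (le_trans (ler_normB _ _)); rewrite (ger0_norm i1) lerD2r.
    apply: (le_trans (ler_normD _ _)); apply: lerD.
      have -> : enorm z ^+ 2 / (4 * r ^+ 2) = 1 / (4 * r ^+ 2) * enorm z ^+ 2.
        by rewrite mulrC div1r.
      by rewrite ger0_norm// mulr_ge0// sqr_ge0.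
    rewrite mulrAC normrM (ger0_norm i3); apply: ler_wpM2l => //.
    rewrite ler_norml; apply/andP; split.
      by rewrite lerNl -dotNl (le_trans (ler_dot_enorm _ _))// enormN w1 mul1r.
    by rewrite (le_trans (ler_dot_enorm _ _))// w1 mul1r.
  apply: (le_trans (ler_wpM2r (heat_kernel_ge0 _ _) N)); rewrite -/G.
  apply: (@le_trans _ _ (1 / (4 * r ^+ 2) * (q * r * H) + a / r * (q * s * H) + d%:R / (2 * r) * (q * H))).
    rewrite [leLHS]mulrDl [X in X + _ <= _]mulrDl.
    apply: lerD; first apply: lerD.
    - by rewrite -[leLHS]mulrA; exact: ler_wpM2l.
    - by rewrite -[leLHS]mulrA; exact: ler_wpM2l.
    - exact: ler_wpM2l.
  have -> : drift_const / s * H = (1 / 4 / s + a / s + d%:R / 2 / s) * (q * H).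
    by rewrite /drift_const -/q; ring.
  have sr : 1 / s >= 1 / r.
    rewrite !div1r lef_pV2 ?posrE// -sE expr2 ler_peMl// ltW//.
  have -> : 1 / (4 * r ^+ 2) * (q * r * H) + a / r * (q * s * H) + d%:R / (2 * r) * (q * H)
     = (1 / 4 * (1 / r) + a * (s / r) + d%:R / 2 * (1 / r)) * (q * H).
    by field; rewrite gt_eqF.
  apply: ler_wpM2r => //.
  have -> : s / r = 1 / s by rewrite -sE -/s; field; rewrite gt_eqF.
  have d0 : 0 <= d%:R / 2 :> R by rewrite divr_ge0.
  have e1 := ler_wpM2l d0 sr.
  have e2 : 1 / 4 * (1 / r) <= 1 / 4 * (1 / s) by apply: ler_wpM2l.
  have -> : 1 / 4 / s + a / s + d%:R / 2 / s = 1 / 4 * (1 / s) + a * (1 / s) + d%:R / 2 * (1 / s).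
    by rewrite !div1r.
  by rewrite lerD// lerD2r.
have ih := integrableV_heat_kernel d r20.
have iF : integrableV F.
  apply: (@integrableV_dom _ _ _ (fun z => drift_const / Num.sqrt r * h (2 * r) z)) => //.
    exact: integrableVZ.
  by move=> z; rewrite ger0_norm ?FB// mulr_ge0.
have -> : tiltI w 1 0 (nheat_kernel_t r) = fun y => expR (a ^+ 2 * r) * F (y + - c).
  by apply/funext.
rewrite rintZ; last exact: integrableV_shift.
apply: ler_wpM2l; first exact: expR_ge0.
rewrite rint_shift// -[leRHS]mulr1 -(@rint_heat_kernel R d _ r20) -rintZ//.
by apply: le_rint => //; exact: integrableVZ.
Qed.

Lemma nheat_derive_bound u (C r : R) : 1 <= r -> inS u -> 0 <= C ->
  (forall x, `|u x| <= C * expW 0 x) ->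
  forall x, `|expR (- (a ^+ 2 * r)) * rconv u (nheat_kernel_t r) x|
            <= C * (drift_const / Num.sqrt r) * expW 0 x.
Proof.
move=> r1 su C0 uC x; have r0 : 0 < r by rewrite (lt_le_trans _ r1).
have H := rconv_shiftedW (lexx 1) (inS_continuous su) (rapid_nheat_kernel_t r0) C0 uC
  (fun w => nheat_kernel_t_tilt r1) x.
rewrite normrM ger0_norm ?expR_ge0//; apply: (le_trans (ler_wpM2l (expR_ge0 _) H)).
rewrite le_eqVlt; apply/orP; left; apply/eqP; rewrite shiftedW1.
have E : expR (- (a ^+ 2 * r)) * expR (a ^+ 2 * r) = 1 by rewrite -expRD addNr expR0.
by rewrite -[RHS]mul1r -E; ring.
Qed.

Lemma lipschitz_derive (f f' : R -> R) (x K : R) : 0 <= x ->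
  (forall y : R, 0 <= y <= x -> is_derive y (1 : R) f (f' y)) ->
  (forall y : R, 0 <= y <= x -> `|f' y| <= K) -> `|f x - f 0| <= K * x.
Proof.
move=> x0 df fK.
have dK (y : R) : is_derive y (1 : R) (fun y : R => K * y) K.
  by apply: is_derive_eq (isD_Z _ (is_derive_id y (1 : R))) _; rewrite mulr1.
have H1 : f 0 <= K * x + f x.
  have := @is_derive_ge0_le _ (fun y : R => K * y + f y) (fun y : R => K + f' y) x x0.
  rewrite mulr0 add0r; apply.
    by move=> y yx; apply: isD_D => //; exact: df.
  by move=> y /fK; rewrite ler_norml => /andP[h1 _]; rewrite -lerBlDl sub0r.
have H2 : - f 0 <= K * x - f x.
  have := @is_derive_ge0_le _ (fun y : R => K * y - f y) (fun y : R => K - f' y) x x0.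
  rewrite mulr0 sub0r; apply.
    by move=> y yx; apply: isD_D => //; apply: isD_N; exact: df.
  by move=> y /fK; rewrite ler_norml subr_ge0 => /andP[].
by rewrite ler_norml; apply/andP; split; lra.
Qed.

Definition hdiff (s : R) u x : R := u x - nheat s u x.

Lemma inS_hdiff s u : 0 < s -> inS u -> inS (hdiff s u).
Proof. by move=> s0 su; apply: inSB => //; exact: inS_nheat. Qed.

Lemma nheat_hdiff r s u : 0 < r -> 0 < s -> inS u -> nheat r (hdiff s u) = hdiff s (nheat r u).
Proof.
move=> r0 s0 su; rewrite /hdiff (nheatB a0 r0 su (inS_nheat a0 s0 su)).
rewrite (nheat_semigroup a0 s0 r0 su) (nheat_semigroup a0 r0 s0 su) (addrC s r).
by [].
Qed.

(** As [P_r (1 - P_s) = P_r - P_(r + s)], it suffices to bound the time derivative by [O(r^-1/2)] on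
    an interval of length [s]. *)
Lemma nheat_hdiff_bound (r s C : R) u : 1 <= r -> 0 < s -> inS u -> 0 <= C ->
  (forall x, `|u x| <= C * expW 0 x) ->
  forall x, `|nheat r (hdiff s u) x| <= C * (s * drift_const / Num.sqrt r) * expW 0 x.
Proof.
move=> r1 s0 su C0 uC x; have r0 : 0 < r by rewrite (lt_le_trans _ r1).
rewrite /hdiff nheatB//; last exact: inS_nheat.
rewrite nheat_semigroup// [s + r]addrC.
pose f e := nheat (r + e) u x.
pose f' e := expR (- (a ^+ 2 * (r + e))) * rconv u (nheat_kernel_t (r + e)) x.
have df e : 0 <= e <= s -> is_derive e (1 : R) f (f' e).
  move=> /andP[e0 _]; have re : 0 < r + e by rewrite ltr_pwDl.
  have dr : is_derive e (1 : R) (fun e => r + e) 1.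
    by apply: is_derive_eq (isD_D (isD_cst r e (1 : R)) (is_derive_id e (1 : R))) _; rewrite add0r.
  by apply: is_derive_eq (is_derive1_comp (is_derive_nheat x su re) dr) _; rewrite mulr1.
have fK e : 0 <= e <= s -> `|f' e| <= C * (drift_const / Num.sqrt r) * expW 0 x.
  move=> /andP[e0 _]; have re : 1 <= r + e by rewrite (le_trans r1)// lerDl.
  apply: (le_trans (nheat_derive_bound re su C0 uC x)).
  apply: ler_wpM2r; first exact: (expW_ge0 a).
  apply: ler_wpM2l => //; apply: ler_wpM2l; first exact: drift_const_ge0.
  rewrite lef_pV2 ?posrE ?sqrtr_gt0// ?ltr_pwDl//.
  by rewrite ler_wsqrtr// lerDl.
have := lipschitz_derive (ltW s0) df fK; rewrite /f addr0 distrC => H.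
by apply: (le_trans H); rewrite le_eqVlt; apply/orP; left; apply/eqP; ring.
Qed.

End decay_estimates.

(** * Bounded sequences of functionals *)

Section asymptotics.
Variable R : realType.

(** The limits below are taken in this form, from bounds by [C / k] for large [k]. *)
Lemma le0_archi (X C : R) (k0 : nat) :
  (forall k : nat, (k0 <= k)%N -> X * k%:R <= C) -> X <= 0.
Proof.
move=> H; rewrite leNgt; apply/negP => X0.
have [n Hn] : exists n : nat, C / X < n%:R.
  exists (Num.truncn `|C / X|).+1.
  by apply: (le_lt_trans (ler_norm _)); exact: truncnS_gt.
have := H (maxn k0 n) (leq_maxl _ _).
rewrite leNgt => /negP; apply; rewrite mulrC -ltr_pdivrMr//.
by apply: (lt_le_trans Hn); rewrite ler_nat leq_maxr.
Qed.

Lemma pow_le_fact_expR (x : R) (n : nat) : 0 <= x -> x ^+ n <= n`!%:R * expR x.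
Proof.
case: n => [|n] x0; first by rewrite expr0 fact0 mul1r -expR0 ler_expR.
have := expR_ge1Dxn n x0 => H.
have f0 : 0 < n.+1`!%:R :> R by rewrite ltr0n fact_gt0.
have H2 : x ^+ n.+1 / n.+1`!%:R <= expR x by rewrite (le_trans _ H)// lerDr.
by move: H2; rewrite ler_pdivrMr// mulrC.
Qed.

(** [q ^ k] dominates [(k ln q) ^ m.+1 / m.+1!], one power of [k] more than the right-hand side; the
    spare power feeds [le0_archi]. *)
Lemma exp_beats_pow (q X C : R) (m : nat) : 1 < q -> 0 <= X ->
  (forall k : nat, (0 < k)%N -> q ^+ k * X <= C * k%:R ^+ m) -> X = 0.
Proof.
move=> q1 X0 H; apply/eqP; rewrite eq_le X0 andbT.
have q0 : 0 < q by rewrite (lt_trans _ q1).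
have l0 : 0 < ln q by exact: ln_gt0.
apply: (@le0_archi _ (C * m.+1`!%:R / ln q ^+ m.+1) 1) => k k1.
have k0 : 0 < k%:R :> R by rewrite ltr0n.
have E : (k%:R * ln q) ^+ m.+1 <= m.+1`!%:R * q ^+ k.
  have := pow_le_fact_expR m.+1 (ltW (mulr_gt0 k0 l0)).
  by rewrite expRM_natl lnK.
rewrite ler_pdivlMr ?exprn_gt0//.
have km : 0 < k%:R ^+ m :> R by rewrite exprn_gt0.
rewrite -(ler_pM2r km).
have -> : X * k%:R * ln q ^+ m.+1 * k%:R ^+ m = X * (k%:R * ln q) ^+ m.+1.
  by rewrite exprMn (exprS k%:R); ring.
apply: (le_trans (ler_wpM2l X0 E)).
have := ler_wpM2l (ler0n R m.+1`!) (H k k1); rewrite mulrCA; lra.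
Qed.

(** A continuous seminorm involves finitely many derivatives; one constant can then serve for all of
    them. *)
Lemma uniform_const (T : eqType) (l : seq T) (P : T -> R -> Prop) :
  (forall s C C', C <= C' -> P s C -> P s C') -> (forall s, exists C, P s C) ->
  exists2 C, 0 <= C & forall s, s \in l -> P s C.
Proof.
move=> mono ex; elim: l => [|s l [C C0 HC]]; first by exists 0.
have [D HD] := ex s; exists (Num.max C D); first by rewrite le_max C0.
move=> s'; rewrite in_cons => /predU1P[->|/HC].
  by apply: mono HD; rewrite le_max lexx orbT.
by apply: mono; rewrite le_max lexx.
Qed.

Lemma normc_ge0 (z : R[i]) : 0 <= normc z.
Proof. by case: z => x y; exact: sqrtr_ge0. Qed.

Lemma normc_real (c : R) : normc c%:C%C = `|c|.
Proof. by rewrite /normc /= expr0n/= addr0 sqrtr_sqr. Qed.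

Lemma normcX (z : R[i]) n : normc (z ^+ n) = normc z ^+ n.
Proof. by elim: n => [|n IH]; rewrite ?expr0 ?normc1// !exprS normcM IH. Qed.

Lemma normc_le0 (z : R[i]) : normc z <= 0 -> z = 0.
Proof. by move=> z0; apply: eq0_normc; apply/eqP; rewrite eq_le z0 normc_ge0. Qed.

Lemma bounded_second_difference (b : nat -> R[i]) (K : R) :
  (forall n, normc (b n) <= K) ->
  (forall n, b n - b n.+1 = b n.+1 - b n.+2) -> b 1%N = b 0%N.
Proof.
move=> bK b2.
have E n : b n - b n.+1 = b 0%N - b 1%N by elim: n => [//|n IH]; rewrite -b2 IH.
have F n : b 0%N - b n = (b 0%N - b 1%N) *+ n.
  elim: n => [|n IH]; first by rewrite subrr mulr0n.
  by rewrite mulrSr -IH -(E n) addrA subrK.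
apply/eqP; rewrite eq_sym -subr_eq0; apply/eqP; apply: normc_le0.
apply: (@le0_archi _ (K + K) 0) => k _.
rewrite mulr_natr -normcMn -F (le_trans (le_normcD _ _))// normcN lerD//.
Qed.

End asymptotics.

(** * Interpolated decay, the generator, and Taylor expansions in time *)

Section functional.
Variables (R : realType) (d : nat) (a : R).
Hypotheses (a0 : 0 < a) (hd : (0 < d)%N).
Local Notation V := 'rV[R]_d.
Local Notation h := (@heat_kernel R d).
Local Notation inS := (@inS R d a).
Local Notation expW := (@expW R d a).
Local Notation nheat := (@nheat R d a).
Local Notation hdiff := (@hdiff R d a).
Implicit Types (u v K : V -> R) (x y z w : V) (r s : R).

Lemma inS_iter_hdiff (n : nat) s u : 0 < s -> inS u -> inS (iter n (hdiff s) u).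
Proof. by move=> s0 su; elim: n => [//|n IH]; rewrite iterS; exact: inS_hdiff. Qed.

Lemma nheat_iter_hdiff (n : nat) r s u : 0 < r -> 0 < s -> inS u ->
  nheat r (iter n (hdiff s) u) = iter n (hdiff s) (nheat r u).
Proof.
move=> r0 s0 su; elim: n => [//|n IH]; rewrite !iterS -IH.
exact: nheat_hdiff (inS_iter_hdiff n s0 su).
Qed.

Lemma rderiv_iter_nheat l (n : nat) r u : 0 < r -> inS u ->
  rderiv l (iter n (nheat r) u) = iter n (nheat r) (rderiv l u).
Proof.
move=> r0 su; elim: n => [//|n IH]; rewrite !iterS -IH.
exact: rderiv_nheat (iter_nheat_inS a0 n r0 su).
Qed.

Lemma rderiv_iter_hdiff l (n : nat) s u : 0 < s -> inS u ->
  rderiv l (iter n (hdiff s) u) = iter n (hdiff s) (rderiv l u).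
Proof.
move=> s0 su; elim: n => [//|n IH]; rewrite !iterS -IH.
have sn := inS_iter_hdiff n s0 su.
by rewrite {1}/hdiff (rderivB _ sn (inS_nheat a0 s0 sn)) (rderiv_nheat a0 _ s0 sn).
Qed.

(** [nheat r] and [hdiff s] commute, so each of the [n] factors [hdiff s] is paired with its own
    [nheat r] and gains [O(r^-1/2)]. *)
Lemma hdiff_contract (n : nat) (r s C : R) u : 1 <= r -> 0 < s -> inS u -> 0 <= C ->
  (forall x, `|u x| <= C * expW 0 x) ->
  forall x, `|iter n (nheat r) (iter n (hdiff s) u) x|
     <= C * (s * drift_const d a / Num.sqrt r) ^+ n * expW 0 x.
Proof.
move=> r1 s0; have r0 : 0 < r by rewrite (lt_le_trans _ r1).
elim: n u C => [|n IH] u C su C0 uC x; first by rewrite expr0 mulr1; exact: uC.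
rewrite !iterSr nheat_iter_hdiff//; last exact: inS_hdiff.
rewrite exprS mulrA; apply: IH => //.
- exact: inS_nheat (inS_hdiff a0 s0 su).
- by apply: mulr_ge0 => //; rewrite divr_ge0 ?sqrtr_ge0// mulr_ge0 ?(drift_const_ge0 d a0)// ltW.
- exact: nheat_hdiff_bound.
Qed.

Lemma expW_mul (m : nat) x : expW 0 x * expW (2 * m) x = expW m x ^+ 2.
Proof.
rewrite /expW expr0 divr1 mulrA exprMn -expr2; congr (_ * _).
by rewrite exprVn -exprM mulnC.
Qed.

(* The iterates are O(k^-(2 m + 1)) for the weight [expW 0] and O(k^(2 m)) for
   [expW (2 m)]; [expW m] is the geometric mean of the two. *)
Lemma hdiff_decay (m : nat) (t s : R) u : 0 < t -> 0 < s -> inS u ->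
  exists2 C, 0 <= C & forall k : nat, (4 * m).+2%:R / t <= k%:R -> (0 < k)%N ->
    forall x, `|iter k (nheat t) (iter (4 * m).+2 (hdiff s) u) x|
      <= Num.sqrt (C / k%:R) * expW m x.
Proof.
move=> t0 s0 su; set N := (4 * m).+2; set v := iter N _ u.
have sv : inS v by exact: inS_iter_hdiff.
have [C1 C10 uC1] := bigW_ge0 (expW_gt0 a 0) (inS_bigW 0 su).
have [C2 C20 vC2] := bigW_ge0 (expW_gt0 a (2 * m)) (inS_bigW (2 * m) sv).
pose D := drift_const d a; have D0 : 0 <= D by exact: drift_const_ge0.
pose G := expR (@growth_const R d a t (2 * m)).
have N0 : 0 < N%:R :> R by rewrite ltr0n.
have K0 : 0 <= C1 * (s * D) ^+ N * (N%:R / t) ^+ (2 * m).+1 * (C2 * G).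
  have h1 : 0 <= (s * D) ^+ N by rewrite exprn_ge0// mulr_ge0// ltW.
  have h2 : 0 <= (N%:R / t) ^+ (2 * m).+1 by rewrite exprn_ge0// divr_ge0// ltW.
  have h3 : 0 <= C2 * G by rewrite mulr_ge0// expR_ge0.
  by do 3 (apply: mulr_ge0 => //).
exists (C1 * (s * D) ^+ N * (N%:R / t) ^+ (2 * m).+1 * (C2 * G)) => //.
move=> k kN k0 x; have kp : 0 < k%:R :> R by rewrite ltr0n.
(* The total time [k t] is divided into [N] equal parts, one for each factor [hdiff s]; [k] is large
   enough for each part to have length at least 1. As [N = 2 (2 m + 1)], the gain is [r^-(2 m + 1)],
   one power better than the growth [k^(2 m)]. *)
pose r := k%:R * t / N%:R.
have r1 : 1 <= r.
  by rewrite /r ler_pdivlMr// mul1r -ler_pdivrMr.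
have r0 : 0 < r by rewrite (lt_le_trans _ r1).
have E1 : iter k (nheat t) v = iter N (nheat r) v.
  have Ek := iter_nheat a0 k.-1 t0 sv; rewrite prednK// in Ek.
  rewrite {}Ek (iter_nheat a0 (4 * m).+1 r0 sv); congr (nheat _ v).
  by rewrite /r [RHS]mulrC divfK// gt_eqF.
have B1 := hdiff_contract N r1 s0 su C10 uC1 x.
have B2 := nheat_growth a0 hd t0 sv C20 k0 vC2 x.
rewrite -/v -E1 in B1.
rewrite -[leLHS]sqrtr_sqr -[X in _ * X](ger0_norm (expW_ge0 a m x)) -[X in _ * X]sqrtr_sqr.
rewrite -sqrtrM; last first.
  exact: divr_ge0.
apply: ler_wsqrtr.
have -> : iter k (nheat t) v x ^+ 2 = `|iter k (nheat t) v x| * `|iter k (nheat t) v x|.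
  by rewrite -normrM -expr2 ger0_norm// sqr_ge0.
apply: (le_trans (ler_pM (normr_ge0 _) (normr_ge0 _) B1 B2)).
have sN : Num.sqrt r ^+ N = r ^+ (2 * m).+1.
  have NE : N = (2 * (2 * m).+1)%N by rewrite mulnS mulnA add2n.
  by rewrite {}NE exprM sqr_sqrtr// ltW.
rewrite le_eqVlt; apply/orP; left; apply/eqP.
rewrite -expW_mul -/D -/G [in LHS]exprMn exprVn sN.
have -> : r ^- (2 * m).+1 = (N%:R / t) ^+ (2 * m).+1 / (k%:R ^+ (2 * m) * k%:R).
  have rV : r^-1 = N%:R / t * k%:R^-1 by rewrite /r; field; rewrite !gt_eqF.
  have E2 (n : nat) : r ^- n = (N%:R / t) ^+ n / k%:R ^+ n.
    by rewrite -[r ^- n]exprVn rV exprMn exprVn.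
  by rewrite E2 (exprSr k%:R).
have kk : k%:R ^+ (2 * m) != 0 :> R by rewrite expf_neq0// gt_eqF.
field; rewrite ?kk ?gt_eqF//.
Qed.

(* Minus the generator of the semigroup [nheat]. *)
Definition gen u x : R := rlap u x + a ^+ 2 * u x.

Lemma inS_gen u : inS u -> inS (gen u).
Proof. by move=> su; apply: inSD; [exact: inS_rlap|exact: inSZ]. Qed.

Lemma inS_iter_gen (n : nat) u : inS u -> inS (iter n gen u).
Proof. by move=> su; elim: n => [//|n IH]; rewrite iterS; exact: inS_gen. Qed.

Lemma rderiv_gen l u : inS u -> rderiv l (gen u) = gen (rderiv l u).
Proof.
move=> su; have [_ Z] := rsmoothZ (a ^+ 2) (inS_rsmooth su).
have [_ D] := rsmoothD (inS_rsmooth (inS_rlap a0 su)) (inS_rsmooth (inSZ (a ^+ 2) su)).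
by rewrite /gen D Z (rderiv_rlap _ su).
Qed.

Lemma inS_iter_rlap (n : nat) u : inS u -> inS (iter n (@rlap R d) u).
Proof. by move=> su; elim: n => [//|n IH]; rewrite iterS; exact: inS_rlap. Qed.

Lemma rderiv_iter_rlap l (n : nat) u : inS u ->
  rderiv l (iter n (@rlap R d) u) = iter n (@rlap R d) (rderiv l u).
Proof.
move=> su; elim: n => [//|n IH]; rewrite !iterS -IH.
by rewrite (rderiv_rlap l (inS_iter_rlap n su)).
Qed.

Lemma is_derive_rconv_heat u x r : inS u -> 0 < r ->
  is_derive r (1 : R) (fun r => rconv u (h r) x) (- rconv (rlap u) (h r) x).
Proof.
move=> su r0; have mW := moderate_expW d a0 0.
apply: is_derive_eq (is_derive_conv_heat mW x (inS_continuous su) (inS_bigW 0 su) r0) _.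
by rewrite (conv_heat_kernel_t mW (su 0%N) r0).
Qed.

Lemma is_derive_nheat_gen u x r : inS u -> 0 < r ->
  is_derive r (1 : R) (fun r => nheat r u x) (- nheat r (gen u) x).
Proof.
move=> su r0; have mW := moderate_expW d a0 0.
have rh := rapid_heat_kernel d r0.
have dl : is_derive r (1 : R) (fun r => - (a ^+ 2 * r)) (- a ^+ 2).
  by apply: is_derive_eq (isD_N (isD_Z _ (is_derive_id r (1 : R)))) _; rewrite mulr1.
apply: is_derive_eq (isD_M (is_derive_expR_comp dl) (is_derive_rconv_heat x su r0)) _.
have sl := inS_rlap a0 su; have sz := inSZ (a ^+ 2) su.
rewrite /nheat /gen (convD mW (inS_continuous sl) (inS_bigW 0 sl)
  (inS_continuous sz) (inS_bigW 0 sz) rh).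
by rewrite (convZ mW _ (inS_continuous su) (inS_bigW 0 su) rh); ring.
Qed.

Definition heat_mass (b r : R) : R := 16 * 2 `^ (d%:R / 2) * expR (4 * b ^+ 2 * r).

Lemma heat_mass_ge0 b r : 0 <= heat_mass b r.
Proof. by rewrite !mulr_ge0 ?powR_ge0 ?expR_ge0. Qed.

Lemma wnorm_heat_kernel b r : 0 < r -> wnorm b (h r) <= heat_mass b r.
Proof.
move=> r0; have r20 : 0 < 2 * r by rewrite mulr_gt0.
have i2 := integrableV_heat_kernel d r20.
rewrite -[leRHS]mulr1 -(@rint_heat_kernel R d _ r20) -rintZ//.
apply: le_rint.
- exact: rapid_integrable (rapid_heat_kernel d r0).
- exact: integrableVZ.
- move=> y; have := heat_kernel_moment b y (isT : (0 <= 2)%N) r0.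
  by rewrite !expr0 mul1r mulr1 ger0_norm.
Qed.

Lemma heat_mass_mono b (r s : R) : r <= s -> heat_mass b r <= heat_mass b s.
Proof.
move=> rs; apply: ler_wpM2l; first by rewrite mulr_ge0 ?powR_ge0.
by rewrite ler_expR; apply: ler_wpM2l => //; rewrite mulr_ge0// sqr_ge0.
Qed.

Lemma rconv_heat_bound (m : nat) (r T C : R) u : 0 < r <= T -> inS u -> 0 <= C ->
  (forall x, `|u x| <= C * expW m x) ->
  forall x, `|rconv u (h r) x| <= C * heat_mass (a + m%:R) T * expW m x.
Proof.
move=> /andP[r0 rT] su C0 uC x; have mW := moderate_expW d a0 m.
have rh := rapid_heat_kernel d r0.
apply: (le_trans (conv_bound mW x (inS_continuous su) C0 uC rh)).
rewrite [leRHS]mulrAC; apply: ler_wpM2l; first by rewrite mulr_ge0 ?expW_ge0.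
exact: le_trans (wnorm_heat_kernel _ r0) (heat_mass_mono _ rT).
Qed.

(** The expansion is made at the positive time [t] rather than at 0, so that only kernels at
    positive times are differentiated; invariance under [P_t] later makes this shift harmless. *)
Lemma nheat_taylor (m : nat) (t : R) u : 0 < t -> inS u -> exists2 C : R, 0 <= C &
  forall s, 0 <= s <= t -> forall x,
    `|nheat (t + s) u x - nheat t u x + s * nheat t (gen u) x| <= C * s ^+ 2 * expW m x.
Proof.
move=> t0 su; have s2 := inS_iter_gen 2 su.
have [C C0 HC] := bigW_ge0 (expW_gt0 a m) (inS_bigW m s2).
pose B := heat_mass (a + m%:R) (t + t).
have B0 : 0 <= B by exact: heat_mass_ge0.
exists (C * B / 2) => [|s st x]; first by rewrite divr_ge0// mulr_ge0.
pose F (n : nat) (r : R) := (-1) ^+ n * nheat (t + r) (iter n gen u) x.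
have dF (n : nat) (r : R) : 0 <= r <= t -> is_derive r (1 : R) (F n) (F n.+1 r).
  move=> /andP[r0 _]; have tr : 0 < t + r by rewrite ltr_pwDl.
  have dr : is_derive r (1 : R) (fun e => t + e) 1.
    by apply: is_derive_eq (isD_D (isD_cst t r (1 : R)) (is_derive_id r (1 : R))) _; rewrite add0r.
  apply: is_derive_eq (isD_Z _
    (is_derive1_comp (is_derive_nheat_gen x (inS_iter_gen n su) tr) dr)) _.
  by rewrite /F exprS iterS; ring.
have FK r : 0 <= r <= t -> `|F 2 r| <= C * B * expW m x.
  move=> /andP[r0 rt]; rewrite /F sqrrN expr1n mul1r /nheat normrM ger0_norm ?expR_ge0//.
  have tr : 0 < t + r <= t + t by rewrite ltr_pwDl// lerD2l.
  apply: (le_trans _ (rconv_heat_bound tr s2 C0 HC x)).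
  rewrite ler_piMl// -expR0 ler_expR oppr_le0 mulr_ge0 ?sqr_ge0//.
  by rewrite addr_ge0// ltW.
have := taylor_bound dF FK st.
rewrite !big_ord_recr big_ord0 /F /tpow /= !expr0 !expr1 !fact0 factS fact0 addr0 /=.
have -> : 1 * nheat (t + s) u x
    - (0 + 1 / 1%:R * (1 * nheat t u x) + s / (1 * 1)%:R * (-1 * nheat t (gen u) x))
  = nheat (t + s) u x - nheat t u x + s * nheat t (gen u) x.
  by field.
move=> H; apply: (le_trans H); rewrite le_eqVlt; apply/orP; left; apply/eqP.
by rewrite !factS fact0; ring.
Qed.

Lemma iter_rlap_heat (n : nat) (q : R) u : 0 < q -> inS u ->
  rconv (iter n.+1 (@rlap R d) u) (h (n.+1%:R * q)) =
  iter n.+1 (fun v => rconv (rlap v) (h q)) u.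
Proof.
move=> q0 su; have mW := moderate_expW d a0 0.
elim: n => [|n IH]; first by rewrite mul1r.
rewrite [RHS]iterS -IH; set v := iter n.+1 _ u.
have sv : inS v by exact: inS_iter_rlap.
have sl := inS_rlap a0 sv.
have nq : 0 < n.+1%:R * q by rewrite mulr_gt0.
rewrite -(conv_rlap mW (sv 0%N) (rapid_heat_kernel d nq)).
rewrite (conv_heat_semigroup mW (inS_continuous sl) (inS_bigW 0 sl) nq q0).
by congr (rconv _ (h _)); rewrite -[n.+2%:R]natr1; ring.
Qed.

(** Each Laplacian is given its own share [r / n.+1] of the time and costs [O(n.+1 / r)]. The
    resulting power of [n.+1] is bounded by [n.+1! * exp n.+1], a form in which the factorial
    cancels that of the Taylor remainder. *)
Lemma iter_rlap_heat_bound (n m : nat) (r T C : R) u : 0 < r <= T -> inS u -> 0 <= C ->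
  (forall x, `|u x| <= C * expW m x) ->
  forall x, `|rconv (iter n.+1 (@rlap R d) u) (h r) x| <=
    C * n.+1`!%:R * (expR 1 * time_const R d / r) ^+ n.+1
      * expR (4 * (a + m%:R) ^+ 2 * T) * expW m x.
Proof.
move=> /andP[r0 rT] su C0 uC x; have mW := moderate_expW d a0 m.
pose q := r / n.+1%:R; have q0 : 0 < q by rewrite divr_gt0.
have rq : r = n.+1%:R * q by rewrite mulrC divfK.
pose e := 4 * (a + m%:R) ^+ 2; have e0 : 0 <= e by rewrite mulr_ge0// sqr_ge0.
pose B := time_const R d / q * expR (e * q).
have c0 : 0 <= time_const R d.
  have := le_trans (wnorm_ge0 0 (heat_kernel_t 1)) (@wnorm_heat_kernel_t R d 0 1 ltr01).
  by rewrite expr0n/= mulr0 mul0r expR0 divr1 mulr1.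
have B0 : 0 <= B by rewrite mulr_ge0 ?expR_ge0// divr_ge0// ltW.
pose G v := rconv (rlap v) (h q).
have H : forall k : nat, inS (iter k G u) /\ forall x, `|iter k G u x| <= C * B ^+ k * expW m x.
  elim=> [|k [sk IH]]; first by rewrite expr0 mulr1.
  split; rewrite iterS.
    apply: inS_rconv => //; [exact: inS_rlap|exact: rapid_heat_kernel].
  move=> z; have := conv_heat_kernel_t mW (sk m) q0.
  move=> /(congr1 (fun f => f z)) E.
  have -> : G (iter k G u) z = - rconv (iter k G u) (heat_kernel_t q) z by rewrite E opprK.
  rewrite normrN; have CB : 0 <= C * B ^+ k by rewrite mulr_ge0// exprn_ge0.
  apply: (le_trans (conv_bound mW z (inS_continuous sk) CB IH (rapid_heat_kernel_t d q0))).
  rewrite exprSr mulrA [leRHS]mulrAC; apply: ler_wpM2l.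
    by rewrite mulr_ge0 ?expW_ge0.
  exact: wnorm_heat_kernel_t.
rewrite {1}rq iter_rlap_heat//; have [_ Hn] := H n.+1.
apply: (le_trans (Hn x)); apply: ler_wpM2r; first exact: expW_ge0.
rewrite -/e; move: c0 @B B0 H Hn; move: (time_const R d) => c c0 B B0 _ _.
have -> : B ^+ n.+1 = n.+1%:R ^+ n.+1 * ((c / r) ^+ n.+1 * expR (e * r)).
  have -> : B = n.+1%:R * (c / r) * expR (e * q).
    by rewrite /B rq; field; rewrite gt_eqF//= addrC natr1 pnatr_eq0.
  rewrite 2!exprMn -expRM_natl -mulrA; congr (_ * (_ * expR _)).
  by rewrite [in RHS]rq mulrCA.
have -> : C * n.+1`!%:R * (expR 1 * c / r) ^+ n.+1 * expR (e * T) =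
   C * (n.+1`!%:R * expR n.+1%:R * ((c / r) ^+ n.+1 * expR (e * T))).
  by rewrite -[expR 1 * c / r]mulrA exprMn -expRM_natl mulr1; ring.
have p0 : 0 <= (c / r) ^+ n.+1 by rewrite exprn_ge0// divr_ge0// ltW.
apply: ler_wpM2l => //; apply: ler_pM.
- by rewrite exprn_ge0.
- by rewrite mulr_ge0 ?expR_ge0.
- exact: pow_le_fact_expR.
- by apply: ler_wpM2l => //; rewrite ler_expR; apply: ler_wpM2l.
Qed.

(** Solves [c theta / (1 - theta) = 1 / 2] for [c = exp 1 * time_const]: this quotient is the ratio
    of the geometric bound on the Taylor remainders at time [(1 - theta) s]. *)
Definition theta : R := (2 * (expR 1 * time_const R d) + 1)^-1.

Lemma time_const_gt0 : 0 < time_const R d.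
Proof. by rewrite /time_const !mulr_gt0 ?powR_gt0// ltr_pwDl. Qed.

Lemma theta_itv : 0 < theta < 1.
Proof.
have c0 : 0 < 2 * (expR 1 * time_const R d) by rewrite !mulr_gt0 ?expR_gt0 ?time_const_gt0.
by rewrite invr_gt0 ltr_pwDl//= invf_lt1 ?ltrDr// ltr_pwDl.
Qed.

(* [theta] is small enough for the Taylor series of the heat semigroup at time
   [s] to converge at the earlier time [(1 - theta) s]. *)
Lemma heat_backward_taylor (n m : nat) (s T C : R) u : 0 < s <= T -> inS u -> 0 <= C ->
  (forall x, `|u x| <= C * expW m x) ->
  forall x, `|rconv u (h ((1 - theta) * s)) x
     - \sum_(k < n.+1) tpow k (theta * s) * rconv (iter k (@rlap R d) u) (h s) x|
    <= C * expR (4 * (a + m%:R) ^+ 2 * T) / 2 ^+ n.+1 * expW m x.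
Proof.
move=> /andP[s0 sT] su C0 uC x; have /andP[th0 th1] := theta_itv.
pose F (k : nat) (r : R) := rconv (iter k (@rlap R d) u) (h (s - r)) x.
pose r0 := (1 - theta) * s.
have r00 : 0 < r0 by rewrite mulr_gt0// subr_gt0.
have lo r : 0 <= r <= theta * s -> r0 <= s - r <= s.
  by move=> /andP[r1 r2]; rewrite /r0 gerBl r1 andbT; lra.
have dF (k : nat) (r : R) : 0 <= r <= theta * s -> is_derive r (1 : R) (F k) (F k.+1 r).
  move=> /lo/andP[r1 _]; have sr : 0 < s - r by rewrite (lt_le_trans r00).
  have dr : is_derive r (1 : R) (fun e => s - e) (-1).
    by apply: is_derive_eq (isD_D (isD_cst s r (1 : R)) (isD_N (is_derive_id r (1 : R)))) _; rewrite add0r.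
  have D := @is_derive1_comp _ (fun q => rconv (iter k (@rlap R d) u) (h q) x) (fun e => s - e) r
    _ _ (is_derive_rconv_heat x (inS_iter_rlap k su) sr) dr.
  refine (is_derive_eq D _).
  by rewrite /F iterS mulrN1 opprK.
pose E := expR (4 * (a + m%:R) ^+ 2 * T).
have c0 : 0 <= expR 1 * time_const R d by rewrite mulr_ge0 ?expR_ge0// ltW// time_const_gt0.
have FK r : 0 <= r <= theta * s -> `|F n.+1 r| <=
    C * n.+1`!%:R * (expR 1 * time_const R d / r0) ^+ n.+1 * E * expW m x.
  move=> /lo/andP[r1 r2]; have sr : 0 < s - r <= T.
    by rewrite (lt_le_trans r00)//= (le_trans r2).
  apply: (le_trans (iter_rlap_heat_bound n sr su C0 uC x)).
  apply: ler_wpM2r; first exact: expW_ge0.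
  apply: ler_wpM2r; first exact: expR_ge0.
  apply: ler_wpM2l; first by rewrite mulr_ge0.
  have /andP[sr0 _] := sr.
  apply: lerXn2r; rewrite ?nnegrE.
  - by rewrite divr_ge0// ltW.
  - by rewrite divr_ge0// ltW.
  by apply: ler_wpM2l => //; rewrite lef_pV2.
have xs : 0 <= theta * s <= theta * s by rewrite lexx andbT mulr_ge0// ltW.
have := taylor_bound dF FK xs; rewrite /F.
have -> : s - theta * s = (1 - theta) * s by ring.
under eq_bigr do rewrite subr0.
move=> H; apply: (le_trans H); rewrite le_eqVlt; apply/orP; left; apply/eqP.
rewrite mulrAC; congr (_ * _).
have f0 : n.+1`!%:R != 0 :> R by rewrite pnatr_eq0 -lt0n fact_gt0.
have -> : C * n.+1`!%:R * (expR 1 * time_const R d / r0) ^+ n.+1 * E * tpow n.+1 (theta * s)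
   = C * E * (expR 1 * time_const R d / r0 * (theta * s)) ^+ n.+1.
  by rewrite /tpow [in RHS]exprMn; field.
rewrite -exprVn; congr (_ * _ ^+ _).
rewrite /r0 /theta; set c := expR 1 * _ in c0 *.
have c1 : 2 * c + 1 != 0 by rewrite gt_eqF// ltr_wpDl// mulr_ge0.
have c2 : c != 0.
  apply/eqP => c00; move: th1; rewrite /theta -/c c00 mulr0 add0r invr1 ltxx//.
have -> : 1 - (2 * c + 1)^-1 = 2 * c / (2 * c + 1) by field.
by field; rewrite c2 c1 gt_eqF.
Qed.

End functional.

(** * Supercritical, critical and zero multiplier, on real test functions *)

Section dual_sequences.
Variables (R : realType) (d : nat) (a : R).
Hypotheses (a0 : 0 < a) (hd : (0 < d)%N).
Local Notation V := 'rV[R]_d.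
Local Notation h := (@heat_kernel R d).
Local Notation inS := (@inS R d a).
Local Notation expW := (@expW R d a).
Local Notation nheat := (@nheat R d a).
Local Notation hdiff := (@hdiff R d a).
Local Notation gen := (@gen R d a).
Implicit Types (u v K : V -> R) (x y z w : V) (r s : R).

Section tau.
Variables (t : R) (A : R[i]) (tau : int -> (V -> R) -> R[i]).
Variables (m0 : nat) (ws : seq (seq 'I_d)) (M : R).
Hypothesis t0 : 0 < t.
Hypothesis tauB : forall k u v, inS u -> inS v ->
  tau k (fun x => u x - v x) = tau k u - tau k v.
Hypothesis tauZ : forall k (c : R) u, inS u ->
  tau k (fun x => c * u x) = c%:C%C * tau k u.
Hypothesis tau_heat : forall k u, inS u -> tau k (rconv u (h t)) = A * tau (k + 1) u.
Hypothesis M0 : 0 <= M.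
(** Condition (2) in the form used: the fixed seminorm is dominated through one weight [expW m0] and
    finitely many derivatives, indexed by the words of [ws]. *)
Hypothesis tau_bound : forall k u (C : R), inS u -> 0 <= C ->
  (forall l, l \in ws -> forall x, `|rderiv l u x| <= C * expW m0 x) ->
  normc (tau k u) <= M * C.

Lemma family_bound (P : (V -> R) -> R -> Prop) u : inS u ->
  (forall v C C', C <= C' -> P v C -> P v C') ->
  (forall v, inS v -> exists C, P v C) ->
  exists2 C, 0 <= C & forall l, l \in ws -> P (rderiv l u) C.
Proof.
move=> su mono ex; apply: (@uniform_const _ _ ws (fun l C => P (rderiv l u) C)).
  by move=> l C C'; exact: mono.
by move=> l; apply: ex; exact: inS_rderiv.
Qed.

Lemma tau_bounded u : inS u -> exists2 C, 0 <= C & forall k, normc (tau k u) <= C.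
Proof.
move=> su.
have [C C0 HC] := family_bound (P := fun v C => forall x, `|v x| <= C * expW m0 x) su
  (fun v C C' CC' H x => le_trans (H x) (ler_wpM2r (expW_ge0 a m0 x) CC'))
  (fun v sv => inS_bigW m0 sv).
exists (M * C); first exact: mulr_ge0.
by move=> k; exact: tau_bound.
Qed.

Definition eigB : R[i] := (expR (- (a ^+ 2 * t)))%:C%C * A.

Lemma tau_nheat k u : inS u -> tau k (nheat t u) = eigB * tau (k + 1) u.
Proof.
move=> su; rewrite tauZ; last by apply: inS_rconv => //; exact: rapid_heat_kernel.
by rewrite tau_heat// mulrA.
Qed.

Lemma tau_iter_nheat (n : nat) k u : inS u ->
  tau k (iter n (nheat t) u) = eigB ^+ n * tau (k + n%:Z) u.
Proof.
move=> su; elim: n k => [|n IH] k; first by rewrite expr0 mul1r addr0.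
rewrite iterS tau_nheat; last exact: iter_nheat_inS.
by rewrite IH exprS mulrA -addrA -PoszD add1n.
Qed.

Lemma tau_growth u : inS u -> exists2 C, 0 <= C & forall (k : nat) i, (0 < k)%N ->
  normc (tau i (iter k (nheat t) u)) <= C * k%:R ^+ m0.
Proof.
move=> su.
have [C C0 HC] := family_bound (P := fun v C => forall x, `|v x| <= C * expW m0 x) su
  (fun v C C' CC' H x => le_trans (H x) (ler_wpM2r (expW_ge0 a m0 x) CC'))
  (fun v sv => inS_bigW m0 sv).
exists (M * (C * expR (@growth_const R d a t m0))).
  by rewrite !mulr_ge0 ?expR_ge0.
move=> k i k0; rewrite -mulrA; apply: tau_bound.
- exact: iter_nheat_inS.
- by rewrite !mulr_ge0 ?expR_ge0 ?exprn_ge0.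
- move=> l lw x; rewrite rderiv_iter_nheat//.
  apply: nheat_growth => //; first exact: inS_rderiv.
  exact: HC.
Qed.

Lemma normc_eigB : normc eigB = normc A / expR (t * a ^+ 2).
Proof.
rewrite normcM normc_real ger0_norm ?expR_ge0// mulrC.
by rewrite -expRN; congr (_ * expR _); ring.
Qed.

Lemma tau_supercritical u : normc A > expR (t * a ^+ 2) -> inS u -> tau 0 u = 0.
Proof.
move=> hA su; have [C C0 HC] := tau_growth su.
apply: normc_le0.
have q1 : 1 < normc eigB by rewrite normc_eigB ltr_pdivlMr ?expR_gt0// mul1r.
rewrite (@exp_beats_pow _ (normc eigB) (normc (tau 0 u)) C m0)//; first exact: normc_ge0.
move=> k k0; have := HC k (- k%:Z) k0.
by rewrite tau_iter_nheat// addNr normcM normcX.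
Qed.

Section critical.
Hypothesis hA : normc A = expR (t * a ^+ 2).

Let B1 : normc eigB = 1.
Proof. by rewrite normc_eigB hA divff// gt_eqF// expR_gt0. Qed.

Lemma normc_tau_shift (k : nat) u : inS u ->
  normc (tau 0 u) = normc (tau (- k%:Z) (iter k (nheat t) u)).
Proof. by move=> su; rewrite tau_iter_nheat// addNr normcM normcX B1 expr1n mul1r. Qed.

Lemma tau_iter_hdiff0 s u : 0 < s -> inS u -> tau 0 (iter (4 * m0).+2 (hdiff s) u) = 0.
Proof.
move=> s0 su; set N := (4 * m0).+2.
pose P v (C : R) := 0 <= C /\ forall k : nat, N%:R / t <= k%:R -> (0 < k)%N ->
    forall x, `|iter k (nheat t) (iter N (hdiff s) v) x| <= Num.sqrt (C / k%:R) * expW m0 x.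
have mono v C C' : C <= C' -> P v C -> P v C'.
  move=> CC' [C0 H]; split; first exact: le_trans CC'.
  move=> k kN k0 x; apply: (le_trans (H k kN k0 x)); apply: ler_wpM2r; first exact: expW_ge0.
  by apply: ler_wsqrtr; apply: ler_wpM2r => //; rewrite invr_ge0.
have ex v : inS v -> exists C, P v C.
  by move=> sv; have [C C0 HC] := hdiff_decay a0 hd m0 t0 s0 sv; exists C.
have [C C0 HC] := family_bound su mono ex.
set X := tau 0 _; apply: normc_le0.
have sv := inS_iter_hdiff a0 N s0 su.
(* Squaring turns the bound [M * sqrt (C / k)] into one that [le0_archi] accepts. *)
have : normc X ^+ 2 <= 0.
  apply: (@le0_archi _ _ (M ^+ 2 * C) (Num.truncn (N%:R / t)).+1) => k kN.
  have k0 : (0 < k)%N by exact: leq_trans kN.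
  have kN' : N%:R / t <= k%:R.
    by apply: (le_trans (ltW (truncnS_gt _))); rewrite ler_nat.
  have kp : 0 < k%:R :> R by rewrite ltr0n.
  rewrite /X (normc_tau_shift k sv).
  have H : normc (tau (- k%:Z) (iter k (nheat t) (iter N (hdiff s) u)))
      <= M * Num.sqrt (C / k%:R).
    apply: tau_bound; [exact: iter_nheat_inS|exact: sqrtr_ge0|].
    move=> l lw x; rewrite rderiv_iter_nheat// rderiv_iter_hdiff//.
    by have [_ ] := HC l lw; exact.
  have H2 := lerXn2r 2 (normc_ge0 _) (mulr_ge0 M0 (sqrtr_ge0 _)) H.
  apply: (le_trans (ler_wpM2r (ltW kp) H2)).
  rewrite exprMn sqr_sqrtr; last by rewrite divr_ge0// ltW.
  by rewrite -mulrA divfK ?gt_eqF.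
by move=> X2; rewrite -(@ler_pXn2r _ 2) ?nnegrE ?normc_ge0// expr0n.
Qed.

(* n steps of length t / j.+1 are whole steps of length t, which shift k and
   multiply by a factor of modulus 1, and fewer than j.+1 remaining ones. *)
Lemma tau_iter_bounded (j : nat) u : inS u ->
  exists K : R, forall n, normc (tau 0 (iter n (nheat (t / j.+1%:R)) u)) <= K.
Proof.
move=> su; set s := t / _; have s0 : 0 < s by rewrite divr_gt0.
have /choice[C HC] : forall r : nat, exists C, forall k,
    0 <= C /\ normc (tau k (iter r (nheat s) u)) <= C.
  move=> r; have [C C0 HC] := tau_bounded (iter_nheat_inS a0 r s0 su).
  by exists C.
exists (\sum_(r < j.+1) C r) => n.
have C0 (r : nat) : 0 <= C r by have [] := HC r 0.
have -> : iter n (nheat s) u = iter (n %/ j.+1) (nheat t) (iter (n %% j.+1) (nheat s) u).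
  rewrite {1}(divn_eq n j.+1) iterD iterM.
  have sv := iter_nheat_inS a0 (n %% j.+1) s0 su.
  elim: (n %/ j.+1)%N => [//|q IH]; rewrite !iterS IH.
  refine (etrans (iter_nheat a0 j s0 (iter_nheat_inS a0 q t0 sv)) _).
  by congr (nheat _ _); rewrite /s mulrC divfK.
rewrite tau_iter_nheat; last exact: iter_nheat_inS.
rewrite normcM normcX B1 expr1n mul1r.
have nj : (n %% j.+1 < j.+1)%N by rewrite ltn_mod.
apply: (@le_trans _ _ (C (Ordinal nj))); first by have [] := HC (n %% j.+1)%N (0 + (n %/ j.+1)%N%:Z).
by rewrite (bigD1 (Ordinal nj))//= lerDl sumr_ge0.
Qed.

Lemma tau_nheat_invariant (j : nat) u : inS u ->
  tau 0 (nheat (t / j.+1%:R) u) = tau 0 u.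
Proof.
move=> su; set s := t / _; have s0 : 0 < s by rewrite divr_gt0.
have step v : inS v -> (forall n, tau 0 (hdiff s (hdiff s (iter n (nheat s) v))) = 0) ->
    tau 0 (hdiff s v) = 0.
  move=> sv H; have [K HK] := tau_iter_bounded j sv.
  have sn n := iter_nheat_inS a0 n s0 sv.
  have Hd n : tau 0 (hdiff s (iter n (nheat s) v)) =
     tau 0 (iter n (nheat s) v) - tau 0 (iter n.+1 (nheat s) v).
    by rewrite /hdiff tauB//; exact: inS_nheat.
  rewrite (Hd 0%N); apply/eqP; rewrite subr_eq0 eq_sym; apply/eqP.
  apply: (bounded_second_difference HK) => n.
  rewrite -!Hd; apply/eqP; rewrite -subr_eq0; apply/eqP.
  rewrite -tauB; try exact: inS_hdiff.
  rewrite -[RHS](H n); congr (tau 0 _); apply/funext => x.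
  by rewrite iterS -(nheat_hdiff a0 s0 s0 (sn n)).
(* Descending induction on the number [N.+1] of factors; [p] bounds its distance to [(4 * m0).+2].
   The statement ranges over all [v] because [step] calls for it along the whole orbit of [v] under
   [nheat s]. *)
have all0 : forall (p N : nat) v, ((4 * m0).+1 - N <= p)%N -> inS v ->
    tau 0 (iter N.+1 (hdiff s) v) = 0.
  elim=> [|p IH] N v Np sv.
    have -> : N.+1 = ((4 * m0).+2 + (N - (4 * m0).+1))%N by lia.
    by rewrite iterD; apply: tau_iter_hdiff0 => //; exact: inS_iter_hdiff.
  rewrite iterS; apply: step; first exact: inS_iter_hdiff.
  move=> n; rewrite -[X in hdiff s (hdiff s X)](_ : iter N (hdiff s) (iter n (nheat s) v) = _).
    rewrite -iterS; apply: (IH N.+1); first by lia.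
    exact: iter_nheat_inS.
  elim: n => [//|n IHn]; rewrite !iterS -IHn nheat_iter_hdiff//.
  exact: iter_nheat_inS.
have := all0 _ 0%N u (leqnn _) su; rewrite /= /hdiff tauB//; last exact: inS_nheat.
by move=> /eqP; rewrite subr_eq0 => /eqP.
Qed.

Lemma tau_gen u : inS u -> tau 0 (gen u) = 0.
Proof.
move=> su; have sg := inS_gen a0 su.
have Inv (j : nat) v : inS v -> tau 0 (nheat (t / j.+1%:R) v) = tau 0 v.
  exact: tau_nheat_invariant.
pose P v (C : R) := forall s, 0 <= s <= t -> forall x,
  `|nheat (t + s) v x - nheat t v x + s * nheat t (gen v) x| <= C * s ^+ 2 * expW m0 x.
have mono v C C' : C <= C' -> P v C -> P v C'.
  move=> CC' H s st x; apply: (le_trans (H s st x)).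
  by apply: ler_wpM2r; [exact: expW_ge0|apply: ler_wpM2r => //; exact: sqr_ge0].
have ex v : inS v -> exists C, P v C.
  by move=> sv; have [C _ HC] := nheat_taylor a0 m0 t0 sv; exists C.
have [C C0 HC] := family_bound su mono ex.
(* By invariance [gen u] may be replaced by [nheat t (gen u)], the linear coefficient of the
   expansion at time [t]. Invariance also kills the contribution of [nheat (t + s) u - nheat t u],
   so that [s * X] is bounded by [M * C * s^2]; here [s = t / k] is a step for which invariance is
   known. *)
have I1 := Inv 0%N _ sg; rewrite divr1 in I1; rewrite -{}I1.
set X := tau 0 _; apply: normc_le0.
apply: (@le0_archi _ _ (M * C * t) 1) => k k0.
have kp : 0 < k%:R :> R by rewrite ltr0n.
pose s := t / k%:R; have s0 : 0 < s by rewrite divr_gt0.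
have st : 0 <= s <= t by rewrite ltW//= ler_pdivrMr// ler_peMr ?(ltW t0)// ler1n.
have ts : 0 < t + s by rewrite addr_gt0.
pose E v x := (nheat (t + s) v x - nheat t v x) - (- s) * nheat t (gen v) x.
have sE v : inS v -> [/\ inS (nheat (t + s) v), inS (nheat t v), inS (nheat t (gen v)),
    inS (fun x => nheat (t + s) v x - nheat t v x)
    & inS (fun x => - s * nheat t (gen v) x)].
  move=> sv; have s1 := inS_nheat a0 ts sv; have s2 := inS_nheat a0 t0 sv.
  have s3 := inS_nheat a0 t0 (inS_gen a0 sv); split=> //.
    exact: inSB.
  exact: inSZ.
have [s1 s2 s3 s4 s5] := sE u su.
have dE l : rderiv l (E u) = E (rderiv l u).
  rewrite /E (rderivB _ s4 s5) (rderivB _ s1 s2).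
  have [_ ->] := rsmoothZ (- s) (inS_rsmooth s3).
  by rewrite !(rderiv_nheat a0)// rderiv_gen.
have tE : tau 0 (E u) = s%:C%C * X.
  rewrite /E (tauB 0 s4 s5) (tauB 0 s1 s2) (tauZ 0 (- s) s3).
  rewrite -(nheat_semigroup a0 t0 s0 su).
  have -> : tau 0 (nheat s (nheat t u)) = tau 0 (nheat t u).
    by have := Inv k.-1 _ s2; rewrite prednK.
  by rewrite subrr sub0r rmorphN mulNr opprK.
have bE : normc (tau 0 (E u)) <= M * (C * s ^+ 2).
  apply: tau_bound; first exact: inSB.
    by rewrite mulr_ge0// sqr_ge0.
  move=> l lw x; rewrite dE /E mulNr opprK; exact: HC.
rewrite tE normcM normc_real gtr0_norm// in bE.
have : s * (normc X * k%:R) <= s * (M * C * t).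
  have -> : s * (M * C * t) = M * (C * s ^+ 2) * k%:R.
    by rewrite /s; field; rewrite gt_eqF.
  by rewrite mulrA; apply: ler_wpM2r => //; exact: ltW.
by rewrite ler_pM2l.
Qed.

End critical.

Section vanishing.
Hypothesis hA0 : A = 0.
Local Notation theta := (theta R d).

(** The iterated Laplacians of [u] stay in the test space, so [tau k] kills every term of the Taylor
    polynomial at time [s]. Its value at time [(1 - theta) s] is therefore its value on the
    remainder, of any order, and the remainders tend to 0. *)
Lemma tau_heat_backward k (s : R) : 0 < s <= t ->
  (forall u, inS u -> tau k (rconv u (h s)) = 0) ->
  forall u, inS u -> tau k (rconv u (h ((1 - theta) * s))) = 0.
Proof.
move=> st Z u su; have /andP[s0 _] := st; have /andP[th0 th1] := theta_itv R d.
set r := (1 - theta) * s.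
have r0 : 0 < r by rewrite mulr_gt0// subr_gt0.
have rh (q : R) : 0 < q -> rapid (h q) by exact: rapid_heat_kernel.
pose F (n : nat) v x := rconv v (h r) x
  - \sum_(i < n) tpow i (theta * s) * rconv (iter i (@rlap R d) v) (h s) x.
have H (n : nat) : [/\ inS (F n u), tau k (F n u) = tau k (rconv u (h r))
    & forall l, rderiv l (F n u) = F n (rderiv l u)].
  have FS v : F n.+1 v = fun x => F n v x - tpow n (theta * s) * rconv (iter n (@rlap R d) v) (h s) x.
    by apply/funext => x; rewrite /F big_ord_recr/= opprD addrA.
  elim: n FS => [|n IH] FS.
    have F0 v : F 0%N v = rconv v (h r).
      by apply/funext => x; rewrite /F big_ord0 subr0.
    have sr := inS_rconv a0 su (rh _ r0).
    split; [by rewrite F0|by rewrite F0|move=> l].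
    by rewrite !F0 (rderiv_rconv a0 l su (rh _ r0)).
  have {}FS v : F n.+1 v = fun x => F n v x - tpow n (theta * s) * rconv (iter n (@rlap R d) v) (h s) x.
    by apply/funext => x; rewrite /F big_ord_recr/= opprD addrA.
  have [|I1 I2 I3] := IH; first exact: FS.
  have si := inS_iter_rlap a0 n su; have sc := inS_rconv a0 si (rh _ s0).
  have sz := inSZ (tpow n (theta * s)) sc.
  split.
  - by rewrite FS; exact: inSB.
  - by rewrite FS tauB// tauZ// (Z _ si) mulr0 subr0.
  - move=> l; rewrite !FS (rderivB _ I1 sz) I3.
    have [_ ->] := rsmoothZ (tpow n (theta * s)) (inS_rsmooth sc).
    by rewrite (rderiv_rconv a0 l si (rh _ s0)) (rderiv_iter_rlap a0).
have [C C0 HC] := family_bound (P := fun v C => forall x, `|v x| <= C * expW m0 x) su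
  (fun v C C' CC' H x => le_trans (H x) (ler_wpM2r (expW_ge0 a m0 x) CC'))
  (fun v sv => inS_bigW m0 sv).
pose E := expR (4 * (a + m0%:R) ^+ 2 * t).
apply: normc_le0; set X := normc _; have X0 : 0 <= X by exact: normc_ge0.
apply: (@le0_archi _ _ (M * (C * E)) 1) => -[//|n] _.
have [H1 H2 H3] := H n.+1.
have B : X <= M * (C * E / 2 ^+ n.+1).
  rewrite /X -H2; apply: tau_bound => //.
    by rewrite divr_ge0 ?exprn_ge0// mulr_ge0 ?expR_ge0.
  move=> l lw x; rewrite H3.
  apply: (heat_backward_taylor a0 n st (inS_rderiv l su) C0).
  exact: HC.
have p0 : 0 < 2 ^+ n.+1 :> R by rewrite exprn_gt0.
rewrite mulrA ler_pdivlMr// -mulrA in B || idtac.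
have : X * 2 ^+ n.+1 <= M * (C * E).
  have -> : M * (C * E) = M * (C * E / 2 ^+ n.+1) * 2 ^+ n.+1.
    by field; rewrite gt_eqF.
  by apply: ler_wpM2r => //; exact: ltW.
apply: le_trans; apply: ler_wpM2l => //.
by rewrite -natrX ler_nat ltnW// ltn_expl.
Qed.

Lemma tau_vanish k u : inS u -> tau k u = 0.
Proof.
move=> su; have /andP[th0 th1] := theta_itv R d.
have q0 : 0 < 1 - theta by rewrite subr_gt0.
pose s (n : nat) := (1 - theta) ^+ n * t.
have s0 n : 0 < s n by rewrite mulr_gt0// exprn_gt0.
have st n : 0 < s n <= t.
  have q1 : 1 - theta <= 1 by rewrite gerBl ltW.
  by rewrite s0/= ler_piMl ?(ltW t0)// exprn_ile1// ltW.
have Z n : forall v, inS v -> tau k (rconv v (h (s n))) = 0.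
  elim: n => [|n IH].
    by move=> v sv; rewrite /s expr0 mul1r tau_heat// hA0 mul0r.
  have -> : s n.+1 = (1 - theta) * s n by rewrite /s exprS mulrA.
  exact: tau_heat_backward (st n) IH.
(* A Bernoulli inequality, [(1 - theta)^n <= 1 / (1 + theta n)]: the times are [O(1 / n)]. The error
   [O(sqrt (s n))] made by smoothing [u] for time [s n] is then, once squared, of the form needed by
   [le0_archi]. *)
have sn n : s n * (1 + theta * n%:R) <= t.
  have E : (1 - theta) ^+ n * (1 + theta * n%:R) <= 1.
    elim: n => [|n IH]; first by rewrite expr0 mul1r mulr0 addr0.
    rewrite exprSr -mulrA; apply: le_trans IH; apply: ler_wpM2l.
      by rewrite exprn_ge0// ltW.
    rewrite -natr1; have := ler0n R n; move: (n%:R : R) => x x0.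
    have : 0 <= theta * theta * x by rewrite !mulr_ge0// ltW.
    have : 0 <= theta * theta by rewrite mulr_ge0// ltW.
    nra.
  by rewrite /s mulrAC ler_piMl// ltW.
pose P v (C : R) := forall x q, 0 < q <= 1 ->
  `|rconv v (h q) x - v x| <= C * expW m0 x * Num.sqrt q.
have mono v C C' : C <= C' -> P v C -> P v C'.
  move=> CC' H x q q1; apply: (le_trans (H x q q1)).
  by apply: ler_wpM2r; [exact: sqrtr_ge0|apply: ler_wpM2r => //; exact: expW_ge0].
have ex v : inS v -> exists C, P v C.
  by move=> sv; have [C _ HC] := conv_heat_approx (moderate_expW d a0 m0) (sv m0); exists C.
have [C C0 HC] := family_bound su mono ex.
set X := tau k u; apply: normc_le0.
have : normc X ^+ 2 <= 0.
  pose n0 := (Num.truncn (t / theta)).+1.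
  apply: (@le0_archi _ _ ((M * C) ^+ 2 * t / theta) n0) => n nn.
  have n1 : t <= theta * n%:R.
    rewrite mulrC -ler_pdivrMr//; apply: (le_trans (ltW (truncnS_gt _))).
    by rewrite ler_nat.
  have sn1 : 0 < s n <= 1.
    rewrite s0/=; have h1 := sn n; have h2 := s0 n.
    have h3 : s n * t <= s n * (theta * n%:R) by apply: ler_wpM2l => //; exact: ltW.
    rewrite -(ler_pM2r t0) mul1r; move: h1 h3; rewrite mulrDr mulr1; lra.
  have rh := rapid_heat_kernel d (s0 n).
  have sc := inS_rconv a0 su rh.
  have B : normc X <= M * (C * Num.sqrt (s n)).
    have -> : X = - tau k (fun x => rconv u (h (s n)) x - u x).
      by rewrite tauB// (Z n _ su) sub0r opprK.
    rewrite normcN; apply: tau_bound; first exact: inSB.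
      by rewrite mulr_ge0 ?sqrtr_ge0.
    move=> l lw x; rewrite (rderivB _ sc su) (rderiv_rconv a0 l su rh).
    by rewrite mulrAC; exact: HC.
  have B2 : normc X ^+ 2 <= (M * C) ^+ 2 * s n.
    have -> : (M * C) ^+ 2 * s n = (M * (C * Num.sqrt (s n))) ^+ 2.
      by rewrite [M * (C * _)]mulrA [RHS]exprMn sqr_sqrtr// ltW.
    apply: lerXn2r => //; rewrite nnegrE ?normc_ge0//.
    by rewrite !mulr_ge0 ?sqrtr_ge0.
  have B3 : s n * n%:R <= t / theta.
    rewrite ler_pdivlMr//; apply: le_trans (sn n); have := s0 n; lra.
  apply: (le_trans (ler_wpM2r (ler0n _ n) B2)).
  by rewrite -[leLHS]mulrA -[leRHS]mulrA; apply: ler_wpM2l => //; exact: sqr_ge0.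
by move=> X2; rewrite -(@ler_pXn2r _ 2) ?nnegrE ?normc_ge0// expr0n.
Qed.

End vanishing.
End tau.
End dual_sequences.

(** * Complex test functions *)

Section complex_test_functions.
Variables (R : realType) (d : nat) (a : R).
Hypothesis a0 : 0 < a.
Local Notation V := 'rV[R]_d.
Local Notation C := R[i].
Local Notation h := (@heat_kernel R d).
Local Notation inS := (@inS R d a).
Local Notation expW := (@expW R d a).
Local Notation Sa := (@Sa R d a).
Implicit Types (u v : V -> R) (f g : V -> C) (x : V) (al : multi_index d).

Definition re f : V -> R := fun x => complex.Re (f x).
Definition im f : V -> R := fun x => complex.Im (f x).
Definition pk u v : V -> C := fun x => (u x +i* v x)%C.

Lemma pk_re_im f : f = pk (re f) (im f).
Proof. by apply/funext => x; rewrite /pk /re /im; case: (f x). Qed.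

Lemma ler_Re_normc (z : C) : `|complex.Re z| <= normc z.
Proof. by case: z => x y /=; rewrite -sqrtr_sqr ler_wsqrtr// lerDl sqr_ge0. Qed.

Lemma ler_Im_normc (z : C) : `|complex.Im z| <= normc z.
Proof. by case: z => x y /=; rewrite -sqrtr_sqr ler_wsqrtr// lerDr sqr_ge0. Qed.

Lemma normc_le_ReIm (z : C) : normc z <= `|complex.Re z| + `|complex.Im z|.
Proof.
case: z => x y /=; have s0 : 0 <= `|x| + `|y| by rewrite addr_ge0.
rewrite -[leRHS](ger0_norm s0) -sqrtr_sqr ler_wsqrtr// sqrrD.
rewrite !real_normK ?num_real// lerD2r lerDl.
by rewrite mulrn_wge0// mulr_ge0.
Qed.

Lemma Sa_gamma_le (m : nat) al f (c : R) :
  (Sa_gamma a (m, al) f <= c%:E)%E <->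
  forall x, normc (mderiv al f x) <= c * expW m x.
Proof.
have E x : (normc (mderiv al f x) <= c * expW m x) =
    (expR (a * enorm x) * (1 + enorm x) ^+ m * normc (mderiv al f x) <= c).
  rewrite /expW expRN mulrA ler_pdivlMr ?exprn_gt0 ?enorm1_gt0//.
  rewrite ler_pdivlMr ?expR_gt0//; congr (_ <= _); ring.
split=> [H x|H].
  rewrite E -lee_fin; apply: le_trans H; apply: ereal_sup_ubound.
  by exists x.
by apply: ge_ereal_sup => _ [x _ <-]; rewrite lee_fin -E.
Qed.

Lemma Sa_gamma_lty (m : nat) al f :
  (Sa_gamma a (m, al) f < +oo)%E <-> exists c, (Sa_gamma a (m, al) f <= c%:E)%E.
Proof.
split=> [|[c H]]; last exact: le_lt_trans H (ltry _).
case: (Sa_gamma a (m, al) f) => [r|//|] _; first by exists r.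
by exists 0; rewrite leNye.
Qed.

Lemma Sa_inS f : Sa f <-> inS (re f) /\ inS (im f).
Proof.
split.
  move=> [[s1 s2] H].
  have B m l : exists c, forall x, `|rderiv l (re f) x| <= c * expW m x /\
      `|rderiv l (im f) x| <= c * expW m x.
    have [al pal] := perm_mi_word l.
    have /Sa_gamma_lty[c /Sa_gamma_le Hc] := H (m, al).
    exists c => x; rewrite (rderiv_perm s1 pal) (rderiv_perm s2 pal).
    split.
      exact: le_trans (ler_Re_normc (mderiv al f x)) (Hc x).
    exact: le_trans (ler_Im_normc (mderiv al f x)) (Hc x).
  split=> m; split=> // l; have [c Hc] := B m l; exists c => x.
    by have [] := Hc x.
  by have [] := Hc x.
move=> [s1 s2]; split; first by split; exact: inS_rsmooth.
move=> [m al]; apply/Sa_gamma_lty.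
have [c1 H1] := inS_bigW m (inS_rderiv (mi_word al) s1).
have [c2 H2] := inS_bigW m (inS_rderiv (mi_word al) s2).
exists (c1 + c2); apply/Sa_gamma_le => x; rewrite mulrDl.
apply: (le_trans (normc_le_ReIm _)); apply: lerD; [exact: H1|exact: H2].
Qed.

Lemma inS0 : inS (fun=> 0).
Proof. by move=> m; apply: smoothW0; exact: expW_gt0. Qed.

Lemma rderiv0 (l : seq 'I_d) : rderiv l (fun _ : V => 0 : R) = fun=> 0.
Proof.
have := (rsmoothZ 0 (inS_rsmooth inS0)).2 l.
have -> : (fun _ : V => 0 * 0) = (fun=> 0 : R) by apply/funext => x; rewrite mul0r.
by move=> ->; apply/funext => x; rewrite mul0r.
Qed.

Lemma Sa_pk u v : inS u -> inS v -> Sa (pk u v).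
Proof. by move=> su sv; apply/Sa_inS. Qed.

Lemma Sa_pk0 u : inS u -> Sa (pk u (fun=> 0)).
Proof. by move=> su; apply: Sa_pk => //; exact: inS0. Qed.

Lemma heat_pk (t : R) f : heat t f = pk (rconv (re f) (h t)) (rconv (im f) (h t)).
Proof.
apply/funext => x; rewrite /heat /convolution /cint /pk /rconv.
congr (complex.Complex _ _); congr rint; apply/funext => y; rewrite /re /im.
  by case: (f (x - y)) => p q /=; rewrite mulr0 subr0.
by case: (f (x - y)) => p q /=; rewrite mulr0 add0r.
Qed.

Lemma complex_sum (I : Type) (l : seq I) (F : I -> C) :
  \sum_(i <- l) F i
  = ((\sum_(i <- l) complex.Re (F i)) +i* (\sum_(i <- l) complex.Im (F i)))%C.
Proof.
elim: l => [|i l IH]; first by rewrite !big_nil.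
by rewrite !big_cons IH; case: (F i).
Qed.

Lemma laplacian_pk f : laplacian f = pk (rlap (re f)) (rlap (im f)).
Proof.
apply/funext => x; rewrite /laplacian /pk /rlap.
rewrite -[RHS]/(- ((\sum_(j < d) rderiv [:: j; j] (re f) x)
  +i* (\sum_(j < d) rderiv [:: j; j] (im f) x))%C); congr (- _).
exact: (complex_sum _ (fun j : 'I_d => cderiv [:: j; j] f x)).
Qed.

Lemma rconv0 (K : V -> R) : rconv (fun=> 0) K = fun=> 0.
Proof.
apply/funext => x; apply/eqP; rewrite -normr_le0 /rconv.
have -> : (fun y => 0 * K y) = (fun=> 0) by apply/funext => y; rewrite mul0r.
by rewrite /rint /Rintegral integral0 normr0.
Qed.

Lemma mderivZ al (c : R) f : Sa f ->
  mderiv al (fun x => c%:C%C * f x) = fun x => c%:C%C * mderiv al f x.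
Proof.
move=> /Sa_inS[s1 s2]; apply/funext => x; rewrite /mderiv /cderiv -/(mi_word al).
have -> : (fun y => complex.Re (c%:C%C * f y)) = fun y => c * re f y.
  by apply/funext => y; rewrite /re; case: (f y) => p q /=; rewrite mul0r subr0.
have -> : (fun y => complex.Im (c%:C%C * f y)) = fun y => c * im f y.
  by apply/funext => y; rewrite /im; case: (f y) => p q /=; rewrite mul0r addr0.
rewrite (rsmoothZ c (inS_rsmooth s1)).2 (rsmoothZ c (inS_rsmooth s2)).2.
by rewrite /GRing.mul /=; congr (_ +i* _)%C; rewrite mul0r ?subr0 ?addr0.
Qed.

Lemma SaZ (c : R) f : Sa f -> Sa (fun x => c%:C%C * f x).
Proof.
move=> sf; have /Sa_inS[s1 s2] := sf; apply/Sa_inS; split.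
  have -> : re (fun x => c%:C%C * f x) = fun y => c * re f y.
    by apply/funext => y; rewrite /re; case: (f y) => p q /=; rewrite mul0r subr0.
  exact: inSZ.
have -> : im (fun x => c%:C%C * f x) = fun y => c * im f y.
  by apply/funext => y; rewrite /im; case: (f y) => p q /=; rewrite mul0r addr0.
exact: inSZ.
Qed.

(** Continuity at 0 yields a basic neighbourhood of 0 on which [|p| < 1]; homogeneity spreads this
    bound to all test functions. *)
Lemma seminorm_bound (p : (V -> C) -> R) : Sa_seminorm a p ->
  exists (s : seq (nat * multi_index d)) (K : R), 0 < K /\
    forall g (c : R), Sa g -> 0 < c ->
      (forall i, i \in s -> forall x, normc (mderiv i.2 g x) <= c * expW i.1 x) ->
      p g <= K * c.
Proof.
move=> [pD pZ pc]; have S0 : Sa (fun=> 0) by exact: Sa_pk0 inS0.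
have p0 : p (fun=> 0) = 0.
  have := pZ 0 _ S0.
  have -> : (fun x : V => 0 * 0) = (fun=> 0 : C) by apply/funext => x; rewrite mulr0.
  by rewrite normc0 mul0r.
have := pc _ S0 _ (nbhsx_ballx (p (fun=> 0)) 1 ltr01); rewrite p0.
move=> [s [e [e0 He]]]; exists s, (2 / e); split; first by rewrite divr_gt0.
move=> g c sg c0 Hg.
(* The factor 2 leaves room for the strict inequality of [Sa_nbhs]: a supremum of values at most
   [e / 2] is below [e]. *)
pose k := e / (2 * c); have k0 : 0 < k by rewrite divr_gt0// mulr_gt0.
have pk1 : `|p (fun x => k%:C%C * g x)| < 1.
  rewrite -normrN -sub0r; apply: (He _ (SaZ k sg)) => -[m al] ims.
  have -> : (fun x => k%:C%C * g x - 0) = (fun x => k%:C%C * g x).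
    by apply/funext => x; rewrite subr0.
  apply: (@le_lt_trans _ _ (e / 2)%:E); last first.
    by rewrite lte_fin ltr_pdivrMr// ltr_pMr// ltr1n.
  apply/Sa_gamma_le => x; rewrite mderivZ// normcM normc_real gtr0_norm//.
  have -> : e / 2 = k * c by rewrite /k; field; rewrite gt_eqF.
  by rewrite -mulrA; apply: ler_wpM2l; [exact: ltW|exact: Hg ims x].
have := le_lt_trans (ler_norm _) pk1.
rewrite pZ// normc_real gtr0_norm// => /ltW.
have -> : k = (2 / e * c)^-1 by rewrite /k; field; rewrite !gt_eqF.
by rewrite mulrC ler_pdivrMr ?mul1r// mulr_gt0// divr_gt0.
Qed.

Section sequences.
Variables (t : R) (A : C) (T : int -> distr R d).
Hypothesis t0 : 0 < t.
Hypothesis seqT : heat_sequence t a A T.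

(* Real test functions suffice, by complex linearity. *)
Definition tau (k : int) u : C := T k (pk u (fun=> 0)).

Let lin k : Sa_dual a (T k). Proof. by have [] := seqT. Qed.

Lemma distr_pk k u v : inS u -> inS v -> T k (pk u v) = tau k u + 'i%C * tau k v.
Proof.
move=> su sv; have [TD TZ _] := lin k.
have -> : pk u v = fun x => pk u (fun=> 0) x + 'i%C * pk v (fun=> 0) x.
  apply/funext => x; rewrite /pk /GRing.add /GRing.mul /=.
  by congr (complex.Complex _ _); ring.
rewrite TD; [|exact: Sa_pk0|].
  by rewrite TZ//; exact: Sa_pk0.
have -> : (fun x => 'i%C * pk v (fun=> 0) x) = pk (fun=> 0) v.
  apply/funext => x; rewrite /pk /GRing.mul /=.
  by congr (complex.Complex _ _); ring.
by apply: Sa_pk => //; exact: inS0.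
Qed.

Lemma tauZ k (c : R) u : inS u -> tau k (fun x => c * u x) = c%:C%C * tau k u.
Proof.
move=> su; have [_ TZ _] := lin k; rewrite /tau -TZ; last exact: Sa_pk0.
congr (T k _); apply/funext => x; rewrite /pk [RHS]/GRing.mul /=.
by congr (complex.Complex _ _); ring.
Qed.

Lemma tauB k u v : inS u -> inS v -> tau k (fun x => u x - v x) = tau k u - tau k v.
Proof.
move=> su sv; have [TD _ _] := lin k.
have -> : tau k u - tau k v = tau k u + tau k (fun x => -1 * v x).
  by rewrite tauZ// rmorphN1 mulN1r.
rewrite /tau -TD; [|exact: Sa_pk0|by apply: Sa_pk0; exact: inSZ].
congr (T k _); apply/funext => x; rewrite /pk [RHS]/GRing.add /=.
by congr (complex.Complex _ _); ring.
Qed.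

Lemma tau_heat k u : inS u -> tau k (rconv u (h t)) = A * tau (k + 1) u.
Proof.
move=> su; have [_ H _] := seqT.
have := H k _ (Sa_pk0 su); rewrite /distr_heat /distr_scale heat_pk.
by rewrite -[im _]/(fun=> 0) rconv0.
Qed.

Lemma tau_bounds : exists (m0 : nat) (ws : seq (seq 'I_d)) (M : R), 0 <= M /\
  forall k u (c : R), inS u -> 0 <= c ->
  (forall l, l \in ws -> forall x, `|rderiv l u x| <= c * expW m0 x) ->
  normc (tau k u) <= M * c.
Proof.
have [_ _ [p [M [sp M0 HM]]]] := seqT.
have [s [K [K0 HK]]] := seminorm_bound sp.
exists (\max_(i <- s) i.1), [seq mi_word i.2 | i <- s], (M * K).
split; first by rewrite mulr_ge0// ltW.
move=> k u c su c0 Hu.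
have MK : 0 < M * K by rewrite mulr_gt0.
(* [seminorm_bound] asks for a positive constant while [c] may vanish; [c] is increased by an amount
   that costs exactly [e]. *)
apply/ler_addgt0Pr => e e0; pose c' := c + e / (M * K).
have c'0 : 0 < c' by rewrite ltr_wpDl// divr_gt0.
have -> : M * K * c + e = M * (K * c').
  by rewrite /c'; field; rewrite !gt_eqF.
apply: (le_trans (HM k _ (Sa_pk0 su))); apply: ler_wpM2l; first exact: ltW.
apply: HK => // [|[m al] ims x]; first exact: Sa_pk0.
rewrite /mderiv /cderiv -/(mi_word al) /pk /= rderiv0 expr0n addr0 sqrtr_sqr.
apply: (@le_trans _ _ (c * expW (\max_(i <- s) i.1) x)).
  by apply: Hu; apply/mapP; exists (m, al).
apply: ler_pM => //; first exact: expW_ge0.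
  by rewrite lerDl divr_ge0// ltW.
by apply: expW_mono; exact: (leq_bigmax_seq (m, al)).
Qed.

Lemma supercritical_zero : (0 < d)%N -> normc A > expR (t * a ^+ 2) ->
  Sa_eq a (T 0) (@distr_zero R d).
Proof.
move=> hd hA psi /Sa_inS[s1 s2]; have [m0 [ws [M [M0 HM]]]] := tau_bounds.
have H := tau_supercritical a0 hd t0 tauZ tau_heat M0 HM hA.
by rewrite (pk_re_im psi) distr_pk// !H// mulr0 addr0.
Qed.

Lemma critical_eigen : (0 < d)%N -> normc A = expR (t * a ^+ 2) ->
  Sa_eq a (distr_laplacian (T 0)) (distr_scale (- (a ^+ 2))%:C%C (T 0)).
Proof.
move=> hd hA psi /Sa_inS[s1 s2]; have [m0 [ws [M [M0 HM]]]] := tau_bounds.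
have H u : inS u -> tau 0 (rlap u) = (- (a ^+ 2))%:C%C * tau 0 u.
  move=> su; have := tau_gen a0 hd t0 tauB tauZ tau_heat M0 HM hA su.
  have -> : gen a u = fun x => rlap u x - - a ^+ 2 * u x.
    by apply/funext => x; rewrite /gen mulNr opprK.
  rewrite tauB; [|exact: inS_rlap|exact: inSZ].
  by rewrite tauZ// => /eqP; rewrite subr_eq0 => /eqP.
rewrite /distr_laplacian /distr_scale laplacian_pk distr_pk; try exact: inS_rlap.
rewrite [in RHS](pk_re_im psi).
rewrite (distr_pk 0 s1 s2).
refine (etrans (congr2 (fun p q => p + 'i%C * q) (H _ s1) (H _ s2)) _).
rewrite [RHS]mulrDr [X in _ = _ + X]mulrCA.
exact: erefl.
Qed.

Lemma zero_vanish : A = 0 -> forall k, Sa_eq a (T k) (@distr_zero R d).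
Proof.
move=> hA k psi /Sa_inS[s1 s2]; have [m0 [ws [M [M0 HM]]]] := tau_bounds.
have H := tau_vanish a0 t0 tauB tauZ tau_heat M0 HM hA k.
by rewrite (pk_re_im psi) distr_pk// !H// mulr0 addr0.
Qed.

End sequences.
End complex_test_functions.

(** * Exponential waves and the subcritical case *)

Section polynomial_decay.
Variables (R : realType) (d : nat).
Local Notation V := 'rV[R]_d.
Implicit Types x : V.

Lemma prod_le_enorm x : \prod_(j < d) (1 + x 0 j ^+ 2) <= (1 + enorm x) ^+ (2 * d).
Proof.
have -> : (1 + enorm x) ^+ (2 * d) = \prod_(j < d) ((1 + enorm x) ^+ 2).
  by rewrite prodr_const card_ord exprM.
apply: ler_prod => j _; apply/andP; split; first by rewrite addr_ge0// sqr_ge0.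
have e0 := enorm_ge0 x; have h1 : `|x 0 j| <= enorm x by exact: ler_coord_enorm.
have h2 : x 0 j ^+ 2 <= enorm x ^+ 2.
  by rewrite -[x 0 j ^+ 2]real_normK ?num_real//; apply: lerXn2r.
rewrite sqrrD expr1n mul1r; have : 0 <= enorm x *+ 2 by rewrite mulrn_wge0.
lra.
Qed.

Lemma integral_oneDsqrV :
  (\int[@lebesgue_measure R]_x ((oneDsqr x)^-1)%:E = pi%:E)%E.
Proof.
rewrite ge0_symfun_integralT.
- rewrite (_ : [set x | _] = `[0, +oo[%classic).
    by rewrite integral0y_oneDsqr -EFinM mulrC divfK.
  by apply/seteqP; split => x/=; rewrite in_itv/= andbT.
- by move=> x; rewrite invr_ge0 (le_trans _ (oneDsqr_ge1 x)).
- exact: continuous_oneDsqrV.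
- by move=> x; rewrite /= /oneDsqr sqrrN.
Qed.

(** Compared with the product of the functions [1 / (1 + x_j^2)]; each coordinate uses two powers of
    [1 + |x|], hence the exponent [2 d]. *)
Lemma integrable_polynomial_decay : integrableV (fun x => (1 + enorm x) ^- (2 * d)).
Proof.
have e1 x : 0 < 1 + enorm x by rewrite ltr_pwDl.
have cP (j : 'I_d) : continuous (fun x => oneDsqr (x 0 j)).
  apply: contD; first exact: contC.
  by apply: contX; exact: continuous_coord.
have p0 x : 0 < \prod_(j < d) oneDsqr (x 0 j).
  by apply: prodr_gt0 => j _; exact: lt_le_trans (oneDsqr_ge1 _).
have mV : measurable_fun setT (fun x : R => (oneDsqr x)^-1).
  by apply: continuous_measurable_fun; exact: continuous_oneDsqrV.
have V0 (x : R) : 0 <= (oneDsqr x)^-1 by rewrite invr_ge0 (le_trans _ (oneDsqr_ge1 x)).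
have iP : integrableV (fun x => \prod_(j < d) (oneDsqr (x 0 j))^-1).
  have E (y : d.-tuple (measurableTypeR R)) :
      \prod_(j < d) (oneDsqr (row_of y 0 j))^-1 = \prod_(j < d) (oneDsqr (tnth y j))^-1.
    by apply: eq_bigr => j _; rewrite mxE.
  apply/integrableP; split.
    apply/measurable_EFinP; rewrite /comp; under eq_fun do rewrite E.
    apply: measurable_prod => j _.
    by apply: (measurableT_comp mV); exact: measurable_tnth.
  under eq_integral => y _.
    rewrite /= E ger0_norm; last by apply: prodr_ge0.
    over.
  rewrite (integral_lebesgue_tuple_prod _ mV V0).
  rewrite (eq_bigr (fun=> pi%:E)) => [|j _]; last exact: integral_oneDsqrV.
  by rewrite prodEFin ltry.
apply: integrableV_dom iP _.
- apply: continuous_measurableV => x.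
  have cX : continuous (fun x : V => (1 + enorm x) ^+ (2 * d)).
    by apply: contX; apply: contD; [exact: contC|exact: continuous_enorm].
  by apply: (continuousV _ (cX x)); rewrite expf_neq0// gt_eqF.
- move=> x; rewrite ger0_norm; last by rewrite invr_ge0 exprn_ge0// ltW.
  rewrite prodfV lef_pV2 ?posrE ?exprn_gt0//; exact: prod_le_enorm.
Qed.

End polynomial_decay.

(** * Exponential waves and their heat evolution *)

Section wave.
Variables (R : realType) (d : nat) (j0 : 'I_d) (b c : R).
Local Notation V := 'rV[R]_d.
Local Notation h := (@heat_kernel R d).
Implicit Types (u v K : V -> R) (x y z : V) (p q r s : R).

(** The waves lie outside S^a; the convolution estimates still apply, because they only ask for some
    moderate weight. *)
Definition waveW x : R := expR (b * x 0 j0).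

(* Real and imaginary parts of combinations of [exp ((b + i c) x_j0)]. *)
Definition wave p q x : R :=
  expR (b * x 0 j0) * (p * cos (c * x 0 j0) + q * sin (c * x 0 j0)).

Lemma moderate_waveW : moderate `|b| waveW.
Proof.
split=> // [x|x y]; first exact: expR_gt0.
rewrite /waveW -expRD ler_expR mxE mulrDr lerD2l.
apply: (le_trans (ler_norm _)); rewrite normrM; apply: ler_wpM2l => //.
exact: ler_coord_enorm.
Qed.

Lemma continuous_wave p q : continuous (wave p q).
Proof.
have cl (k : R) : continuous (fun x => k * x 0 j0).
  by apply: contM; [exact: contC|exact: continuous_coord].
apply: contM.
  by apply: cont_comp; [exact: continuous_expR|exact: cl].
apply: contD; apply: contM; try exact: contC.
  by apply: cont_comp; [exact: continuous_cos|exact: cl].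
by apply: cont_comp; [exact: continuous_sin|exact: cl].
Qed.

(** The pair [(p, q)] encodes the amplitude [p - i q]: [wave p q] is the real part of
    [(p - i q) exp ((b + i c) x_j0)]. Differentiation along [j0] multiplies the amplitude by
    [b + i c]. *)
Lemma is_derive_wave p q j x :
  is_derive x (delta_mx 0 j) (wave p q)
    ((j == j0)%:R * wave (b * p + c * q) (b * q - c * p) x).
Proof.
apply: isD_along; pose e : R := (j == j0)%:R.
have -> : (fun r : R => wave p q (x + r *: 'e_j)) = fun r : R =>
    expR (b * (x 0 j0 + r * e)) * (p * cos (c * (x 0 j0 + r * e)) + q * sin (c * (x 0 j0 + r * e))).
  by apply/funext => r; rewrite /wave !mxE eqxx/= [j0 == j]eq_sym.
have dl (k : R) : is_derive (0 : R) (1 : R) (fun r : R => k * (x 0 j0 + r * e)) (k * e).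
  apply: is_derive_eq (isD_Z k (isD_D (isD_cst (x 0 j0) _ _)
    (isD_M (is_derive_id (0 : R) (1 : R)) (isD_cst e _ _)))) _.
  by rewrite mulr0 addr0 add0r mul1r.
have dc := @is_derive1_comp _ (@cos R) (fun r : R => c * (x 0 j0 + r * e)) 0 _ _
  (is_derive_cos (c * (x 0 j0 + 0 * e))) (dl c).
have ds := @is_derive1_comp _ (@sin R) (fun r : R => c * (x 0 j0 + r * e)) 0 _ _
  (is_derive_sin (c * (x 0 j0 + 0 * e))) (dl c).
apply: is_derive_eq (isD_M (is_derive_expR_comp (dl b)) (isD_D (isD_Z p dc) (isD_Z q ds))) _.
by rewrite /wave /= !mul0r !addr0 -/e; ring.
Qed.

Lemma rderiv_wave (l : seq 'I_d) p q : exists p' q', rderiv l (wave p q) = wave p' q'.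
Proof.
elim: l => [|j l [p' [q' IH]]]; first by exists p, q.
exists ((j == j0)%:R * (b * p' + c * q')), ((j == j0)%:R * (b * q' - c * p')).
rewrite rderiv_cons IH; apply/funext => x.
rewrite /rderiv/= (isD_val (is_derive_wave p' q' j x)) /wave; ring.
Qed.

Lemma smoothW_wave p q : smoothW waveW (wave p q).
Proof.
split=> l; have [p' [q' ->]] := rderiv_wave l p q.
  split; first exact: continuous_wave.
  by move=> x j; have [] := is_derive_wave p' q' j x.
exists (`|p'| + `|q'|) => x; rewrite /wave normrM ger0_norm ?expR_ge0// mulrC.
apply: ler_wpM2r; first exact: expR_ge0.
apply: (le_trans (ler_normD _ _)); rewrite !normrM; apply: lerD.
  by rewrite ler_piMr// cos_max.
by rewrite ler_piMr// sin_max.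
Qed.

Lemma rlap_wave p q : rlap (wave p q) =
  wave (- ((b ^+ 2 - c ^+ 2) * p + 2 * b * c * q)) (- ((b ^+ 2 - c ^+ 2) * q - 2 * b * c * p)).
Proof.
apply/funext => x; rewrite /rlap (bigD1 j0)//= big1 => [|j jj].
  have E1 : (fun y => 'D_(delta_mx 0 j0) (wave p q) y) = wave (b * p + c * q) (b * q - c * p).
    by apply/funext => y; rewrite (isD_val (is_derive_wave p q j0 y)) eqxx mul1r.
  by rewrite E1 (isD_val (is_derive_wave _ _ j0 x)) eqxx mul1r /wave; ring.
have E1 : (fun y => 'D_(delta_mx 0 j) (wave p q) y) = wave 0 0.
  by apply/funext => y; rewrite (isD_val (is_derive_wave p q j y)) (negbTE jj) mul0r /wave; ring.
by rewrite E1 (isD_val (is_derive_wave _ _ j x)) (negbTE jj) mul0r.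
Qed.

Lemma rconv_wave p q K : rapid K ->
  rconv (wave p q) K = fun x => p * rconv (wave 1 0) K x + q * rconv (wave 0 1) K x.
Proof.
move=> rK; have mW := moderate_waveW.
have cw := continuous_wave; have bw p' q' := smoothW_bigW (smoothW_wave p' q').
have -> : wave p q = fun x => p * wave 1 0 x + q * wave 0 1 x.
  by apply/funext => x; rewrite /wave; ring.
have c1 : continuous (fun x => p * wave 1 0 x) by apply: contM; [exact: contC|exact: cw].
have c2 : continuous (fun x => q * wave 0 1 x) by apply: contM; [exact: contC|exact: cw].
have b1 := smoothW_bigW (smoothWZ p (smoothW_wave 1 0)).
have b2 := smoothW_bigW (smoothWZ q (smoothW_wave 0 1)).
rewrite (convD mW c1 b1 c2 b2 rK).
by rewrite (convZ mW p (cw 1 0) (bw 1 0) rK) (convZ mW q (cw 0 1) (bw 0 1) rK).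
Qed.

Lemma is_derive_rconv_wave p q x r : 0 < r ->
  is_derive r (1 : R) (fun r => rconv (wave p q) (h r) x)
    (rconv (wave ((b ^+ 2 - c ^+ 2) * p + 2 * b * c * q) ((b ^+ 2 - c ^+ 2) * q - 2 * b * c * p)) (h r) x).
Proof.
move=> r0; have mW := moderate_waveW.
have bw := smoothW_bigW (smoothW_wave p q).
have D := is_derive_conv_heat mW x (continuous_wave (p:=p) (q:=q)) bw r0.
apply: is_derive_eq D _.
rewrite (conv_heat_kernel_t mW (smoothW_wave p q) r0) rlap_wave.
by rewrite rconv_wave 1?[in RHS]rconv_wave; [ring|exact: rapid_heat_kernel..].
Qed.

(** Real and imaginary parts of [(b + i c)^2]. *)
Let om := b ^+ 2 - c ^+ 2.
Let ph := 2 * b * c.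

Let U r := rconv (wave 1 0) (h r) 0.
Let S r := rconv (wave 0 1) (h r) 0.

(** Together with [dS]: [U + i S] solves the linear equation with coefficient [om + i ph]. Solving
    it from its limit at [0^+] avoids a Gaussian integral with complex exponent. *)
Let dU r : 0 < r -> is_derive r (1 : R) U (om * U r - ph * S r).
Proof.
move=> r0; apply: is_derive_eq (is_derive_rconv_wave 1 0 0 r0) _.
by rewrite rconv_wave; [rewrite /U /S /om /ph; ring|exact: rapid_heat_kernel].
Qed.

Let dS r : 0 < r -> is_derive r (1 : R) S (ph * U r + om * S r).
Proof.
move=> r0; apply: is_derive_eq (is_derive_rconv_wave 0 1 0 r0) _.
by rewrite rconv_wave; [rewrite /U /S /om /ph; ring|exact: rapid_heat_kernel].
Qed.

(* Undoing the evolution of the waves by the inverse rotation and dilation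
   gives a constant function of time. *)
Let G k l r := expR (- (om * r)) * ((k * cos (ph * r) - l * sin (ph * r)) * U r
   + (l * cos (ph * r) + k * sin (ph * r)) * S r).

Let dG k l r : 0 < r -> is_derive r (1 : R) (G k l) 0.
Proof.
move=> r0.
have dl (q : R) : is_derive r (1 : R) (fun r : R => q * r) q.
  by apply: is_derive_eq (isD_Z q (is_derive_id r (1 : R))) _; rewrite mulr1.
have dc := @is_derive1_comp _ (@cos R) (fun r : R => ph * r) r _ _ (is_derive_cos (ph * r)) (dl ph).
have ds := @is_derive1_comp _ (@sin R) (fun r : R => ph * r) r _ _ (is_derive_sin (ph * r)) (dl ph).
have de := is_derive_expR_comp (isD_N (dl om)).
refine (is_derive_eq (isD_M de (isD_D
  (isD_M (isD_D (isD_Z k dc) (isD_N (isD_Z l ds))) (dU r0))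
  (isD_M (isD_D (isD_Z l dc) (isD_Z k ds)) (dS r0)))) _).
rewrite /=; ring.
Qed.

Let Gconst k l r s : 0 < r -> r <= s -> G k l s = G k l r.
Proof.
move=> r0 rs; apply/eqP; rewrite -subr_eq0 -normr_le0.
have dF (y : R) : 0 <= y <= s - r -> is_derive y (1 : R) (fun y : R => G k l (r + y)) 0.
  move=> /andP[y0 _]; have ry : 0 < r + y by rewrite ltr_pwDl.
  have dr : is_derive y (1 : R) (fun e => r + e) 1.
    by apply: is_derive_eq (isD_D (isD_cst r y (1 : R)) (is_derive_id y (1 : R))) _; rewrite add0r.
  have D := @is_derive1_comp _ (G k l) (fun e => r + e) y _ _ (dG k l ry) dr.
  by apply: is_derive_eq D _; rewrite mul0r.
have sr : 0 <= s - r by rewrite subr_ge0.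
have dB (y : R) : 0 <= y <= s - r -> `|0 : R| <= 0 by rewrite normr0.
have := lipschitz_derive sr dF dB.
rewrite (_ : r + (s - r) = s); last by ring.
by rewrite addr0 mul0r.
Qed.

Let cvgUS p q : rconv (wave p q) (h r) 0 @[r --> 0^'+] --> p.
Proof.
have [C C0 HC] := conv_heat_approx moderate_waveW (smoothW_wave p q).
have w0 : wave p q 0 = p by rewrite /wave mxE !mulr0 expR0 cos0 sin0; ring.
have cs : C * waveW 0 * Num.sqrt r @[r --> 0^'+] --> 0.
  have : C * waveW 0 * Num.sqrt r @[r --> 0^'+] --> C * waveW 0 * Num.sqrt 0.
    by apply: cvgMr; apply: cvg_at_right_filter; exact: sqrt_continuous.
  by rewrite sqrtr0 mulr0.
apply/cvgrPdist_le => e e0.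
move/cvgrPdist_le : cs => /(_ e e0) cs.
near=> r.
have r01 : 0 < r <= 1 by apply/andP; split; near: r; [exact: nbhs_right_gt|exact: nbhs_right_le].
have := HC 0 r r01; rewrite w0 distrC => H; apply: (le_trans H).
have : `|0 - C * waveW 0 * Num.sqrt r| <= e by near: r.
by rewrite sub0r normrN ger0_norm// !mulr_ge0 ?sqrtr_ge0 ?expR_ge0.
Unshelve. all: by end_near. Qed.

Let Gval k l r : 0 < r -> G k l r = k.
Proof.
move=> r0; have cl q : q * s @[s --> 0^'+] --> 0.
  rewrite -[X in _ --> X](mulr0 q); apply: cvgMr; apply: cvg_at_right_filter; exact: cvg_id.
have cc : cos (ph * s) @[s --> 0^'+] --> cos 0.
  apply: (@continuous_cvg _ _ _ _ _ _ (@cos R)); last exact: cl.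
  exact: continuous_cos.
have csn : sin (ph * s) @[s --> 0^'+] --> sin 0.
  apply: (@continuous_cvg _ _ _ _ _ _ (@sin R)); last exact: cl.
  exact: continuous_sin.
have ce : expR (- (om * s)) @[s --> 0^'+] --> expR (- 0).
  apply: (@continuous_cvg _ _ _ _ _ _ (fun z : R => expR (- z))); last exact: cl.
  by apply: cont_comp; [exact: continuous_expR|exact: opp_continuous].
rewrite cos0 in cc; rewrite sin0 in csn; rewrite oppr0 expR0 in ce.
have cG : G k l s @[s --> 0^'+] --> 1 * ((k * 1 - l * 0) * 1 + (l * 1 + k * 0) * 0).
  apply: cvgM ce _; apply: cvgD; apply: cvgM; try exact: cvgUS.
    by apply: cvgB; apply: cvgMr.
  by apply: cvgD; apply: cvgMr.
have cGr : G k l s @[s --> 0^'+] --> G k l r.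
  apply: (@cvg_near_cst _ _ _ _ _ _).
  near=> s; apply: esym; apply: Gconst.
    by near: s; exact: nbhs_right_gt.
  by near: s; exact: nbhs_right_le.
have := cvg_lim (@Rhausdorff _) cGr; rewrite (cvg_lim (@Rhausdorff _) cG) => <-; ring.
Unshelve. all: by end_near. Qed.

Lemma rconv_wave_heat r : 0 < r ->
  rconv (wave 1 0) (h r) 0 = expR ((b ^+ 2 - c ^+ 2) * r) * cos (2 * b * c * r) /\
  rconv (wave 0 1) (h r) 0 = expR ((b ^+ 2 - c ^+ 2) * r) * sin (2 * b * c * r).
Proof.
move=> r0; rewrite -/om -/ph -/(U r) -/(S r).
have E : expR (om * r) * expR (- (om * r)) = 1 by rewrite -expRD subrr expR0.
have sc : cos (ph * r) ^+ 2 + sin (ph * r) ^+ 2 = 1 by exact: cos2Dsin2.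
split.
  (* The amplitudes [k] and [l] are chosen at time [r] itself, so that the rotation in [G] leaves
     [U r] alone; the other formula is obtained in the same way with [S r]. *)
  rewrite -[X in _ = _ * X](Gval (cos (ph * r)) (- sin (ph * r)) r0) /G.
  have -> : cos (ph * r) * cos (ph * r) - - sin (ph * r) * sin (ph * r) = 1.
    by rewrite -sc; ring.
  by rewrite mulrA E; ring.
rewrite -[X in _ = _ * X](Gval (sin (ph * r)) (cos (ph * r)) r0) /G.
have -> : cos (ph * r) * cos (ph * r) + sin (ph * r) * sin (ph * r) = 1.
  by rewrite -sc; ring.
by rewrite mulrA E; ring.
Qed.

End wave.

(** * The heat kernel as a test function *)

Section gaussian_test_functions.
Variables (R : realType) (d : nat) (a t : R).
Hypothesis t0 : 0 < t.
Local Notation V := 'rV[R]_d.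
Local Notation h := (@heat_kernel R d).
Implicit Types (u v : V -> R) (x : V).

(** A class that contains the heat kernel, is stable under differentiation and lends itself to
    induction; no formula for the iterated derivatives of a Gaussian is needed. *)
Inductive gauss_poly : (V -> R) -> Prop :=
| gauss_poly_kernel : gauss_poly (h t)
| gauss_poly_coord j u : gauss_poly u -> gauss_poly (fun x => x 0 j * u x)
| gauss_polyZ k u : gauss_poly u -> gauss_poly (fun x => k * u x)
| gauss_polyD u v : gauss_poly u -> gauss_poly v -> gauss_poly (fun x => u x + v x).

Lemma gauss_poly_continuous u : gauss_poly u -> continuous u.
Proof.
elim=> [|j {}u _ IH|k {}u _ IH|{}u v _ IHu _ IHv].
- exact: continuous_heat_kernel.
- by apply: contM => //; exact: continuous_coord.
- by apply: contM => //; exact: contC.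
- exact: contD.
Qed.

Lemma is_derive_coord_delta (i j : 'I_d) x :
  is_derive x (delta_mx 0 j) (fun y : V => y 0 i) (i == j)%:R.
Proof.
apply: isD_along; set e : R := (i == j)%:R.
have -> : (fun r : R => (x + r *: delta_mx 0 j) 0 i) = fun r => x 0 i + r * e.
  by apply/funext => r; rewrite !mxE eqxx.
apply: is_derive_eq (isD_D (isD_cst (x 0 i) (0 : R) (1 : R))
  (isD_M (is_derive_id (0 : R) (1 : R)) (isD_cst e _ _))) _.
by rewrite mulr0 addr0 add0r mul1r.
Qed.

Lemma gauss_poly_derive u (j : 'I_d) : gauss_poly u ->
  exists2 w, gauss_poly w & forall x, is_derive x (delta_mx 0 j) u (w x).
Proof.
elim=> [|i {}u gu [w gw dw]|k {}u _ [w gw dw]|{}u v _ [w gw dw] _ [w' gw' dw']].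
- exists (fun x => - (2 * t)^-1 * (x 0 j * h t x)).
    by apply: gauss_polyZ; apply: gauss_poly_coord; exact: gauss_poly_kernel.
  move=> x; apply: is_derive_eq (is_derive_heat_kernel_x j x t0) _.
  by rewrite /heat_kernel_x; field; rewrite gt_eqF.
- exists (fun x => (i == j)%:R * u x + x 0 i * w x).
    by apply: gauss_polyD; [exact: gauss_polyZ|exact: gauss_poly_coord].
  by move=> x; exact: isD_M (is_derive_coord_delta i j x) (dw x).
- exists (fun x => k * w x); first exact: gauss_polyZ.
  by move=> x; exact: isD_Z.
- exists (fun x => w x + w' x); first exact: gauss_polyD.
  by move=> x; exact: isD_D.
Qed.

Lemma gauss_poly_bound u : gauss_poly u ->
  forall b, exists C, forall x, `|u x| * expR (b * enorm x) <= C.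
Proof.
have t20 : 0 < 2 * t by rewrite mulr_gt0.
elim=> [|i {}u _ IH|k {}u _ IH|{}u v _ IHu _ IHv] b.
- exists (heat_mass d b t * hconst d (2 * t)) => x.
  rewrite mulrC ger0_norm//.
  have := heat_kernel_moment b x (isT : (0 <= 2)%N) t0.
  rewrite !expr0 mul1r mulr1 => H; apply: (le_trans H).
  apply: ler_wpM2l; first exact: heat_mass_ge0.
  rewrite heat_kernelE ler_piMr//; first by rewrite ltW// hconst_gt0.
  rewrite -expR0 ler_expR oppr_le0; apply: divr_ge0; first exact: sqr_ge0.
  by rewrite ltW// !mulr_gt0.
(* One unit of exponential rate pays for the coordinate, by [|x_i| <= exp |x|]; this is why the
   bound is proved for all [b] at once. *)
- have [C HC] := IH (1 + b); exists C => x; apply: le_trans (HC x).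
  rewrite normrM mulrDl mul1r expRD [leRHS]mulrA.
  apply: ler_wpM2r; first exact: expR_ge0.
  rewrite [leLHS]mulrC; apply: ler_wpM2l => //; apply: (le_trans (ler_coord_enorm _ _)).
  by apply: le_trans (expR_ge1Dx _); rewrite lerDr.
- have [C HC] := IH b; exists (`|k| * C) => x; rewrite normrM -mulrA.
  by apply: ler_wpM2l.
- have [C HC] := IHu b; have [C' HC'] := IHv b; exists (C + C') => x.
  apply: le_trans (lerD (HC x) (HC' x)); rewrite -mulrDl.
  by apply: ler_wpM2r; [exact: expR_ge0|exact: ler_normD].
Qed.

Lemma rderiv_gauss_poly (l : seq 'I_d) u : gauss_poly u -> gauss_poly (rderiv l u).
Proof.
move=> gu; elim: l => [//|j l IH]; have [w gw dw] := gauss_poly_derive j IH.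
by have -> : rderiv (j :: l) u = w by apply/funext => x; exact: isD_val (dw x).
Qed.

Lemma inS_gauss_poly u : gauss_poly u -> inS a u.
Proof.
move=> gu m; split=> l; have gl := rderiv_gauss_poly l gu.
  split; first exact: gauss_poly_continuous.
  by move=> x j; have [w _ dw] := gauss_poly_derive j gl; have [] := dw x.
have [C HC] := gauss_poly_bound gl (a + m%:R); exists C => x.
apply: (@le_trans _ _ (C * expR (- ((a + m%:R) * enorm x)))).
  by rewrite expRN ler_pdivlMr ?expR_gt0.
have C0 : 0 <= C by apply: le_trans (HC 0); rewrite mulr_ge0 ?expR_ge0.
apply: ler_wpM2l => //.
rewrite mulrDl opprD expRD; apply: ler_wpM2l; first exact: expR_ge0.
rewrite expRN lef_pV2 ?posrE ?expR_gt0 ?exprn_gt0 ?enorm1_gt0// expRM_natl.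
apply: lerXn2r; rewrite ?nnegrE ?expR_ge0 ?addr_ge0//; exact: expR_ge1Dx.
Qed.

Lemma inS_heat_kernel : inS a (h t).
Proof. exact: inS_gauss_poly gauss_poly_kernel. Qed.

End gaussian_test_functions.

(** * Integration of test functions against waves *)

Section wave_integrals.
Variables (R : realType) (d : nat) (a : R) (j0 : 'I_d) (b c : R).
Hypotheses (a0 : 0 < a) (ba : `|b| <= a).
Local Notation V := 'rV[R]_d.
Local Notation h := (@heat_kernel R d).
Local Notation inS := (@inS R d a).
Local Notation expW := (@expW R d a).
Local Notation wv := (@wave R d j0 b c).
Implicit Types (u v : V -> R) (x y : V) (p q t : R).

Definition decay x : R := (1 + enorm x) ^- (2 * d).

Lemma decay_ge0 x : 0 <= decay x.
Proof. by rewrite invr_ge0 exprn_ge0// addr_ge0. Qed.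

(** As [|b| <= a], the exponential weight absorbs the growth of the wave; the [2 d] polynomial
    powers are kept for integrability. *)
Lemma wave_bound p q x (C : R) : 0 <= C ->
  `|wv p q x| * (C * expW (2 * d) x) <= (`|p| + `|q|) * C * decay x.
Proof.
move=> C0; have H : `|wv p q x| <= (`|p| + `|q|) * expR (a * enorm x).
  rewrite /wave normrM ger0_norm ?expR_ge0// mulrC; apply: ler_pM => //.
    apply: (le_trans (ler_normD _ _)); rewrite !normrM; apply: lerD.
      by rewrite ler_piMr// cos_max.
    by rewrite ler_piMr// sin_max.
  rewrite ler_expR; apply: (le_trans (ler_norm _)); rewrite normrM.
  by apply: ler_pM => //; exact: ler_coord_enorm.
have CW : 0 <= C * expW (2 * d) x by rewrite mulr_ge0 ?expW_ge0.
apply: (le_trans (ler_wpM2r CW H)); rewrite le_eqVlt; apply/orP; left; apply/eqP.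
have E : expR (a * enorm x) * expR (- (a * enorm x)) = 1 by rewrite -expRD subrr expR0.
rewrite -[RHS]mulr1 -E /expW /decay; ring.
Qed.

Lemma integrable_wave p q u : inS u -> integrableV (fun x => wv p q x * u x).
Proof.
move=> su; have [C C0 HC] := bigW_ge0 (expW_gt0 a (2 * d)) (inS_bigW (2 * d) su).
apply: (@integrableV_dom _ _ _ (fun x => (`|p| + `|q|) * C * decay x)).
- apply: continuous_measurableV; apply: contM; first exact: continuous_wave.
  exact: inS_continuous su.
- by apply: integrableVZ; exact: integrable_polynomial_decay.
- move=> x; rewrite normrM; apply: le_trans (wave_bound p q x C0).
  by apply: ler_wpM2l.
Qed.

Definition wint p q u : R := rint (fun x => wv p q x * u x).

Lemma wintD p q u v : inS u -> inS v -> wint p q (fun x => u x + v x) = wint p q u + wint p q v.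
Proof.
move=> su sv; rewrite /wint -rintD; try exact: integrable_wave.
by congr rint; apply/funext => x; rewrite mulrDr.
Qed.

Lemma wintZ p q (k : R) u : inS u -> wint p q (fun x => k * u x) = k * wint p q u.
Proof.
move=> su; rewrite /wint -rintZ; last exact: integrable_wave.
by congr rint; apply/funext => x; rewrite mulrCA.
Qed.

Lemma wint_bound p q u (C : R) : inS u -> 0 <= C -> (forall x, `|u x| <= C * expW (2 * d) x) ->
  `|wint p q u| <= (`|p| + `|q|) * rint decay * C.
Proof.
move=> su C0 HC; rewrite mulrAC -rintZ; last exact: integrable_polynomial_decay.
apply: ler_norm_rint.
- exact: integrableV_measurable (integrable_wave p q su).
- by apply: integrableVZ; exact: integrable_polynomial_decay.
- move=> x; rewrite normrM; apply: le_trans (wave_bound p q x C0).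
  by apply: ler_wpM2l.
Qed.

Lemma wave_add p q x y :
  wv p q (x + y) = wv 1 0 y * wv p q x + wv 0 1 y * wv q (- p) x.
Proof. by rewrite /wave mxE !mulrDr expRD cosD sinD; ring. Qed.

Lemma wint_heat_kernel t : 0 < t ->
  wint 1 0 (h t) = expR ((b ^+ 2 - c ^+ 2) * t) * cos (2 * b * c * t) /\
  wint 0 1 (h t) = expR ((b ^+ 2 - c ^+ 2) * t) * sin (2 * b * c * t).
Proof.
(* A convolution at the origin evaluates the wave at [0 - y]; reversing the signs of [b] and [c]
   undoes this reflection and leaves [b^2 - c^2] and [b c] unchanged. *)
move=> t0; have [E1 E2] := rconv_wave_heat j0 (- b) (- c) t0.
have -> : b ^+ 2 - c ^+ 2 = (- b) ^+ 2 - (- c) ^+ 2 by ring.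
have -> : 2 * b * c = 2 * (- b) * (- c) by ring.
have E p q y : wv p q y = wave j0 (- b) (- c) p q (0 - y).
  by rewrite /wave !mxE sub0r !mulrNN.
rewrite -E1 -E2 /wint; split; congr rint; apply/funext => y; by rewrite E.
Qed.

(** Real form of the fact that exponentials are eigenfunctions of convolutions: Fubini, a
    translation of [x] by [y], then the addition formula [wave_add]. The amplitude encoded by
    [(q, - p)] is [i] times that of [(p, q)]. *)
Lemma wint_heat p q t u : 0 < t -> inS u ->
  wint p q (rconv u (h t)) = wint 1 0 (h t) * wint p q u + wint 0 1 (h t) * wint q (- p) u.
Proof.
move=> t0 su; have cu := inS_continuous su.
have rh := rapid_heat_kernel d t0; have sh := @inS_heat_kernel R d a t t0.
have mW := moderate_expW d a0 (2 * d).
have [C C0 HC] := bigW_ge0 (expW_gt0 a (2 * d)) (inS_bigW (2 * d) su).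
have bu : bigW (expW (2 * d)) u by exact: inS_bigW.
pose F x y := wv p q x * (u (x - y) * h t y).
have iF : integrableV (fun x => (`|p| + `|q|) * C * decay x).
  by apply: integrableVZ; exact: integrable_polynomial_decay.
transitivity (rint (fun x => rint (F x))).
  congr rint; apply/funext => x.
  rewrite /rconv -(@rintZ _ _ (wv p q x) (fun y => u (x - y) * h t y)) //.
  have I := integrable_conv mW x cu bu rh.
  exact: I.
rewrite (@rint_swap _ _ F _ _ _ iF (rapid_integrable (a + (2 * d)%:R) rh)).
- transitivity (rint (fun y => wint p q u * (wv 1 0 y * h t y)
      + wint q (- p) u * (wv 0 1 y * h t y))).
    congr rint; apply/funext => y.
    have mF : measurableV (fun x => wv p q (x + y) * u x).
      apply: continuous_measurableV; apply: contM => //.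
      by apply: cont_compV; [exact: continuous_wave|exact: continuous_addr].
    transitivity (h t y * rint (fun x => wv p q (x - y + y) * u (x - y))).
      rewrite -rintZ; first by congr rint; apply/funext => x; rewrite /F subrK; ring.
      have := integrableV_shift (- y) (F := fun x => wv p q (x + y) * u x).
      apply; have -> : (fun x => wv p q (x + y) * u x) =
          fun x => wv 1 0 y * (wv p q x * u x) + wv 0 1 y * (wv q (- p) x * u x).
        by apply/funext => x; rewrite wave_add; ring.
      by apply: integrableVD; apply: integrableVZ; exact: integrable_wave.
    rewrite (@rint_shift _ _ (fun x => wv p q (x + y) * u x) (- y) mF).
    have -> : (fun x => wv p q (x + y) * u x) =
        fun x => wv 1 0 y * (wv p q x * u x) + wv 0 1 y * (wv q (- p) x * u x).
      by apply/funext => x; rewrite wave_add; ring.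
    rewrite rintD; try (by apply: integrableVZ; exact: integrable_wave).
    by rewrite !rintZ; try exact: integrable_wave; rewrite /wint; ring.
  rewrite rintD; try (by apply: integrableVZ; exact: integrable_wave).
  by rewrite !rintZ; try exact: integrable_wave; rewrite /wint; ring.
- apply: measurable_funM.
    have := @continuous_measurableV2 R d (wv p q) 1 0 0 (continuous_wave (p:=p) (q:=q)).
    by congr measurable_fun; apply/funext => z; rewrite addr0 scale1r scale0r addr0.
  apply: measurable_funM.
    have := @continuous_measurableV2 R d u 1 (-1) 0 cu.
    by congr measurable_fun; apply/funext => z; rewrite addr0 scale1r scaleN1r.
  have := @continuous_measurableV2 R d (h t) 0 1 0 (@continuous_heat_kernel R d t).
  by congr measurable_fun; apply/funext => z; rewrite addr0 scale1r scale0r add0r.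
- move=> x y; rewrite /F normrM [`|_ * h t y|]normrM [leLHS]mulrA [leRHS]mulrA; apply: ler_wpM2r => //.
  have H := bigW_sub mW x y C0 HC.
  apply: (le_trans (ler_wpM2l (normr_ge0 _) H)); rewrite mulrA.
  by apply: ler_wpM2r; [exact: expR_ge0|exact: wave_bound].
Qed.

End wave_integrals.

(** * Complex eigendistributions of the heat operator *)

Section wave_functional.
Variables (R : realType) (d : nat) (a : R) (j0 : 'I_d) (b c : R).
Hypotheses (a0 : 0 < a) (ba : `|b| <= a).
Local Notation V := 'rV[R]_d.
Local Notation C := R[i].
Local Notation h := (@heat_kernel R d).
Local Notation inS := (@inS R d a).
Local Notation expW := (@expW R d a).
Local Notation Sa := (@Sa R d a).
Local Notation wi := (@wint R d j0 b c).
Implicit Types (u v : V -> R) (f g : V -> C) (x y : V) (p q t : R).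

Definition zint u : C := (wi 1 0 u +i* wi 0 1 u)%C.

(* The integral of [f] against [exp ((b + i c) x_j0)]. *)
Definition wave_functional f : C := zint (re f) + 'i%C * zint (im f).

(** The eigenvalue is the pairing of the exponential with the kernel itself, namely
    [exp (t (b + i c)^2)]. *)
Definition wave_eigenvalue t : C := zint (h t).

Lemma wint_N u : inS u -> wi 0 (-1) u = - wi 0 1 u.
Proof.
move=> su; rewrite -[RHS]mulN1r /wint -rintZ; last exact: (integrable_wave j0 c ba 0 1 su).
by congr rint; apply/funext => x; rewrite /wave; ring.
Qed.

Lemma zint_heat t u : 0 < t -> inS u -> zint (rconv u (h t)) = wave_eigenvalue t * zint u.
Proof.
move=> t0 su; rewrite /zint (wint_heat j0 c a0 ba 1 0 t0 su) (wint_heat j0 c a0 ba 0 1 t0 su).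
rewrite oppr0 wint_N// /wave_eigenvalue /zint [RHS]/GRing.mul /=.
by congr (complex.Complex _ _); ring.
Qed.

Lemma zintD u v : inS u -> inS v -> zint (fun x => u x + v x) = zint u + zint v.
Proof. by move=> su sv; rewrite /zint !(wintD j0 c ba). Qed.

Lemma zintZ (k : R) u : inS u -> zint (fun x => k * u x) = k%:C%C * zint u.
Proof.
move=> su; rewrite /zint !(wintZ j0 c ba)// [RHS]/GRing.mul /=.
by congr (complex.Complex _ _); ring.
Qed.

Lemma zint_bound u (k : R) : inS u -> 0 <= k -> (forall x, `|u x| <= k * expW (2 * d) x) ->
  normc (zint u) <= 2 * rint (@decay R d) * k.
Proof.
move=> su k0 H; apply: (le_trans (normc_le_ReIm _)).
apply: (le_trans (lerD (wint_bound j0 c ba 1 0 su k0 H) (wint_bound j0 c ba 0 1 su k0 H))).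
by rewrite !normr0 !normr1 addr0 add0r le_eqVlt; apply/orP; left; apply/eqP; ring.
Qed.

Lemma wave_eigenvalueE t : 0 < t -> wave_eigenvalue t =
  (expR ((b ^+ 2 - c ^+ 2) * t))%:C%C * (cos (2 * b * c * t) +i* sin (2 * b * c * t))%C.
Proof.
move=> t0; rewrite /wave_eigenvalue /zint.
have [-> ->] := wint_heat_kernel j0 b c t0; rewrite [RHS]/GRing.mul /=.
by congr (complex.Complex _ _); ring.
Qed.

Lemma normc_wave_eigenvalue t : 0 < t ->
  normc (wave_eigenvalue t) = expR ((b ^+ 2 - c ^+ 2) * t).
Proof.
move=> t0; rewrite wave_eigenvalueE// normcM normc_real ger0_norm ?expR_ge0//.
by rewrite /normc cos2Dsin2 sqrtr1 mulr1.
Qed.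

Lemma wave_functional_heat t f : 0 < t -> Sa f ->
  wave_functional (heat t f) = wave_eigenvalue t * wave_functional f.
Proof.
move=> t0 /Sa_inS[s1 s2]; rewrite heat_pk /wave_functional.
rewrite -[re (pk _ _)]/(rconv (re f) (h t)) -[im (pk _ _)]/(rconv (im f) (h t)).
by rewrite !zint_heat// mulrDr mulrCA.
Qed.

Lemma wave_functionalD f g : Sa f -> Sa g ->
  wave_functional (fun x => f x + g x) = wave_functional f + wave_functional g.
Proof.
move=> /Sa_inS[s1 s2] /Sa_inS[s3 s4]; rewrite /wave_functional.
have -> : re (fun x => f x + g x) = fun x => re f x + re g x.
  by apply/funext => x; rewrite /re; case: (f x) (g x) => ? ? [].
have -> : im (fun x => f x + g x) = fun x => im f x + im g x.
  by apply/funext => x; rewrite /im; case: (f x) (g x) => ? ? [].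
by rewrite !zintD// mulrDr addrACA.
Qed.

Lemma wave_functionalZ (k : C) f : Sa f ->
  wave_functional (fun x => k * f x) = k * wave_functional f.
Proof.
move=> /Sa_inS[s1 s2]; rewrite /wave_functional; case: k => k l.
have -> : re (fun x => (k +i* l)%C * f x) = fun x => k * re f x + (- l) * im f x.
  by apply/funext => x; rewrite /re /im; case: (f x) => p q /=; rewrite mulNr.
have -> : im (fun x => (k +i* l)%C * f x) = fun x => k * im f x + l * re f x.
  by apply/funext => x; rewrite /re /im; case: (f x).
rewrite !zintD; try exact: inSZ.
rewrite !zintZ//.
case: (zint (re f)) => p q; case: (zint (im f)) => p' q'.
rewrite /GRing.mul /GRing.add /=; congr (complex.Complex _ _); ring.
Qed.

Lemma wave_functional_bound f (k : R) : Sa f -> 0 <= k ->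
  (forall x, normc (f x) <= k * expW (2 * d) x) ->
  normc (wave_functional f) <= 4 * rint (@decay R d) * k.
Proof.
move=> /Sa_inS[s1 s2] k0 H.
have H1 x : `|re f x| <= k * expW (2 * d) x by exact: le_trans (ler_Re_normc _) (H x).
have H2 x : `|im f x| <= k * expW (2 * d) x by exact: le_trans (ler_Im_normc _) (H x).
apply: (le_trans (le_normcD _ _)); rewrite normcM.
have -> : normc 'i%C = 1 :> R by rewrite /normc /= expr0n add0r expr1n sqrtr1.
rewrite mul1r; apply: (le_trans (lerD (zint_bound s1 k0 H1) (zint_bound s2 k0 H2))).
by rewrite le_eqVlt; apply/orP; left; apply/eqP; ring.
Qed.

(** Tested on the Gaussian [h 1], where the functional takes the nonzero value
    [exp ((b + i c)^2)]. *)
Lemma wave_functional_neq0 : exists2 f, Sa f & normc (wave_functional f) = expR (b ^+ 2 - c ^+ 2).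
Proof.
exists (pk (h 1) (fun=> 0)); first by apply: Sa_pk0 => //; exact: inS_heat_kernel.
rewrite /wave_functional -[re _]/(h 1) -[im _]/(fun=> 0 : R).
have -> : zint (fun=> 0) = 0.
  have s0 := @inS0 R d a; have := zintZ 0 s0.
  have -> : (fun _ : V => 0 * 0) = (fun=> 0 : R) by apply/funext => x; rewrite mul0r.
  by rewrite mul0r.
by rewrite mulr0 addr0 normc_wave_eigenvalue// mulr1.
Qed.

End wave_functional.

(** * Functionals bounded by a weighted sup norm *)

Section bounded_functionals.
Variables (R : realType) (d : nat) (a : R).
Hypothesis a0 : 0 < a.
Local Notation V := 'rV[R]_d.
Local Notation C := R[i].
Local Notation expW := (@expW R d a).
Local Notation Sa := (@Sa R d a).
Implicit Types (f g : V -> C) (E : distr R d) (m : nat).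

(** A bound by one weighted sup norm, without derivatives, already gives continuity on S^a; the wave
    functionals satisfy it with [m = 2 d]. *)
Definition bounded_functional m E : Prop :=
  [/\ forall f g, Sa f -> Sa g -> E (fun x => f x + g x) = E f + E g,
      forall k f, Sa f -> E (fun x => k * f x) = k * E f
    & exists2 K, 0 <= K & forall f (k : R), Sa f -> 0 <= k ->
        (forall x, normc (f x) <= k * expW m x) -> normc (E f) <= K * k].

Lemma bounded_functional_comb m E1 E2 (k1 k2 : C) :
  bounded_functional m E1 -> bounded_functional m E2 ->
  bounded_functional m (fun f => k1 * E1 f + k2 * E2 f).
Proof.
move=> [D1 Z1 [K1 K10 B1]] [D2 Z2 [K2 K20 B2]]; split.
- by move=> f g sf sg; rewrite D1// D2//; ring.
- by move=> k f sf; rewrite Z1// Z2//; ring.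
- exists (normc k1 * K1 + normc k2 * K2).
    by rewrite addr_ge0// mulr_ge0// normc_ge0.
  move=> f k sf k0 H; apply: (le_trans (le_normcD _ _)); rewrite !normcM mulrDl -!mulrA.
  by apply: lerD; apply: ler_wpM2l; [exact: normc_ge0|exact: B1|exact: normc_ge0|exact: B2].
Qed.

Lemma SaB f g : Sa f -> Sa g -> Sa (fun x => f x - g x).
Proof.
move=> /Sa_inS[s1 s2] /Sa_inS[s3 s4]; apply/Sa_inS; split.
  have -> : re (fun x => f x - g x) = fun x => re f x - re g x.
    by apply/funext => x; rewrite /re; case: (f x) (g x) => ? ? [].
  exact: inSB.
have -> : im (fun x => f x - g x) = fun x => im f x - im g x.
  by apply/funext => x; rewrite /im; case: (f x) (g x) => ? ? [].
exact: inSB.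
Qed.

Lemma bounded_functional_near m E f (e : R) : bounded_functional m E -> Sa f -> 0 < e ->
  exists2 k : R, 0 < k & forall g, Sa g ->
    (Sa_gamma a (m, [ffun=> 0%N] : multi_index d) (fun x => (g x - f x)%R) < k%:E)%E -> normc (E g - E f) < e.
Proof.
move=> [ED EZ [K K0 EB]] sf e0; exists (e / (K + 1)); first by rewrite divr_gt0// ltr_wpDl.
move=> g sg /ltW/Sa_gamma_le H.
have sgf := SaB sg sf; have k0 : 0 <= e / (K + 1) by rewrite divr_ge0 ?addr_ge0// ltW.
have -> : E g - E f = E (fun x => g x - f x).
  have -> : E g = E (fun x => (g x - f x) + f x).
    by congr (E _); apply/funext => x; rewrite subrK.
  by rewrite ED// addrK.
have M0 x : mderiv ([ffun=> 0%N] : multi_index d) (fun x => g x - f x) x = g x - f x.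
  rewrite /mderiv.
  have -> : flatten [seq nseq (([ffun=> 0%N] : multi_index d) j) j | j <- enum 'I_d] = [::].
    by elim: (enum _) => [//|j l IH]; rewrite /= ffunE.
  by rewrite /cderiv /=; case: (g x - f x).
apply: (@le_lt_trans _ _ (K * (e / (K + 1)))).
  by apply: EB => // x; rewrite -M0; exact: H.
by rewrite mulrA ltr_pdivrMr ?ltr_wpDl// mulrC ltr_pM2l// ltrDl.
Qed.

Lemma bounded_functional_dual m E : bounded_functional m E -> Sa_dual a E.
Proof.
move=> bE; have [ED EZ _] := bE; split=> // f sf A /nbhs_ballP[e /= e0 eA].
have [k k0 Hk] := bounded_functional_near bE sf e0.
exists [:: (m, [ffun=> 0%N] : multi_index d)], k; split=> // g sg Hg; apply: eA.
rewrite /ball /= sub0r normrN ger0_norm ?normc_ge0//.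
by apply: Hk => //; apply: Hg; rewrite mem_head.
Qed.

(** Supplies the seminorm of condition (2): the [T_k] to be built are combinations of two fixed
    functionals with coefficients of modulus 1, so it bounds them all. *)
Lemma bounded_functional_seminorm m E1 E2 :
  bounded_functional m E1 -> bounded_functional m E2 ->
  Sa_seminorm a (fun f => normc (E1 f) + normc (E2 f)).
Proof.
move=> b1 b2; have [D1 Z1 _] := b1; have [D2 Z2 _] := b2; split.
- move=> f g sf sg; rewrite D1// D2// addrACA.
  by apply: lerD; exact: le_normcD.
- by move=> k f sf; rewrite Z1// Z2// !normcM mulrDr.
- move=> f sf A /nbhs_ballP[e /= e0 eA].
  have e20 : 0 < e / 2 by rewrite divr_gt0.
  have [k1 k10 H1] := bounded_functional_near b1 sf e20.
  have [k2 k20 H2] := bounded_functional_near b2 sf e20.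
  exists [:: (m, [ffun=> 0%N] : multi_index d)], (Num.min k1 k2); split; first by rewrite lt_min k10.
  move=> g sg Hg; apply: eA; rewrite /ball /=.
  have {}Hg := Hg _ (mem_head _ _).
  have {}H1 : normc (E1 g - E1 f) < e / 2.
    by apply: H1 => //; apply: (lt_le_trans Hg); rewrite lee_fin ge_min lexx.
  have {}H2 : normc (E2 g - E2 f) < e / 2.
    by apply: H2 => //; apply: (lt_le_trans Hg); rewrite lee_fin ge_min lexx orbT.
  have tri (z w : C) : `|normc z - normc w| <= normc (w - z).
    rewrite ler_norml; apply/andP; split.
      rewrite lerNl opprB lerBlDr; have := le_normcD (w - z) z; by rewrite subrK.
    rewrite lerBlDr -(normcN (w - z)) opprB; have := le_normcD (z - w) w; by rewrite subrK.
  rewrite opprD addrACA (splitr e); apply: (le_lt_trans (ler_normD _ _)).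
  by apply: ltrD; [apply: le_lt_trans H1|apply: le_lt_trans H2]; exact: tri.
Qed.

End bounded_functionals.

(** With [s = ln r / t] the requirement is [b^2 - c^2 = s]. The same [e > 0] is added to the
    positive and negative parts of [s], so that neither [b] nor [c] vanishes; a small [e] keeps
    [b^2] at most [a^2] and the angle [2 b c t] in []0, pi[], which makes the eigenvalue
    non-real. *)
Lemma wave_parameters (R : realType) (t a r : R) : 0 < t -> 0 < a -> 0 < r ->
  r < expR (t * a ^+ 2) ->
  exists b c : R, [/\ `|b| <= a, expR ((b ^+ 2 - c ^+ 2) * t) = r & sin (2 * b * c * t) != 0].
Proof.
move=> t0 a0 r0 ra; pose s := ln r / t.
have sa : s < a ^+ 2.
  by rewrite ltr_pdivrMr// mulrC -ltr_expR lnK.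
pose sp := Num.max s 0; pose sn := Num.max (- s) 0.
have [sp0 sn0] : 0 <= sp /\ 0 <= sn by rewrite !le_max !lexx !orbT.
have spa : sp < a ^+ 2 by rewrite gt_max sa exprn_gt0.
have [sE sA sM] : [/\ sp - sn = s, sp + sn = `|s| & sp * sn = 0].
  have [s0|s0] := leP 0 s.
    have -> : sp = s by apply/max_idPl.
    have -> : sn = 0 by apply/max_idPr; rewrite oppr_le0.
    by rewrite subr0 addr0 mulr0 ger0_norm.
  have -> : sp = 0 by apply/max_idPr; exact: ltW.
  have -> : sn = - s by apply/max_idPl; rewrite oppr_ge0 ltW.
  by rewrite sub0r opprK add0r mul0r ltr0_norm.
(* As [b^2 c^2 = e (|s| + e)] and [e <= 1], the square of the angle [2 b c t] is at most [e D], and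
   [e] is chosen to make this at most 1. *)
pose D := 4 * t ^+ 2 * (`|s| + 1).
have D0 : 0 < D by rewrite !mulr_gt0 ?exprn_gt0// ltr_wpDl.
pose e := Num.min (Num.min (a ^+ 2 - sp) 1) D^-1.
have e0 : 0 < e by rewrite !lt_min subr_gt0 spa ltr01 invr_gt0 D0.
have ea : sp + e <= a ^+ 2 by rewrite -lerBrDl !ge_min lexx.
have e1 : e <= 1 by rewrite !ge_min lexx orbT.
have eD : e * D <= 1.
  by rewrite -ler_pdivlMr// div1r ge_min lexx orbT.
pose b := Num.sqrt (sp + e); pose c := Num.sqrt (sn + e).
have b2 : b ^+ 2 = sp + e by rewrite sqr_sqrtr// addr_ge0// ltW.
have c2 : c ^+ 2 = sn + e by rewrite sqr_sqrtr// addr_ge0// ltW.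
have b0 : 0 < b by rewrite sqrtr_gt0 ltr_wpDl.
have c0 : 0 < c by rewrite sqrtr_gt0 ltr_wpDl.
exists b, c; split.
- rewrite gtr0_norm// -(@ler_pXn2r _ 2) ?nnegrE ?b2//; exact: ltW.
- have -> : (b ^+ 2 - c ^+ 2) * t = ln r.
    by rewrite b2 c2 opprD addrACA subrr addr0 sE /s divfK// gt_eqF.
  by rewrite lnK.
have x0 : 0 < 2 * b * c * t by rewrite !mulr_gt0.
have x1 : 2 * b * c * t <= 1.
  rewrite -(@ler_pXn2r _ 2) ?nnegrE ?(ltW x0)// expr1n; apply: le_trans eD.
  have -> : (2 * b * c * t) ^+ 2 = 4 * t ^+ 2 * (b ^+ 2 * c ^+ 2) by ring.
  have -> : b ^+ 2 * c ^+ 2 = e * (`|s| + e).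
    by rewrite b2 c2 -sA mulrDl !mulrDr sM; ring.
  rewrite /D [leRHS]mulrCA; apply: ler_wpM2l; first by rewrite mulr_ge0// sqr_ge0.
  by apply: ler_wpM2l; [exact: ltW|rewrite lerD2l].
rewrite gt_eqF// sin_gt0_pi// x0/= (le_lt_trans x1)// (lt_le_trans _ (pi_ge2 R))//.
by rewrite ltr1n.
Qed.

Lemma normc_expz (R : realType) (z : R[i]) (k : int) : normc z = 1 -> normc (z ^ k) = 1.
Proof.
by move=> z1; case: k => n; rewrite /exprz ?normcV normcX z1 expr1n ?invr1.
Qed.

Lemma subcritical_sequence (R : realType) (d : nat) (j0 : 'I_d) (t a : R) (A : R[i]) :
  0 < t -> 0 < a -> normc A != 0 -> normc A < expR (t * a ^+ 2) ->
  exists2 T : int -> distr R d, heat_sequence t a A T &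
    ~ exists mu : R[i], Sa_eq a (distr_heat t (T 0)) (distr_scale mu (T 0)).
Proof.
move=> t0 a0 A0 Aa.
have nA0 : 0 < normc A by rewrite lt_def A0 normc_ge0.
have [b [c [ba bcA sn0]]] := wave_parameters t0 a0 nA0 Aa.
pose E1 := @wave_functional R d j0 b c; pose E2 := @wave_functional R d j0 b (- c).
pose mu1 := @wave_eigenvalue R d j0 b c t; pose mu2 := @wave_eigenvalue R d j0 b (- c) t.
have H1 f : Sa a f -> E1 (heat t f) = mu1 * E1 f by exact: wave_functional_heat.
have H2 f : Sa a f -> E2 (heat t f) = mu2 * E2 f by exact: wave_functional_heat.
have B k : bounded_functional a (2 * d) (@wave_functional R d j0 b k).
  split.
  - by move=> f g; exact: wave_functionalD.
  - by move=> z f; exact: wave_functionalZ.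
  - exists (4 * rint (@decay R d)).
      by rewrite mulr_ge0//; apply: rint_ge0 => x; exact: decay_ge0.
    by move=> f z; exact: wave_functional_bound.
have n1 : normc mu1 = normc A by rewrite normc_wave_eigenvalue.
have n2 : normc mu2 = normc A by rewrite normc_wave_eigenvalue// sqrrN.
have An0 : A != 0 by apply: contraNneq A0 => ->; rewrite normc0.
have q1 : normc (mu1 / A) = 1 by rewrite normcM normcV n1 divff.
have q2 : normc (mu2 / A) = 1 by rewrite normcM normcV n2 divff.
have nz (z : R[i]) : normc z = 1 -> z != 0.
  by move=> z1; apply: contra_eqN z1 => /eqP ->; rewrite normc0 eq_sym oner_eq0.
(* [mu1] and [mu2] have the modulus of [A], so these powers have modulus 1 for [k] of either sign,
   which gives a bound uniform in [k]. *)
pose T (k : int) : distr R d := fun f => (mu1 / A) ^ k * E1 f + (mu2 / A) ^ k * E2 f.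
exists T.
  split.
  - by move=> k; apply: bounded_functional_dual; apply: bounded_functional_comb; exact: B.
  - move=> k f sf; rewrite /distr_heat /distr_scale /T H1// H2//.
    rewrite !expfzDr ?nz// !expr1z; field.
    exact: An0.
  - exists (fun f => normc (E1 f) + normc (E2 f)), 1; split=> //.
      by apply: bounded_functional_seminorm; exact: B.
    move=> k f sf; rewrite mul1r; apply: (le_trans (le_normcD _ _)).
    by rewrite !normcM !normc_expz// !mul1r.
move=> [mu Hmu].
(* The two eigenvalues are complex conjugates, and they are not real by the choice of the angle. *)
have m12 : mu1 != mu2.
  rewrite /mu1 /mu2 !wave_eigenvalueE// sqrrN; set e := expR _.
  have -> : 2 * b * - c * t = - (2 * b * c * t) by ring.
  rewrite sinN; apply/eqP => /(congr1 (@complex.Im R)) /=; rewrite !mul0r !addr0.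
  have e0 : 0 < e by exact: expR_gt0.
  move=> /(mulfI (lt0r_neq0 e0)) /eqP; rewrite -subr_eq0 opprK -mulr2n mulrn_eq0 /=.
  by rewrite (negbTE sn0).
have sh (f : 'rV[R]_d -> R[i]) : Sa a f -> Sa a (heat t f).
  move=> /Sa_inS[s1 s2]; rewrite heat_pk; apply: Sa_pk.
    by apply: inS_rconv => //; exact: rapid_heat_kernel.
  by apply: inS_rconv => //; exact: rapid_heat_kernel.
have K f : Sa a f -> (mu1 - mu) * E1 f + (mu2 - mu) * E2 f = 0.
  move=> sf; have := Hmu f sf; rewrite /distr_heat /distr_scale /T !expr0z !mul1r H1// H2//.
  move=> /eqP; rewrite -subr_eq0 => /eqP <-; ring.
(* Independence of eigenvectors: [K] is used at [f] and at [heat t f], and [E2] is eliminated. Once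
   [mu = mu1], the same relation forces [E2] to vanish, which [wave_functional_neq0] excludes. *)
have K1 : mu = mu1.
  have [f sf nf] := wave_functional_neq0 j0 c ba.
  have x0 : E1 f != 0.
  apply/eqP => z0; move: nf; rewrite -/(E1 f) z0 normc0 => /esym/eqP.
  by rewrite gt_eqF// expR_gt0.
  have k1 := K f sf; have := K _ (sh _ sf); rewrite H1// H2// => k2.
  have /eqP : (mu1 - mu) * (mu1 - mu2) * E1 f = 0.
    have -> : (mu1 - mu) * (mu1 - mu2) * E1 f = (mu1 - mu) * (mu1 * E1 f) + (mu2 - mu) * (mu2 * E2 f)
       - mu2 * ((mu1 - mu) * E1 f + (mu2 - mu) * E2 f) by ring.
    by rewrite k1 k2 mulr0 subr0.
  by rewrite !mulf_eq0 (negbTE x0) orbF !subr_eq0 (negbTE m12) orbF => /eqP ->.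
have [f sf nf] := wave_functional_neq0 j0 (- c) ba.
have y0 : E2 f != 0.
  apply/eqP => z0; move: nf; rewrite -/(E2 f) z0 normc0 => /esym/eqP.
  by rewrite gt_eqF// expR_gt0.
have := K f sf; rewrite K1 subrr mul0r add0r => /eqP.
by rewrite mulf_eq0 (negbTE y0) orbF subr_eq0 eq_sym (negbTE m12).
Qed.

Theorem theorem3p6 (R : realType) (d : nat) (hd : (0 < d)%N) (t a : R)
    (ht : 0 < t) (ha : 0 < a) (A : R[i]) :
  [/\ normc A = expR (t * a ^+ 2) ->
      forall T : int -> distr R d, heat_sequence t a A T ->
        Sa_eq a (distr_laplacian (T 0)) (distr_scale (- (a ^+ 2))%:C%C (T 0)),
      normc A > expR (t * a ^+ 2) ->
      forall T : int -> distr R d, heat_sequence t a A T ->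
        Sa_eq a (T 0) (@distr_zero R d),
      normc A != 0 -> normc A < expR (t * a ^+ 2) ->
      exists2 T : int -> distr R d, heat_sequence t a A T &
        ~ exists mu : R[i], Sa_eq a (distr_heat t (T 0)) (distr_scale mu (T 0))
    & A = 0 ->
      forall T : int -> distr R d, heat_sequence t a A T ->
        forall k : int, Sa_eq a (T k) (@distr_zero R d)].
Proof.
split.
- by move=> hA T hT; exact (critical_eigen ha ht hT hd hA).
- by move=> hA T hT; exact (supercritical_zero ha ht hT hd hA).
- exact (subcritical_sequence (Ordinal hd) ht ha).
- by move=> hA T hT; exact (zero_vanish ha ht hT hA).
Qed.
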